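(* Let $(M,g,\nabla f,\lambda,\mu)$ be a compact gradient hyperbolic Ricci soliton with $\lambda\neq 0$ such that $\pounds_{\nabla f}\pounds_{\nabla f}g$ is trace-free. If $$\int_M \operatorname{Ric}(\nabla f,\nabla f)\geq \frac{1}{2\lambda}\int_M g(\nabla f,\nabla r),$$ then the soliton is trivial, i.e., $\pounds_{\nabla f}g=0$.
   Context: $(M,g)$ is a smooth Riemannian manifold, $f$ is a smooth real function on $M$, $\nabla f$ its gradient, $\operatorname{Ric}$ is the Ricci curvature and $r$ the scalar curvature of $(M,g)$. For a vector field $\xi$, $\pounds_\xi g$ is the Lie derivative of $g$ in the direction of $\xi$, and $\pounds_\xi\pounds_\xi g:=\pounds_\xi(\pounds_\xi g)$. A hyperbolic Ricci soliton $(M,g,\xi,\lambda,\mu)$ consists of $(M,g)$, a smooth vector field $\xi$ (the potential vector field) and two real scalars (constants) $\lambda,\mu$ such that $\pounds_\xi\pounds_\xi g+\lambda\pounds_\xi g+\operatorname{Ric}=\mu g$. It is gradient if $\xi=\nabla f$. It is called trivial if $\xi$ is a Killing vector field, i.e., $\pounds_\xi g=0$. Traces are taken with respect to $g$, trace-free means the trace vanishes identically, and integrals are with respect to the Riemannian measure. *)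

(* Defs.v *)
From HB Require Import structures.
From mathcomp Require Import all_boot all_order all_algebra.
From mathcomp Require Import all_classical all_reals all_analysis.

Set Implicit Arguments.
Unset Strict Implicit.
Unset Printing Implicit Defensive.

Import Order.TTheory GRing.Theory Num.Theory.
Import numFieldNormedType.Exports.

Local Open Scope classical_set_scope.
Local Open Scope ring_scope.

Definition partial (R : realType) n (i : 'I_n) (u : 'rV[R]_n -> R) :
  'rV[R]_n -> R := fun x => 'D_(delta_mx 0 i) u x.

(* Used only for open U, where continuity and derivatives at the points of U
   depend only on the restriction of u to U. *)
Fixpoint Ck_on (R : realType) n (k : nat) (U : set 'rV[R]_n)
    (u : 'rV[R]_n -> R) : Prop :=
  (forall x, U x -> {for x, continuous u}) /\
  match k with
  | 0 => True
  | k'.+1 => forall i : 'I_n,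
      (forall x, U x -> derivable u x (delta_mx 0 i)) /\
      Ck_on k' U (partial i u)
  end.

Definition smooth_on (R : realType) n (U : set 'rV[R]_n)
    (u : 'rV[R]_n -> R) : Prop := forall k, Ck_on k U u.

(* The values of chart_map off chart_dom and of chart_inv off chart_img are
   irrelevant. *)
Record chart (R : realType) (n : nat) (M : topologicalType) := Chart {
  chart_dom : set M;
  chart_img : set 'rV[R]_n;
  chart_map : M -> 'rV[R]_n;
  chart_inv : 'rV[R]_n -> M;
  chart_dom_open : open chart_dom;
  chart_img_open : open chart_img;
  chart_map_img : forall p, chart_dom p -> chart_img (chart_map p);
  chart_inv_dom : forall x, chart_img x -> chart_dom (chart_inv x);
  chart_mapK : forall p, chart_dom p -> chart_inv (chart_map p) = p;
  chart_invK : forall x, chart_img x -> chart_map (chart_inv x) = x;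
  chart_map_continuous : {within chart_dom, continuous chart_map};
  chart_inv_continuous : {within chart_img, continuous chart_inv} }.

Definition overlap (R : realType) n (M : topologicalType)
    (c d : chart R n M) : set 'rV[R]_n :=
  chart_img c `&` chart_inv c @^-1` chart_dom d.

Definition transition (R : realType) n (M : topologicalType)
    (c d : chart R n M) : 'rV[R]_n -> 'rV[R]_n :=
  chart_map d \o chart_inv c.

(* A smooth n-manifold without boundary, presented by a (not necessarily
   maximal) smooth atlas together with a chosen chart around each point. *)
Record smooth_manifold (R : realType) (n : nat) (M : topologicalType) :=
  SmoothManifold {
  manifold_hausdorff : hausdorff_space M;
  manifold_second_countable : @second_countable M;
  chart_index : Type;
  chart_of : chart_index -> chart R n M;
  index_at : M -> chart_index;
  index_atP : forall p, chart_dom (chart_of (index_at p)) p;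
  transition_smooth : forall (i j : chart_index) (a : 'I_n),
    smooth_on (overlap (chart_of i) (chart_of j))
      (fun x => transition (chart_of i) (chart_of j) x 0 a) }.

Section TensorFields.
Context {R : realType} {n : nat} {M : topologicalType}.
Variable A : smooth_manifold R n M.

(* Fields are given by their components in each chart of the atlas, as
   functions of the coordinates; only the values on chart_img matter. A vector
   field is a row of components X^a, a covariant 2-tensor field a matrix of
   components T_ab. *)
Definition sfield := chart_index A -> 'rV[R]_n -> R.
Definition vfield := chart_index A -> 'rV[R]_n -> 'rV[R]_n.
Definition tfield := chart_index A -> 'rV[R]_n -> 'M[R]_n.

Definition local_expr (f : M -> R) : sfield :=
  fun i => f \o chart_inv (chart_of i).

Definition smooth_function (f : M -> R) : Prop :=
  forall i, smooth_on (chart_img (chart_of i)) (local_expr f i).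

(* The value at a point of M of a scalar field whose expressions in the charts
   agree; it then does not depend on the chart index_at p. *)
Definition value_at (u : sfield) (p : M) : R :=
  u (index_at A p) (chart_map (chart_of (index_at A p)) p).

(* 'J is the Jacobian for row vectors: 'D_v F x = v *m 'J F x. *)
Definition smooth_vfield (X : vfield) : Prop :=
  (forall i a, smooth_on (chart_img (chart_of i)) (fun x => X i x 0 a)) /\
  (forall i j x, overlap (chart_of i) (chart_of j) x ->
     let t := transition (chart_of i) (chart_of j) in
     X j (t x) = X i x *m jacobian t x).

Definition smooth_tfield (T : tfield) : Prop :=
  (forall i a b, smooth_on (chart_img (chart_of i)) (fun x => T i x a b)) /\
  (forall i j x, overlap (chart_of i) (chart_of j) x ->
     let t := transition (chart_of i) (chart_of j) in
     T i x = jacobian t x *m T j (t x) *m (jacobian t x)^T).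

Definition eval2 (T : tfield) (X Y : vfield) : sfield :=
  fun i x => (X i x *m T i x *m (Y i x)^T) 0 0.

(* (L_X T)_ab = X^c d_c T_ab + (d_a X^c) T_cb + (d_b X^c) T_ac *)
Definition lie (X : vfield) (T : tfield) : tfield := fun i x =>
  \matrix_(a, b) \sum_c
    (X i x 0 c * partial c (fun y => T i y a b) x
     + partial a (fun y => X i y 0 c) x * T i x c b
     + partial b (fun y => X i y 0 c) x * T i x a c).

End TensorFields.

Arguments local_expr {R n M} A f _ _.

Record riemannian_metric (R : realType) n (M : topologicalType)
    (A : smooth_manifold R n M) := RiemannianMetric {
  metric_tensor :> chart_index A -> 'rV[R]_n -> 'M[R]_n;
  metric_smooth : smooth_tfield (A := A) metric_tensor;
  metric_sym : forall i x, chart_img (chart_of i) x ->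
    (metric_tensor i x)^T = metric_tensor i x;
  metric_pos : forall i x, chart_img (chart_of i) x ->
    forall v : 'rV[R]_n, v != 0 -> 0 < (v *m metric_tensor i x *m v^T) 0 0 }.

Section Riemannian.
Context {R : realType} {n : nat} {M : topologicalType}.
Context {A : smooth_manifold R n M}.
Variable g : riemannian_metric A.

Definition trace_metric (T : tfield A) : sfield A :=
  fun i x => \sum_a \sum_b invmx (g i x) a b * T i x a b.

Definition trace_free (T : tfield A) : Prop :=
  forall i x, chart_img (chart_of i) x -> trace_metric T i x = 0.

Definition grad (u : sfield A) : vfield A := fun i x =>
  \row_a \sum_b invmx (g i x) a b * partial b (u i) x.

(* christoffel c a b is Gamma^c_ab of the Levi-Civita connection. *)
Definition christoffel (c a b : 'I_n) : sfield A := fun i x =>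
  2^-1 * \sum_d invmx (g i x) c d *
    (partial a (fun y => g i y b d) x + partial b (fun y => g i y a d) x
     - partial d (fun y => g i y a b) x).

(* riemann l k a b is the l-th component of R(d_a, d_b) d_k, where
   R(X, Y) Z = D_X D_Y Z - D_Y D_X Z - D_[X,Y] Z. *)
Definition riemann (l k a b : 'I_n) : sfield A := fun i x =>
  partial a (christoffel l b k i) x - partial b (christoffel l a k i) x
  + \sum_m (christoffel l a m i x * christoffel m b k i x
            - christoffel l b m i x * christoffel m a k i x).

(* Ric(Y, Z) is the trace of X |-> R(X, Y) Z, nonnegative on round spheres. *)
Definition ricci : tfield A := fun i x =>
  \matrix_(j, k) \sum_l riemann l k l j i x.

Definition scalar_curvature : sfield A := trace_metric ricci.

Definition killing (xi : vfield A) : Prop :=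
  forall i x, chart_img (chart_of i) x -> lie xi g i x = 0.

Definition hyperbolic_ricci_soliton (xi : vfield A) (lambda mu : R) : Prop :=
  smooth_vfield xi /\
  forall i x, chart_img (chart_of i) x ->
    lie xi (lie xi g) i x + lambda *: lie xi g i x + ricci i x = mu *: g i x.

Definition trivial_soliton (xi : vfield A) : Prop := killing xi.

End Riemannian.

(* Iterated Lebesgue integral; by Tonelli this is the integral with respect to
   Lebesgue measure on R^n for nonnegative Borel functions, the only ones to
   which it is applied. *)
Fixpoint lebesgue_int (R : realType) (n : nat) :
    ('rV[R]_n -> \bar R) -> \bar R :=
  match n with
  | 0 => fun F => F 0
  | m.+1 => fun F =>
      (\int[lebesgue_measure]_(t in [set: R])
         lebesgue_int (fun y : 'rV[R]_m =>
           F (row_mx (const_mx t : 'rV[R]_1) y)))%E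
  end.

Definition borel (M : ptopologicalType) := g_sigma_algebraType (@open M).

(* The Riemannian measure is the unique Borel measure that is
   sqrt(det g) dx^1 ... dx^n in each chart. *)
Definition is_riemannian_measure (R : realType) n (M : ptopologicalType)
    (A : smooth_manifold R n M) (g : riemannian_metric A)
    (vol : {measure set (borel M) -> \bar R}) : Prop :=
  forall (i : chart_index A) (B : set (borel M)),
    measurable B -> B `<=` chart_dom (chart_of i) ->
    vol B = lebesgue_int (fun x : 'rV[R]_n =>
      (\1_(chart_img (chart_of i) `&` chart_inv (chart_of i) @^-1` B) x
       * Num.sqrt (\det (g i x)))%:E).

(* Main.v *)
(* For X = grad f, the identity div(D_X X) = Ric(X,X) + X(div X) + |D X|^2
   integrates to 0 over the compact M. As L_X L_X g is trace-free, the trace of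
   the soliton equation reads r = n mu - 2 lambda div X, so that X(div X) =
   - g(X, grad r) / (2 lambda), and the hypothesis forces the integral of
   |D X|^2 to be nonpositive. Hence D X = 0, and L_X g = 2 D X since X is a
   gradient. The divergence theorem is proved in charts with a C^1 partition of
   unity; the measure enters only through its chart expression. *)

Require Import Defs.
From HB Require Import structures.
From mathcomp Require Import all_boot all_order all_algebra.
From mathcomp Require Import all_classical all_reals all_analysis.
From mathcomp Require Import perm measurable_realfun.
From mathcomp Require Import ring lra.

Set Implicit Arguments.
Unset Strict Implicit.
Unset Printing Implicit Defensive.

Import Order.TTheory GRing.Theory Num.Theory.
Import numFieldNormedType.Exports.

Local Open Scope classical_set_scope.
Local Open Scope ring_scope.

(** * Calculus in R^n *)

(** [Ck_on] speaks of coordinate partial derivatives only, whereas the chain rule across charts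
    needs total differentiability; hence the passage from C^1 to differentiable below. Tensoriality
    is obtained without transforming Christoffel symbols: the vector field fed to the divergence
    theorem is 2 D_X X written as X^a (L_X g)_a^b, whose change of chart follows from that of [X]
    and of a Lie derivative, and the covariance of [ricci] is read off the soliton equation itself.
    The formula for div(D_X X) holds for every vector field with tr((D X)^2) in place of |D X|^2;
    for a gradient D X is self-adjoint, and then this trace is a squared norm. A zero integral
    yields pointwise vanishing by continuity and sqrt(det g) > 0, and a zero trace yields L_X g = 0
    through a factorisation g = P P^T. The cut-off max(t, 0)^2 is C^1, which is all that one
    integration by parts asks of the partition of unity. *)

Lemma continuous_at_sum (R : realType) (T : topologicalType) (I : Type)
    (r : seq I) (P : pred I) (F : I -> T -> R) (x : T) :
  (forall i, P i -> {for x, continuous (F i)}) ->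
  {for x, continuous (fun y => \sum_(i <- r | P i) F i y)}.
Proof.
move=> cF; elim: r => [|i r IH].
  rewrite (_ : (fun _ => _) = cst 0); first exact: cst_continuous.
  by apply/funext => y; rewrite big_nil.
have [Pi|nPi] := boolP (P i).
- rewrite (_ : (fun _ => _) = F i \+ (fun y => \sum_(i <- r | P i) F i y)).
    exact: continuousD (cF i Pi) IH.
  by apply/funext => y; rewrite big_cons Pi.
- rewrite (_ : (fun _ => _) = (fun y => \sum_(i <- r | P i) F i y)) //.
  by apply/funext => y; rewrite big_cons (negbTE nPi).
Qed.

Section MatrixNorm.
Context {R : realType} {m n : nat}.
Implicit Types v : 'M[R]_(m, n).

Lemma mx_coord_le_norm v i j : `|v i j| <= `|v|.
Proof.
rewrite [leRHS]/Num.Def.normr/= mx_normrE.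
exact: (le_bigmax _ _ (i, j)).
Qed.

Lemma mx_norm_le v e : 0 <= e -> (forall i j, `|v i j| <= e) -> `|v| <= e.
Proof.
move=> e0 ve; rewrite [leLHS]/Num.Def.normr/= mx_normrE.
by apply: bigmax_le => // -[i j] _; exact: ve.
Qed.

Lemma mx_norm_lt v e : 0 < e -> (forall i j, `|v i j| < e) -> `|v| < e.
Proof.
move=> e0 ve; rewrite [ltLHS]/Num.Def.normr/= mx_normrE.
by apply: bigmax_lt => // -[i j] _; exact: ve.
Qed.

End MatrixNorm.

Section C1Calculus.
Context {R : realType} {n : nat}.
Implicit Types (U : set 'rV[R]_n) (u v : 'rV[R]_n -> R) (x y : 'rV[R]_n).

Lemma row_delta_norm (i : 'I_n) (t : R) :
  `|t *: (delta_mx 0 i : 'rV[R]_n)| <= `|t|.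
Proof.
apply: mx_norm_le => // a b; rewrite !mxE.
by case: (_ && _); rewrite ?mulr1 ?mulr0 ?normr0.
Qed.

Lemma is_derive_line u y (w : 'rV[R]_n) (t : R) :
  derivable u (y + t *: w) w ->
  is_derive t (1 : R) (fun s => u (y + s *: w)) ('D_w u (y + t *: w)).
Proof.
rewrite /derivable /derive => H.
have E : (fun h : R => h^-1 *: (((fun s => u (y + s *: w)) \o shift t) (h *: (1:R))
       - u (y + t *: w)))
   = (fun h : R => h^-1 *: ((u \o shift (y + t *: w)) (h *: w) - u (y + t *: w))).
  apply/funext => h /=; congr (_ *: (u _ - _)).
  by rewrite [h *: 1]mulr1 scalerDl addrCA.
by apply: DeriveDef; rewrite /derivable /derive E.
Qed.

Lemma partial_MVT_ge0 u y (i : 'I_n) (h : R) : 0 <= h ->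
  (forall t, 0 <= t <= h -> derivable u (y + t *: delta_mx 0 i) (delta_mx 0 i)) ->
  exists2 c, 0 <= c <= h &
    u (y + h *: delta_mx 0 i) - u y = h * partial i u (y + c *: delta_mx 0 i).
Proof.
move=> h0 du; set e := delta_mx 0 i in du *.
have dl t : 0 <= t <= h -> is_derive t (1:R) (fun s => u (y + s *: e))
    ('D_e u (y + t *: e)).
  by move=> /du; exact: is_derive_line.
have [|t /[!in_itv]/= /andP[t0 th]||c] :=
    @MVT_segment R (fun s => u (y + s *: e)) (fun t => 'D_e u (y + t *: e)) 0 h.
- exact: h0.
- by apply: dl; rewrite (ltW t0) ltW.
- apply: derivable_within_continuous => t /[!in_itv]/= /dl dt.
  exact: ex_derive.
rewrite in_itv/= => ch; rewrite scale0r addr0 subr0 => E.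
by exists c => //; rewrite E mulrC.
Qed.

Lemma partial_MVT u y (i : 'I_n) (h : R) :
  (forall t, `|t| <= `|h| -> derivable u (y + t *: delta_mx 0 i) (delta_mx 0 i)) ->
  exists2 c, `|c| <= `|h| &
    u (y + h *: delta_mx 0 i) - u y = h * partial i u (y + c *: delta_mx 0 i).
Proof.
move=> du; have [h0|h0] := leP 0 h.
  have [t /andP[t0 th]|c /andP[c0 ch] E] := partial_MVT_ge0 (u := u) (y := y) (i := i) h0.
    by apply: du; rewrite !ger0_norm.
  by exists c => //; rewrite !ger0_norm.
(* For h < 0 the segment is traversed from its other end y + h e by the positive length -h; the
   intermediate point c is measured from there, hence the witness h + c. *)
set e := delta_mx 0 i in du *.
have h0' : 0 <= - h by rewrite oppr_ge0 ltW.
have [t /andP[t0 th]|c /andP[c0 ch] E] :=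
    partial_MVT_ge0 (u := u) (y := y + h *: e) (i := i) h0'.
  rewrite -addrA -scalerDl; apply: du.
  by rewrite [leRHS]ltr0_norm// ler_norml; apply/andP; split; lra.
exists (h + c).
  by rewrite [leRHS]ltr0_norm// ler_norml; apply/andP; split; lra.
move: E; rewrite scaleNr addrK -/e => E.
apply: oppr_inj; rewrite opprB E.
by rewrite mulNr scalerDl addrA.
Qed.

Lemma Ck_on_le k l U u : (l <= k)%N -> Ck_on k U u -> Ck_on l U u.
Proof.
elim: k l u => [|k IH] l u; first by rewrite leqn0 => /eqP->.
case: l => [_ [] //|l lk [cu du]]; split => // i; have [? ?] := du i.
by split => //; exact: IH.
Qed.

Lemma nbhs_open_ball U x : open U -> U x ->
  exists2 d : R, 0 < d & forall y, `|y - x| < d -> U y.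
Proof.
move=> oU Ux; have /nbhs_ballP[d /= d0 dU] : nbhs x U by exact: open_nbhs_nbhs.
by exists d => // y xy; apply: dU; rewrite -ball_normE /= distrC.
Qed.

(** Vertices of the staircase path from 0 to [h] that switches on one coordinate at a time, so that
    each edge is parallel to an axis. *)
Let trunc (h : 'rV[R]_n) (k : nat) : 'rV[R]_n :=
  \row_j (if (j < k)%N then h 0 j else 0).

Let trunc_norm h k : `|trunc h k| <= `|h|.
Proof.
apply: mx_norm_le => // i j; rewrite !mxE; case: ifP => _.
  by rewrite mx_coord_le_norm.
by rewrite normr0.
Qed.

Let truncS h (k : nat) (kn : (k < n)%N) :
  trunc h k.+1 = trunc h k + h 0 (Ordinal kn) *: delta_mx 0 (Ordinal kn).
Proof.
apply/rowP => j; rewrite !mxE eqxx/=.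
have [jk|jk|jk] := ltngtP j k.
- rewrite ltnS ltnW//; case: eqP => [je|]; last by rewrite mulr0 addr0.
  by move: jk; rewrite je /= ltnn.
- rewrite ltnS leqNgt jk /=; case: eqP => [je|]; last by rewrite mulr0 addr0.
  by move: jk; rewrite je /= ltnn.
- have -> : j = Ordinal kn by apply: val_inj.
  by rewrite /= ltnSn eqxx mulr1 add0r.
Qed.

(** The mean value theorem on each edge of the staircase costs at most e |h|. The radius d / 2 is
    there because a point of an edge is a truncation of [h] plus a further step of size at most
    |h|. *)
Let small_increment u x e d :
  0 <= e ->
  (forall i y, `|y - x| < d -> derivable u y (delta_mx 0 i)) ->
  (forall i y, `|y - x| < d -> `|partial i u y - partial i u x| <= e) ->
  forall h : 'rV[R]_n, `|h| < d / 2 -> forall k, (k <= n)%N ->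
  `|u (x + trunc h k) - u x
     - \sum_(i < n | (i < k)%N) h 0 i * partial i u x| <= k%:R * (e * `|h|).
Proof.
move=> e0 du pu h hd; elim => [|k IH] kn.
  rewrite big1 ?subr0 ?mul0r; last by [].
  have -> : trunc h 0 = 0 by apply/rowP => j; rewrite !mxE.
  by rewrite addr0 subrr normr0.
set i0 := Ordinal kn.
have near_c c : `|c| <= `|h 0 i0| ->
    `|x + trunc h k + c *: delta_mx 0 i0 - x| < d.
  move=> ch; rewrite addrC -!addrA addKr.
  rewrite (le_lt_trans (ler_normD _ _))// (splitr d) ler_ltD//.
    by rewrite (le_trans (trunc_norm _ _))// ltW.
  rewrite (le_lt_trans (row_delta_norm _ _))//.
  by rewrite (le_lt_trans ch)// (le_lt_trans (mx_coord_le_norm _ _ _)).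
have [t th|c ch E] := @partial_MVT u (x + trunc h k) i0 (h 0 i0).
  exact/du/near_c.
rewrite (bigD1 i0)//=.
rewrite (eq_bigl (fun i : 'I_n => (i < k)%N)); last first.
  move=> i; rewrite ltnS leq_eqVlt andb_orl -(inj_eq val_inj) /=.
  by case: ltngtP; rewrite ?andbF ?orbF.
rewrite truncS -/i0 addrA.
rewrite (_ : _ - _ = (u (x + trunc h k) - u x -
    \sum_(i < n | (i < k)%N) h 0 i * partial i u x) +
  (u (x + trunc h k + h 0 i0 *: delta_mx 0 i0) - u (x + trunc h k)
   - h 0 i0 * partial i0 u x)); last by ring.
rewrite (le_trans (ler_normD _ _))// -natr1 mulrDl lerD ?IH ?(ltnW kn)//.
rewrite mul1r E -mulrBr normrM mulrC ler_pM//.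
  exact/pu/near_c.
exact: mx_coord_le_norm.
Qed.

Let diff_form (a : 'I_n -> R) (h : 'rV[R]_n) : R := \sum_i h 0 i * a i.

Let diff_form_linear a : linear (diff_form a : 'rV[R]_n -> R^o).
Proof.
move=> k h1 h2; rewrite /diff_form scaler_sumr -big_split/=.
by apply: eq_bigr => i _; rewrite !mxE mulrDl -mulrA.
Qed.

Lemma C1_differentiable U u x : open U -> Ck_on 1 U u -> U x ->
  differentiable u x.
Proof.
move=> oU [cu du] Ux.
have [d1 d10 d1U] := nbhs_open_ball oU Ux.
pose a i := partial i u x.
pose dfL := GRing.isLinear.Build _ _ _ _ _ (diff_form_linear a).
pose df : {linear 'rV[R]_n -> R^o} := HB.pack (diff_form a) dfL.
have dfc : continuous df.
  move=> h; rewrite /df /= /diff_form.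
  apply: continuous_at_sum => i _.
  by apply: continuousM; [exact: coord_continuous|exact: cst_continuous].
have dfE : (u : 'rV[R]_n -> R^o) \o shift x = cst (u x : R^o) + df +o_ (0 : 'rV[R]_n) id.
  apply/eqaddoP => _/posnumP[e].
  (* The n edges together cost n (e / (n + 1)) |h| <= e |h|; the denominator n + 1 also covers
     dimension 0. *)
  have [d /= [d0 dd1] pu] : exists2 d, 0 < d /\ d <= d1 &
      forall i y, `|y - x| < d -> `|partial i u y - partial i u x| <= e%:num / n.+1%:R.
    have : \forall y \near x, forall i,
       `|partial i u y - partial i u x| <= e%:num / n.+1%:R.
      apply: (@filter_forall _ _ (fun i y => `|partial i u y - partial i u x| <= e%:num / n.+1%:R) (nbhs x)) => i.
      have [_ [cpu _]] := du i; have := cpu x Ux.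
      move=> /cvgrPdist_le /(_ (e%:num / n.+1%:R)); rewrite divr_gt0// => /(_ isT).
      by apply: filterS => y; rewrite distrC.
    move=> /nbhs_ballP[d /= d0 H]; exists (Num.min d d1).
      by rewrite lt_min d0 d10; split => //; rewrite ge_min lexx orbT.
    move=> i y; rewrite lt_min => /andP[yd _]; apply: H.
    by rewrite -ball_normE /= distrC.
  have e1 : 0 <= e%:num / n.+1%:R by rewrite divr_ge0.
  have du' i y : `|y - x| < d -> derivable u y (delta_mx 0 i).
    move=> yd; have [+ _] := du i; apply.
    by apply: d1U; exact: lt_le_trans yd dd1.
  have S := small_increment e1 du' pu.
  apply/nbhs_ballP; exists (d / 2); first by rewrite /= divr_gt0.
  move=> h; rewrite -ball_normE /= sub0r normrN => hd.
  have := S h hd n (leqnn n).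
  have -> : trunc h n = h by apply/rowP => j; rewrite !mxE ltn_ord.
  rewrite (eq_bigl xpredT); last by move=> i; rewrite ltn_ord.
  rewrite addrC.
  set A := (X in X <= _ -> _); set B := (X in _ -> X <= _).
  have -> : B = A.
    rewrite /A /B !fctE /= [h + x]addrC opprD addrA /df /= /diff_form /a.
    by rewrite [in RHS]addrC.
  move=> /le_trans; apply.
  rewrite mulrA ler_wpM2r// mulrCA ger_pMr//.
  by rewrite ler_pdivrMr// mul1r ler_nat.
by apply/diff_locallyP; rewrite (diff_unique dfc dfE).
Qed.

Lemma C1_partial_continuous U u x i : Ck_on 1 U u -> U x ->
  {for x, continuous (partial i u)}.
Proof. by move=> [_ /(_ i) [_ [H _]]] /H. Qed.

(** Schwarz's argument: the second difference of [u] over a small square is symmetric in the two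
    sides, and two uses of the mean value theorem turn it into h^2 times either mixed derivative at
    a point near [x]. *)
Lemma partial_symmetric U u x (i j : 'I_n) : open U -> Ck_on 2 U u -> U x ->
  partial i (partial j u) x = partial j (partial i u) x.
Proof.
move=> oU cu Ux.
have [d d0 dU] := nbhs_open_ball oU Ux.
have d1 (a : 'I_n) y : U y -> derivable u y (delta_mx 0 a).
  by case: cu => _ /(_ a) [+ _]; apply.
have d2 (a b : 'I_n) y : U y -> derivable (partial a u) y (delta_mx 0 b).
  by case: cu => _ /(_ a) [_ [_ /(_ b) [+ _]]]; apply.
have c2 (a b : 'I_n) : {for x, continuous (partial b (partial a u))}.
  by case: cu => _ /(_ a) [_ [_ /(_ b) [_ [+ _]]]]; apply.
pose box (a b : 'I_n) s t : 'rV[R]_n := x + s *: delta_mx 0 a + t *: delta_mx 0 b.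
have box_near a b s t h : 0 <= s <= h -> 0 <= t <= h -> `|box a b s t - x| <= h + h.
  move=> /andP[s0 sh] /andP[t0 th].
  rewrite /box addrC -!addrA addKr (le_trans (ler_normD _ _))//.
  by rewrite lerD// (le_trans (row_delta_norm _ _))// ger0_norm.
have second_diff a b h : 0 < h -> h + h < d -> exists y,
   `|y - x| <= h + h /\
   u (box a b h h) - u (box a b h 0) - (u (box a b 0 h) - u (box a b 0 0))
    = h * (h * partial b (partial a u) y).
  move=> h0 hd.
  (* The second difference is the first difference of [w] in direction a; the mean value theorem in
     direction a, then in direction b, produces the point (s, t) of the square. *)
  pose w y := u (y + h *: delta_mx 0 b) - u y.
  have dw t : 0 <= t <= h -> is_derive (x + t *: delta_mx 0 a) (delta_mx 0 a) w
     (partial a u (box a b t h) - partial a u (box a b t 0)).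
    move=> th.
    have U1 : U (box a b t h).
      apply: dU; apply: le_lt_trans (box_near _ _ _ _ h _ _) hd => //.
      by rewrite (ltW h0) lexx.
    have U2 : U (box a b t 0).
      apply: dU; apply: le_lt_trans (box_near _ _ _ _ h _ _) hd => //.
      by rewrite (ltW h0) lexx.
    have D1 := derivableP (d1 a _ U1).
    have D2 := derivableP (d1 a _ U2).
    rewrite /box scale0r addr0 in D2.
    rewrite {2}/box scale0r addr0; apply: is_deriveB.
    case: D1 => D1 _; rewrite /partial -/(box a b t h).
    have E : (fun k : R => k^-1 *: (((fun y => u (y + h *: delta_mx 0 b))
         \o shift (x + t *: delta_mx 0 a)) (k *: delta_mx 0 a)
         - u (x + t *: delta_mx 0 a + h *: delta_mx 0 b)))
      = (fun k : R => k^-1 *: ((u \o shift (box a b t h)) (k *: delta_mx 0 a)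
            - u (box a b t h))).
      by apply/funext => k /=; rewrite /box !addrA.
    by apply: DeriveDef; rewrite /derivable /derive E.
  have [t th|s sh E] := partial_MVT_ge0 (u := w) (y := x) (i := a) (ltW h0).
    by case: (dw t th).
  have Us t : 0 <= t <= h -> U (box a b s t).
    by move=> th; apply: dU; apply: le_lt_trans (box_near _ _ _ _ h _ _) hd.
  have [t th|t th E'] := partial_MVT_ge0 (u := partial a u)
      (y := x + s *: delta_mx 0 a) (i := b) (ltW h0).
    exact/d2/Us.
  exists (box a b s t); split; first exact: box_near.
  rewrite -E' mulrBr.
  move: E; rewrite /w /partial (@derive_val _ _ _ _ _ _ _ (dw s sh)).
  by rewrite /box !scale0r !addr0 mulrBr.
apply/eqP; rewrite -subr_eq0 -normr_le0; apply/ler_addgt0Pl => e e0; rewrite addr0.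
have e20 : 0 < e / 2 by rewrite divr_gt0.
have /nbhs_ballP[r /= r0 Hr] : \forall y \near x,
   `|partial i (partial j u) x - partial i (partial j u) y| <= e / 2 /\
   `|partial j (partial i u) x - partial j (partial i u) y| <= e / 2.
  have /cvgrPdist_le /(_ _ e20) Hj := c2 j i.
  have /cvgrPdist_le /(_ _ e20) Hi := c2 i j.
  exact: filterI Hj Hi.
(* Points of the square lie within 2h of [x]; the quarter puts them both in [U] and in the ball
   where the mixed derivatives vary by at most e / 2. *)
pose h := Num.min d r / 4.
have m0 : 0 < Num.min d r by rewrite lt_min d0 r0.
have h0 : 0 < h by rewrite divr_gt0.
have hm : h + h < Num.min d r by rewrite /h; lra.
have [hd hr] : h + h < d /\ h + h < r by move: hm; rewrite lt_min => /andP.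
have [y [yh Ey]] := second_diff j i h h0 hd.
have [z [zh Ez]] := second_diff i j h h0 hd.
have /Hr[Hy _] : ball x r y.
  by rewrite -ball_normE/= distrC (le_lt_trans yh).
have /Hr[_ Hz] : ball x r z.
  by rewrite -ball_normE/= distrC (le_lt_trans zh).
have yz : partial i (partial j u) y = partial j (partial i u) z.
  apply: (mulfI (lt0r_neq0 h0)); apply: (mulfI (lt0r_neq0 h0)).
  apply: etrans (esym Ey) (etrans _ Ez).
  have boxC s t : box j i s t = box i j t s by rewrite /box addrAC.
  rewrite !boxC.
  move: (u _) (u _) (u _) (u _) => p q r' s.
  by rewrite !opprD !opprK !addrA; congr (_ + _); rewrite addrAC.
move: Hy Hz; rewrite -yz.
move: (partial i _ x) (partial j _ x) (partial i _ y) => p q r' Hy Hz.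
apply: le_trans (ler_distD r' _ _) _.
by rewrite (splitr e) [`|r' - q|]distrC lerD.
Qed.

End C1Calculus.

Section Partials.
Context {R : realType} {n : nat}.
Implicit Types (U : set 'rV[R]_n) (u v : 'rV[R]_n -> R) (x y : 'rV[R]_n).

Definition has_partials u x := forall i : 'I_n, derivable u x (delta_mx 0 i).

Lemma has_partials_cst (c : R) x : has_partials (fun=> c) x.
Proof. by move=> i; exact: derivable_cst. Qed.

Lemma partial_cst i (c : R) x : partial i (fun=> c) x = 0.
Proof. exact: derive_cst. Qed.

Lemma has_partialsD u v x : has_partials u x -> has_partials v x ->
  has_partials (fun y => u y + v y) x.
Proof. by move=> du dv i; exact: derivableD. Qed.

Lemma partialD i u v x : has_partials u x -> has_partials v x ->
  partial i (fun y => u y + v y) x = partial i u x + partial i v x.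
Proof. by move=> du dv; exact: deriveD. Qed.

Lemma has_partialsM u v x : has_partials u x -> has_partials v x ->
  has_partials (fun y => u y * v y) x.
Proof. by move=> du dv i; exact: derivableM. Qed.

Lemma partialM i u v x : has_partials u x -> has_partials v x ->
  partial i (fun y => u y * v y) x = partial i u x * v x + u x * partial i v x.
Proof.
move=> du dv; rewrite /partial [LHS]deriveM//.
by rewrite addrC; congr (_ + _); exact: mulrC.
Qed.

Lemma has_partialsV u x : u x != 0 -> has_partials u x ->
  has_partials (fun y => (u y)^-1) x.
Proof. by move=> u0 du i; exact: derivableV. Qed.

Lemma partialV i u x : u x != 0 -> has_partials u x ->
  partial i (fun y => (u y)^-1) x = - (partial i u x * ((u x)^-1 * (u x)^-1)).
Proof.
move=> u0 du; rewrite /partial [LHS]deriveV//.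
by rewrite scaleNr -exprVn expr2 [_ *: _]mulrC.
Qed.

Lemma has_partials_sum (I : Type) (r : seq I) (P : pred I)
    (F : I -> 'rV[R]_n -> R) x :
  (forall i, P i -> has_partials (F i) x) ->
  has_partials (fun y => \sum_(i <- r | P i) F i y) x.
Proof.
move=> dF; elim: r => [|a r IH].
  rewrite (_ : (fun _ => _) = (fun=> 0)); first exact: has_partials_cst.
  by apply/funext => y; rewrite big_nil.
have [Pa|nPa] := boolP (P a).
- rewrite (_ : (fun _ => _) = (fun y => F a y + \sum_(i <- r | P i) F i y)).
    exact: has_partialsD (dF a Pa) IH.
  by apply/funext => y; rewrite big_cons Pa.
- rewrite (_ : (fun _ => _) = (fun y => \sum_(i <- r | P i) F i y)) //.
  by apply/funext => y; rewrite big_cons (negbTE nPa).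
Qed.

Lemma partial_sum i (I : Type) (r : seq I) (P : pred I)
    (F : I -> 'rV[R]_n -> R) x :
  (forall i, P i -> has_partials (F i) x) ->
  partial i (fun y => \sum_(i <- r | P i) F i y) x =
  \sum_(j <- r | P j) partial i (F j) x.
Proof.
move=> dF; elim: r => [|a r IH].
  rewrite (_ : (fun _ => _) = (fun=> 0)); first by rewrite partial_cst big_nil.
  by apply/funext => y; rewrite big_nil.
have [Pa|nPa] := boolP (P a).
- rewrite (_ : (fun _ => _) = (fun y => F a y + \sum_(i <- r | P i) F i y)).
    rewrite big_cons Pa -IH; apply: partialD (dF a Pa) _.
    exact: has_partials_sum.
  by apply/funext => y; rewrite big_cons Pa.
- rewrite (_ : (fun _ => _) = (fun y => \sum_(i <- r | P i) F i y)).
    by rewrite big_cons (negbTE nPa).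
  by apply/funext => y; rewrite big_cons (negbTE nPa).
Qed.

Lemma open_near U x : open U -> U x -> \forall y \near x, U y.
Proof. by move=> oU Ux; exact: open_nbhs_nbhs. Qed.

Lemma near_eq_on U u v x : open U -> U x -> (forall y, U y -> u y = v y) ->
  \forall y \near x, u y = v y.
Proof.
by move=> oU Ux uv; have := open_near oU Ux; apply: filterS => y; exact: uv.
Qed.

Lemma partial_eq_on U i u v x : open U -> U x -> (forall y, U y -> u y = v y) ->
  partial i u x = partial i v x.
Proof. by move=> oU Ux uv; apply: near_eq_derive; exact: near_eq_on oU Ux uv. Qed.

Lemma continuous_eq_on U u v x : open U -> U x ->
  (forall y, U y -> u y = v y) ->
  {for x, continuous u} -> {for x, continuous v}.
Proof.
move=> oU Ux uv cu; rewrite /prop_for /continuous_at -uv//.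
exact: cvg_trans (near_eq_cvg (near_eq_on oU Ux uv)) cu.
Qed.

Lemma Ck_on_eq k U u v : open U -> (forall y, U y -> u y = v y) ->
  Ck_on k U u -> Ck_on k U v.
Proof.
move=> oU; elim: k u v => [|k IH] u v uv [cu du]; split.
- by move=> x Ux; exact: continuous_eq_on oU Ux uv (cu x Ux).
- by [].
- by move=> x Ux; exact: continuous_eq_on oU Ux uv (cu x Ux).
- move=> i; have [dui ci] := du i; split.
    move=> x Ux; exact: near_eq_derivable (near_eq_on oU Ux uv) (dui x Ux).
  by apply: IH ci => y Uy; exact: partial_eq_on oU Uy uv.
Qed.

Lemma Ck_on_has_partials k U u x : Ck_on k.+1 U u -> U x -> has_partials u x.
Proof. by move=> [_ du] Ux i; have [+ _] := du i; apply. Qed.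

Lemma Ck_on_partial k U u i : Ck_on k.+1 U u -> Ck_on k U (partial i u).
Proof. by move=> [_ /(_ i)[]]. Qed.

Lemma Ck_on_continuous k U u x : Ck_on k U u -> U x -> {for x, continuous u}.
Proof. by case: k => [|k] [+ _]; apply. Qed.

Lemma Ck_onS k U u : open U -> (forall x, U x -> {for x, continuous u}) ->
  (forall x, U x -> has_partials u x) ->
  (forall i, Ck_on k U (partial i u)) -> Ck_on k.+1 U u.
Proof. by move=> oU cu du ci; split => // i; split => // x Ux; exact: du. Qed.

Lemma Ck_on_cst k U (c : R) : open U -> Ck_on k U (fun=> c).
Proof.
move=> oU; elim: k c => [|k IH] c.
  by split => // x _; exact: cst_continuous.
apply: Ck_onS => //.
- by move=> x _; exact: cst_continuous.
- by move=> x _; exact: has_partials_cst.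
- by move=> i; apply: Ck_on_eq (IH 0) => // y _; rewrite partial_cst.
Qed.

Lemma Ck_onD k U u v : open U -> Ck_on k U u -> Ck_on k U v ->
  Ck_on k U (fun y => u y + v y).
Proof.
move=> oU; elim: k u v => [|k IH] u v cu cv.
  split => // x Ux; apply: continuousD.
    exact: Ck_on_continuous cu Ux.
  exact: Ck_on_continuous cv Ux.
apply: Ck_onS => //.
- move=> x Ux; apply: continuousD.
    exact: Ck_on_continuous cu Ux.
  exact: Ck_on_continuous cv Ux.
- by move=> x Ux; apply: has_partialsD; [exact: Ck_on_has_partials cu Ux|exact: Ck_on_has_partials cv Ux].
- move=> i; apply: (Ck_on_eq _ _ (IH _ _ (Ck_on_partial i cu) (Ck_on_partial i cv))) => //.
  by move=> y Uy; rewrite partialD//; [exact: Ck_on_has_partials cu Uy|exact: Ck_on_has_partials cv Uy].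
Qed.

Lemma Ck_onM k U u v : open U -> Ck_on k U u -> Ck_on k U v ->
  Ck_on k U (fun y => u y * v y).
Proof.
move=> oU; elim: k u v => [|k IH] u v cu cv.
  split => // x Ux; apply: continuousM.
    exact: Ck_on_continuous cu Ux.
  exact: Ck_on_continuous cv Ux.
apply: Ck_onS => //.
- move=> x Ux; apply: continuousM.
    exact: Ck_on_continuous cu Ux.
  exact: Ck_on_continuous cv Ux.
- by move=> x Ux; apply: has_partialsM; [exact: Ck_on_has_partials cu Ux|exact: Ck_on_has_partials cv Ux].
- move=> i.
  apply: (@Ck_on_eq _ _ (fun y => partial i u y * v y + u y * partial i v y)) => //.
    by move=> y Uy; rewrite partialM//; [exact: Ck_on_has_partials cu Uy|exact: Ck_on_has_partials cv Uy].
  apply: Ck_onD => //; apply: IH.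
  + exact: Ck_on_partial.
  + exact: Ck_on_le cv.
  + exact: Ck_on_le cu.
  + exact: Ck_on_partial.
Qed.

Lemma Ck_onN k U u : open U -> Ck_on k U u -> Ck_on k U (fun y => - u y).
Proof.
move=> oU cu; apply: (@Ck_on_eq _ _ (fun y => -1 * u y)) => //.
  by move=> y _; rewrite mulN1r.
by apply: Ck_onM => //; exact: Ck_on_cst.
Qed.

Lemma Ck_onB k U u v : open U -> Ck_on k U u -> Ck_on k U v ->
  Ck_on k U (fun y => u y - v y).
Proof. by move=> oU cu cv; apply: Ck_onD => //; exact: Ck_onN. Qed.

(** The derivative of 1/u is a product of a derivative of u and of 1/u itself, so order k of the
    inverse gives order k + 1. *)
Lemma Ck_onV k U u : open U -> (forall y, U y -> u y != 0) -> Ck_on k U u ->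
  Ck_on k U (fun y => (u y)^-1).
Proof.
move=> oU u0 cu.
have cV x : U x -> {for x, continuous (fun y => (u y)^-1)}.
  by move=> Ux; apply: continuousV; [exact: u0|exact: Ck_on_continuous cu Ux].
elim: k cu => [|k IH] cu; first by split => // x Ux; exact: cV.
have cVk := IH (Ck_on_le (leqnSn k) cu).
apply: Ck_onS => // [x Ux|i].
  by apply: has_partialsV; [exact: u0|exact: Ck_on_has_partials cu Ux].
apply: (@Ck_on_eq _ _ (fun y => - (partial i u y * ((u y)^-1 * (u y)^-1)))) => //.
  move=> y Uy; rewrite partialV//; first exact: u0.
  exact: Ck_on_has_partials cu Uy.
by apply: Ck_onN => //; apply: Ck_onM => //;
  [exact: Ck_on_partial|exact: Ck_onM].
Qed.

Lemma Ck_on_sum k U (I : Type) (r : seq I) (P : pred I)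
    (F : I -> 'rV[R]_n -> R) : open U ->
  (forall i, P i -> Ck_on k U (F i)) ->
  Ck_on k U (fun y => \sum_(i <- r | P i) F i y).
Proof.
move=> oU dF; elim: r => [|a r IH].
  rewrite (_ : (fun _ => _) = (fun=> 0)); first exact: Ck_on_cst.
  by apply/funext => y; rewrite big_nil.
have [Pa|nPa] := boolP (P a).
- rewrite (_ : (fun _ => _) = (fun y => F a y + \sum_(i <- r | P i) F i y)).
    exact: Ck_onD (dF a Pa) IH.
  by apply/funext => y; rewrite big_cons Pa.
- rewrite (_ : (fun _ => _) = (fun y => \sum_(i <- r | P i) F i y)) //.
  by apply/funext => y; rewrite big_cons (negbTE nPa).
Qed.

Lemma Ck_on_prod k U (I : Type) (r : seq I) (P : pred I)
    (F : I -> 'rV[R]_n -> R) : open U ->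
  (forall i, P i -> Ck_on k U (F i)) ->
  Ck_on k U (fun y => \prod_(i <- r | P i) F i y).
Proof.
move=> oU dF; elim: r => [|a r IH].
  rewrite (_ : (fun _ => _) = (fun=> 1)); first exact: Ck_on_cst.
  by apply/funext => y; rewrite big_nil.
have [Pa|nPa] := boolP (P a).
- rewrite (_ : (fun _ => _) = (fun y => F a y * \prod_(i <- r | P i) F i y)).
    exact: Ck_onM (dF a Pa) IH.
  by apply/funext => y; rewrite big_cons Pa.
- rewrite (_ : (fun _ => _) = (fun y => \prod_(i <- r | P i) F i y)) //.
  by apply/funext => y; rewrite big_cons (negbTE nPa).
Qed.

Lemma Ck_on_coord k U (j : 'I_n) : open U -> Ck_on k U (fun y => y 0 j).
Proof.
move=> oU.
have pE i (x : 'rV[R]_n) : is_derive x (delta_mx 0 i) (fun y : 'rV[R]_n => y 0 j) ((i == j)%:R : R).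
  have dc : derivable (fun y : 'rV[R]_n => y 0 j) x (delta_mx 0 i).
    exact/diff_derivable/differentiable_coord.
  apply: DeriveDef => //; rewrite /derive; apply: lim_near_cst => //.
  near=> h.
  rewrite /= !mxE eqxx addrK eq_sym [_ *: _]mulrA mulVf ?mul1r//.
  by near: h; exact: nbhs_dnbhs_neq.
have hp x : has_partials (fun y => y 0 j) x by move=> i; case: (pE i x).
have cc x : {for x, continuous (fun y : 'rV[R]_n => y 0 j)}.
  exact: coord_continuous.
case: k => [|k]; first by split => // x _; exact: cc.
apply: Ck_onS => // i.
apply: (Ck_on_eq oU _ (Ck_on_cst k ((i == j)%:R) oU)) => y _.
by rewrite /partial (@derive_val _ _ _ _ _ _ _ (pE i y)).
Unshelve. all: by end_near. Qed.

End Partials.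

Section ChainRule.
Context {R : realType} {n m : nat}.
Implicit Types (U : set 'rV[R]_n) (W : set 'rV[R]_m) (x : 'rV[R]_n).
Implicit Types (F : 'rV[R]_n -> 'rV[R]_m) (u : 'rV[R]_m -> R).

Lemma differentiable_row F x :
  (forall b, differentiable (fun y => F y 0 b) x) -> differentiable F x.
Proof.
move=> dF.
have -> : F = \sum_b (fun y => F y 0 b *: (delta_mx 0 b : 'rV[R]_m)).
  apply/funext => y; rewrite fct_sumE {1}[F y]row_sum_delta.
  by apply: eq_bigr.
by apply: differentiable_sum => b; exact: differentiableZl.
Qed.

Lemma jacobian_partial F x i b : differentiable F x ->
  jacobian F x i b = partial i (fun y => F y 0 b) x.
Proof.
move=> dF; rewrite /partial.
have := derive_mx (@diff_derivable _ _ _ _ _ (delta_mx 0 i) dF).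
rewrite (deriveEjacobian _ dF) -rowE => /matrixP/(_ 0 b).
by rewrite !mxE.
Qed.

Lemma comp_has_partials u F x :
  differentiable F x -> differentiable u (F x) -> has_partials (u \o F) x.
Proof.
by move=> dF du i; apply/diff_derivable/differentiable_comp.
Qed.

Lemma partial_comp u F x i :
  differentiable F x -> differentiable u (F x) ->
  partial i (u \o F) x = \sum_b jacobian F x i b * partial b u (F x).
Proof.
move=> dF du; rewrite /partial deriveE; last exact: differentiable_comp.
rewrite diff_comp//= -(deriveE _ dF) deriveEjacobian// -rowE.
rewrite [row i _]row_sum_delta linear_sum; apply: eq_bigr => b _.
by rewrite linearZ/= mxE -deriveE.
Qed.

Lemma C1_comp U W u F : open U -> open W ->
  (forall b, Ck_on 1 U (fun y => F y 0 b)) -> (forall y, U y -> W (F y)) ->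
  Ck_on 1 W u -> Ck_on 1 U (u \o F).
Proof.
move=> oU oW cF FW cu.
have dF x : U x -> differentiable F x.
  by move=> Ux; apply: differentiable_row => b; exact: C1_differentiable (cF b) Ux.
have du x : U x -> differentiable u (F x).
  by move=> Ux; apply: C1_differentiable cu _ => //; exact: FW.
have cc (v : 'rV[R]_m -> R) x : U x -> {for F x, continuous v} ->
    {for x, continuous (v \o F)}.
  move=> Ux cv; apply: continuous_comp cv.
  exact/differentiable_continuous/dF.
apply: Ck_onS => //.
- move=> x Ux; apply: cc => //.
  by apply: Ck_on_continuous cu _; exact: FW.
- by move=> x Ux; apply: comp_has_partials; [exact: dF|exact: du].
- move=> i.
  apply: (@Ck_on_eq _ _ _ _ (fun y => \sum_b partial i (fun z => F z 0 b) y *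
     (partial b u \o F) y)) => //.
    move=> y Uy; rewrite partial_comp; [|exact: dF|exact: du].
    by apply: eq_bigr => b _; rewrite jacobian_partial//; exact: dF.
  apply: Ck_on_sum => // b _; apply: Ck_onM => //.
    exact: Ck_on_partial.
  split => // x Ux; apply: cc => //.
  by apply: C1_partial_continuous cu _; exact: FW.
Qed.

End ChainRule.

(** * Determinants and positive definite matrices *)

Section SmoothInverse.
Context {R : realType} {n : nat}.
Implicit Types (U : set 'rV[R]_n).

Lemma Ck_on_det k U p (A : 'rV[R]_n -> 'M[R]_p) : open U ->
  (forall a b, Ck_on k U (fun y => A y a b)) -> Ck_on k U (fun y => \det (A y)).
Proof.
move=> oU cA; rewrite /determinant; apply: Ck_on_sum => // s _.
apply: Ck_onM => //; first exact: Ck_on_cst.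
by apply: Ck_on_prod.
Qed.

(** Cramer's rule writes the entries of the inverse as cofactors over the determinant. *)
Lemma Ck_on_invmx k U p (A : 'rV[R]_n -> 'M[R]_p) : open U ->
  (forall y, U y -> A y \in unitmx) ->
  (forall a b, Ck_on k U (fun y => A y a b)) ->
  forall a b, Ck_on k U (fun y => invmx (A y) a b).
Proof.
move=> oU uA cA a b.
apply: (@Ck_on_eq _ _ _ _ (fun y => (\det (A y))^-1 *
   ((-1) ^+ (b + a) * \det (row' b (col' a (A y)))))) => //.
  by move=> y Uy; rewrite /invmx uA// !mxE.
apply: Ck_onM => //.
  apply: Ck_onV => //; last exact: Ck_on_det.
  by move=> y Uy; rewrite -unitfE; have := uA y Uy; rewrite unitmxE.
apply: Ck_onM => //; first exact: Ck_on_cst.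
apply: Ck_on_det => // c d.
by apply: (@Ck_on_eq _ _ _ _ (fun y => A y (lift b c) (lift a d))) => // y _; rewrite !mxE.
Qed.

(** Leibniz's rule on each permutation term, regrouped by the row that is differentiated: each group
    is the determinant of [A] with one row replaced by its derivative, expanded along that row. *)
Lemma partial_det p (A : 'rV[R]_n -> 'M[R]_p) x i :
  (forall a b, has_partials (fun y => A y a b) x) ->
  partial i (fun y => \det (A y)) x =
  \sum_a \sum_b partial i (fun y => A y a b) x * cofactor (A x) a b.
Proof.
move=> dA.
pose dAx : 'M[R]_p := \matrix_(a, b) partial i (fun y => A y a b) x.
have dprod (r : seq 'I_p) (s : {perm 'I_p}) : uniq r ->
   has_partials (fun y => \prod_(a <- r) A y a (s a)) x /\
   partial i (fun y => \prod_(a <- r) A y a (s a)) x =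
   \sum_(a <- r) dAx a (s a) * \prod_(c <- r | c != a) A x c (s c).
  elim: r => [_|a r IH /= /andP[ar ur]].
    rewrite (_ : (fun _ => _) = fun=> 1); last by apply/funext => y; rewrite big_nil.
    by split; [exact: has_partials_cst|rewrite partial_cst big_nil].
  have [dr pr] := IH ur.
  rewrite (_ : (fun _ => _) =
    fun y => A y a (s a) * \prod_(c <- r) A y c (s c)); last first.
    by apply/funext => y; rewrite big_cons.
  split; first exact: has_partialsM.
  rewrite partialM// pr !big_cons eqxx/=; congr (_ + _).
    rewrite mxE; congr (_ * _); rewrite big_seq [RHS]big_seq_cond.
    apply: eq_bigl => c; case cr: (c \in r) => //=.
    by case: eqP => // ca; move: ar; rewrite -ca cr.
  rewrite mulr_sumr; apply: eq_big_seq => c cr.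
  rewrite big_cons; case: eqP => [ac|_]; last by rewrite mulrCA.
  by move: ar; rewrite ac cr.
have dterm (s : {perm 'I_p}) : has_partials (fun y => \prod_a A y a (s a)) x.
  by have [] := dprod _ s (index_enum_uniq _).
rewrite [LHS]partial_sum; last first.
  by move=> s _; apply: has_partialsM; [exact: has_partials_cst|exact: dterm].
transitivity (\sum_(s : 'S_p) \sum_a
    (-1) ^+ s * (dAx a (s a) * \prod_(c | c != a) A x c (s c))).
  apply: eq_bigr => s _; rewrite partialM; [|exact: has_partials_cst|exact: dterm].
  have [_ ->] := dprod _ s (index_enum_uniq _).
  by rewrite partial_cst mul0r add0r mulr_sumr.
rewrite exchange_big/=; apply: eq_bigr => a _.
(* [B] is the matrix with row a differentiated; its cofactors along row a are those of [A x]. *)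
pose B : 'M[R]_p := \matrix_(c, d) if c == a then dAx c d else A x c d.
transitivity (\det B).
  apply: eq_bigr => s _; congr (_ * _); rewrite [RHS](bigD1 a)//= !mxE eqxx.
  by congr (_ * _); apply: eq_bigr => c ca; rewrite mxE (negbTE ca).
rewrite (expand_det_row _ a); apply: eq_bigr => b _.
rewrite !mxE eqxx; congr (_ * _); rewrite /cofactor; congr (_ * \det _).
by apply/matrixP => c d; rewrite !mxE -[_ == a]negbK eq_sym neq_lift.
Qed.

(** Jacobi's formula d(det A) = det A tr(A^-1 dA), in the form that yields the contracted
    Christoffel symbols. *)
Lemma partial_det_unit p (A : 'rV[R]_n -> 'M[R]_p) x i :
  A x \in unitmx -> (forall a b, has_partials (fun y => A y a b) x) ->
  partial i (fun y => \det (A y)) x =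
  \det (A x) * \sum_a \sum_b invmx (A x) b a * partial i (fun y => A y a b) x.
Proof.
move=> uA dA; rewrite partial_det// mulr_sumr; apply: eq_bigr => a _.
rewrite mulr_sumr; apply: eq_bigr => b _.
have d0 : \det (A x) != 0 by rewrite -unitfE -unitmxE.
rewrite /invmx uA !mxE !mulrA divff// mul1r.
by move: (partial i _ x) => t; rewrite -mulrA mulrC.
Qed.

End SmoothInverse.

Section PositiveDefinite.
Context {R : rcfType}.

Definition posdef n (A : 'M[R]_n) :=
  A^T = A /\ forall v : 'rV[R]_n, v != 0 -> 0 < (v *m A *m v^T) 0 0.

(** Cholesky factorisation by induction on the size: the Schur complement of the top left entry is
    again positive definite. *)
Lemma posdef_cholesky n (A : 'M[R]_n) : posdef A ->
  exists2 P : 'M[R]_n, P \in unitmx & A = P *m P^T.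
Proof.
elim: n A => [|n IH] A pA.
  by exists 1%:M; [exact: unitmx1|apply/matrixP => -[]].
pose B : 'M[R]_(1 + n) := A.
pose a := ulsubmx B 0 0; pose b := ursubmx B; pose C := drsubmx B.
have sB : B^T = B by case: pA.
have bT : dlsubmx B = b^T by rewrite /b trmx_ursub sB.
have CT : C^T = C by rewrite /C trmx_drsub sB.
have BE : B = block_mx a%:M b b^T C.
  by rewrite -[LHS]submxK -/b -/C bT [ulsubmx B]mx11_scalar.
have wbT (w : 'rV[R]_n) : w *m b^T = ((b *m w^T) 0 0)%:M.
  apply/matrixP => i j; rewrite !ord1 !mxE eqxx mulr1n.
  by apply: eq_bigr => k _; rewrite !mxE mulrC.
have quad (s : R) (w : 'rV[R]_n) :
    ((row_mx s%:M w : 'rV[R]_(1 + n)) *m B *m (row_mx s%:M w)^T) 0 0 =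
    s * a * s + (s * (b *m w^T) 0 0) *+ 2 + (w *m C *m w^T) 0 0.
  rewrite BE mul_row_block tr_row_mx mul_row_col tr_scalar_mx !mulmxDl.
  rewrite -!scalar_mxM !mul_scalar_mx !mul_mx_scalar -!scalemxAl.
  have -> : w *m b^T = ((b *m w^T) 0 0)%:M.
    exact: wbT.
  rewrite !mxE eqxx !mulr1n; ring.
have a0 : 0 < a.
  have := pA.2 (row_mx 1%:M 0 : 'rV[R]_(1 + n)).
  rewrite -/B quad trmx0 !mulmx0 !mxE mulr0 mul0rn !addr0 mulr1 mul1r.
  apply; apply/eqP => /(congr1 (fun M : 'rV[R]_(1 + n) => lsubmx M)); rewrite row_mxKl linear0.
  by move=> /matrixP/(_ 0 0)/eqP; rewrite !mxE oner_eq0.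
pose S := C - a^-1 *: (b^T *m b).
have pS : posdef S.
  split; first by rewrite linearB linearZ/= trmx_mul trmxK CT.
  move=> w w0; pose t := (b *m w^T) 0 0.
  (* The first coordinate -t/a minimises the quadratic form for fixed [w], and the minimum is the
     value of the Schur complement at [w]. *)
  have := pA.2 (row_mx (- (t / a))%:M w : 'rV[R]_(1 + n)).
  rewrite -/B quad => H.
  suff -> : (w *m S *m w^T) 0 0 = - (t / a) * a * - (t / a) +
      (- (t / a) * t) *+ 2 + (w *m C *m w^T) 0 0.
    apply: H; apply: contra w0 => /eqP/(congr1 (fun M : 'rV[R]_(1 + n) => rsubmx M)).
    by rewrite row_mxKr linear0 => ->.
  have -> : (w *m S *m w^T) 0 0 = (w *m C *m w^T) 0 0 - a^-1 * (t * t).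
    rewrite /S mulmxBr mulmxBl -scalemxAr -scalemxAl mxE; congr (_ + _).
    rewrite mxE mxE; congr (- (_ * _)).
    by rewrite mulmxA -(mulmxA (w *m b^T)) wbT mul_scalar_mx mxE.
  by move: ((w *m C *m w^T) 0 0) => q; rewrite mulr2n; field; rewrite lt0r_neq0.
have [Q uQ SE] := IH S pS.
have sa0 : Num.sqrt a != 0 by rewrite sqrtr_eq0 -ltNge.
pose P : 'M[R]_(1 + n) :=
  block_mx (Num.sqrt a)%:M 0 ((Num.sqrt a)^-1 *: b^T) Q.
have PE : P *m P^T = B.
  rewrite BE /P tr_block_mx mulmx_block !trmx0 !mulmx0 !mul0mx !addr0.
  rewrite tr_scalar_mx -scalar_mxM -expr2 sqr_sqrtr ?ltW// linearZ/= trmxK.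
  rewrite mul_scalar_mx mul_mx_scalar !scalerA divff// !scale1r.
  rewrite -scalemxAl -scalemxAr scalerA -SE /S -expr2 exprVn sqr_sqrtr ?ltW//.
  by rewrite addrCA subrr addr0.
exists P; last exact: esym PE.
have dP : \det P = \det ((Num.sqrt a)%:M : 'M[R]_1) * \det Q.
  exact: (@det_lblock _ 1 n).
by rewrite unitmxE dP det_scalar1 unitrM -unitmxE uQ andbT unitfE.
Qed.

Lemma posdef_det_gt0 n (A : 'M[R]_n) : posdef A -> 0 < \det A.
Proof.
move=> /posdef_cholesky[P uP ->]; rewrite det_mulmx det_tr -expr2.
by rewrite lt_def sqr_ge0 sqrf_eq0 -unitfE -unitmxE uP.
Qed.

Lemma posdef_unitmx n (A : 'M[R]_n) : posdef A -> A \in unitmx.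
Proof. by move=> /posdef_det_gt0 d; rewrite unitmxE unitfE lt0r_neq0. Qed.

Lemma mxtrace_sqr_ge0 n (W : 'M[R]_n) : W^T = W -> 0 <= \tr (W *m W).
Proof.
move=> sW; apply: sumr_ge0 => i _; rewrite mxE; apply: sumr_ge0 => j _.
by rewrite -{2}sW mxE -expr2 sqr_ge0.
Qed.

Lemma mxtrace_sqr_eq0 n (W : 'M[R]_n) : W^T = W -> \tr (W *m W) = 0 -> W = 0.
Proof.
move=> sW /eqP; rewrite psumr_eq0 => [/allP W0|i _]; last first.
  rewrite mxE; apply: sumr_ge0 => j _.
  by rewrite -{2}sW mxE -expr2 sqr_ge0.
apply/matrixP => i j; have := W0 i (mem_index_enum _).
rewrite mxE psumr_eq0 => [/allP /(_ j (mem_index_enum _))|k _].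
  by rewrite -{2}sW mxE -expr2 sqrf_eq0 => /eqP ->; rewrite mxE.
by rewrite -{2}sW mxE -expr2 sqr_ge0.
Qed.

(* With A = P P^T, the matrix (L A^-1)^2 is conjugate to the square of the
   symmetric matrix P^-1 L P^-T. *)
Lemma posdef_trace n (A L : 'M[R]_n) : posdef A -> L^T = L ->
  0 <= \tr (L *m invmx A *m (L *m invmx A)) /\
  (\tr (L *m invmx A *m (L *m invmx A)) = 0 -> L = 0).
Proof.
move=> /posdef_cholesky[P uP ->] sL.
have uPT : P^T \in unitmx by rewrite unitmx_tr.
pose W := invmx P *m L *m invmx P^T.
have sW : W^T = W by rewrite /W !trmx_mul !trmx_inv trmxK sL mulmxA.
have LE : L = P *m W *m P^T.
  by rewrite /W !mulmxA mulmxV// mul1mx mulmxKV.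
have iE : invmx (P *m P^T) = invmx P^T *m invmx P.
  apply: (can_inj (mulKmx (_ : P *m P^T \in unitmx))).
    by rewrite unitmx_mul uP.
  rewrite mulmxV; last by rewrite unitmx_mul uP.
  by rewrite mulmxA mulmxK// mulmxV.
have -> : L *m invmx (P *m P^T) = P *m W *m invmx P.
  by rewrite iE LE mulmxA mulmxK.
have -> : \tr (P *m W *m invmx P *m (P *m W *m invmx P)) = \tr (W *m W).
  by rewrite !mulmxA mulmxKV// mxtrace_mulC !mulmxA mulVmx// mul1mx.
split; first exact: mxtrace_sqr_ge0.
by move=> /mxtrace_sqr_eq0-/(_ sW) W0; rewrite LE W0 mulmx0 mul0mx.
Qed.

End PositiveDefinite.

(** * Lebesgue measure on R^n *)

Section BorelSets.
Context {R : realType}.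

Lemma open_borel (T : ptopologicalType) (U : set T) :
  open U -> measurable (U : set (borel T)).
Proof. by move=> oU; exact: sub_sigma_algebra. Qed.

Lemma closed_borel (T : ptopologicalType) (C : set T) :
  closed C -> measurable (C : set (borel T)).
Proof.
by move=> cC; rewrite -(setCK C); apply: measurableC; apply: open_borel; exact: closed_openC.
Qed.

Lemma preimage_open_on (S T : topologicalType) (U : set S) (f : S -> T) (O : set T) :
  open U -> (forall x, U x -> {for x, continuous f}) -> open O ->
  open (U `&` f @^-1` O).
Proof.
move=> oU cf oO; rewrite openE => x [Ux Ofx].
have nU : nbhs x U by exact: open_nbhs_nbhs.
have nf : nbhs x (f @^-1` O) by apply: cf => //; exact: open_nbhs_nbhs.
exact: filterI nU nf.
Qed.

Lemma continuous_on_borel (S T : ptopologicalType) (U : set S) (f : S -> T) :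
  open U -> (forall x, U x -> {for x, continuous f}) ->
  measurable_fun (U : set (borel S)) (f : borel S -> borel T).
Proof.
move=> oU cf; apply: (@measurability _ _ (borel S) (borel T) U f (@open T)) => //.
by move=> _ [W oW <-]; apply: open_borel; exact: preimage_open_on.
Qed.

Lemma continuous_on_measurable (S : ptopologicalType) (U : set S) (f : S -> R) :
  open U -> (forall x, U x -> {for x, continuous f}) ->
  measurable_fun (U : set (borel S)) (f : borel S -> R).
Proof.
move=> oU cf; apply: (measurability _ (RGenOpens.measurableE R)).
move=> _ [_ [a [b ->] <-]]; apply: open_borel; exact: preimage_open_on.
Qed.

(** An open set of R^n is a countable union of boxes with rational centre and radius 1/(k + 1), and
    a box is a finite intersection of conditions on single coordinates. *)
Lemma measurable_to_rV dd (T : measurableType dd) n (F : T -> 'rV[R]_n) :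
  (forall i, measurable_fun setT (fun t => F t 0 i)) ->
  measurable_fun setT (F : T -> borel 'rV[R]_n).
Proof.
move=> mF; apply: (@measurability _ _ T (borel 'rV[R]_n) setT F (@open 'rV[R]_n)) => //.
move=> _ [W oW <-]; rewrite setTI.
pose box (qk : 'rV[rat]_n * nat) : set 'rV[R]_n :=
  [set v | forall i, `|v 0 i - ratr (qk.1 0 i)| < qk.2.+1%:R^-1].
have -> : F @^-1` W = \bigcup_(qk in [set qk | box qk `<=` W]) F @^-1` (box qk).
  apply/seteqP; split => [t Ot|t [qk /= qkO Ft]]; last exact: qkO.
  have [d d0 dO] := nbhs_open_ball oW Ot.
  (* Chosen so that 1/(k + 1) < d / 2: the triangle inequality through the rational centre uses the
     radius twice. *)
  pose k := Num.truncn (2 / d).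
  have k0 : 0 < k.+1%:R^-1 :> R by rewrite invr_gt0.
  have kd : k.+1%:R^-1 < d / 2.
    by rewrite invf_plt ?posrE ?divr_gt0// invf_div truncnS_gt.
  have qex i : exists q : rat, `|F t 0 i - ratr q| < k.+1%:R^-1.
    have [|q] := @rat_in_itvoo R (F t 0 i - k.+1%:R^-1) (F t 0 i + k.+1%:R^-1).
      by rewrite ltrD2l gtrN.
    by rewrite in_itv/= => /andP[q1 q2]; exists q; rewrite distrC ltr_distl q1 q2.
  pose q : 'rV[rat]_n := \row_i xchoose (qex i).
  have qP i : `|F t 0 i - ratr (q 0 i)| < k.+1%:R^-1.
    by rewrite mxE; exact: xchooseP (qex i).
  exists (q, k); last exact: qP.
  move=> v /= bv; apply: dO; apply: mx_norm_lt => // i j.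
  rewrite !mxE !ord1 (le_lt_trans (ler_distD (ratr (q 0 j)) _ _))//.
  rewrite (splitr d) ltrD//; first exact: lt_trans (bv j) kd.
  by rewrite distrC; exact: lt_trans (qP j) kd.
rewrite bigcup_mkcond; apply: countable_bigcupT_measurable; first exact: countableP.
move=> qk; case: ifP => // _.
rewrite (_ : _ @^-1` _ = \bigcap_(i in [set: 'I_n])
   [set t | `|F t 0 i - ratr (qk.1 0 i)| < qk.2.+1%:R^-1]); last first.
  by apply/seteqP; split => t /=; [move=> H i _|move=> H i]; exact: H.
apply: fin_bigcap_measurable => // i _.
pose h t := F t 0 i - ratr (qk.1 0 i).
rewrite (_ : [set t | _] = h @^-1` `]- qk.2.+1%:R^-1, qk.2.+1%:R^-1[); last first.
  by apply/seteqP; split => t /=; rewrite in_itv/= ltr_norml.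
rewrite -[X in measurable X]setTI.
have mh : measurable_fun setT h by apply: measurable_funB => //; exact: mF.
by apply: mh => //; exact: measurable_itv.
Qed.

End BorelSets.

Section MeasurePackaging.
Context d d' (T : measurableType d) (T' : measurableType d') (R : realType).

Definition image_measure (mu : {measure set T -> \bar R}) (g : T -> T')
  (mg : measurable_fun setT g) : {measure set T' -> \bar R} :=
  measure_function_pushforward__canonical__measure_function_Measure mu mg.

(** Equips a bare measure with the structure that product measures and Fubini ask for, without
    changing its values; the induction on the dimension passes through it at each step. *)
Lemma sigma_finite_pack (mu : {measure set T -> \bar R}) :
  sigma_finite setT mu ->
  exists nu : {sigma_finite_measure set T -> \bar R},
    nu = mu :> (set T -> \bar R).
Proof.
move=> sf.
pose H1 := @isSFinite.Build _ _ _ mu (sfinite_measure_sigma_finite sf).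
pose H2 := @isSigmaFinite.Build _ T R mu sf.
pose nu := HB.pack_for {sigma_finite_measure set T -> \bar R}
  (Measure.sort mu) H1 H2.
by exists nu.
Qed.

End MeasurePackaging.

Section LebesgueMeasureRn.
Context {R : realType}.

(** The splitting R x R^n -> R^(n+1) of [lebesgue_int], uncurried so that a product measure can be
    pushed forward along it. *)
Definition first_rest n (ty : measurableTypeR R * borel 'rV[R]_n) : borel 'rV[R]_n.+1 :=
  row_mx (const_mx ty.1 : 'rV[R]_1) (ty.2 : 'rV[R]_n).

Lemma measurable_rV_coord n (i : 'I_n) :
  measurable_fun setT (fun v : borel 'rV[R]_n => (v : 'rV[R]_n) 0 i).
Proof.
apply: (@continuous_on_measurable _ _ setT); first exact: openT.
by move=> x _; exact: coord_continuous.
Qed.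

Lemma measurable_first_rest n : measurable_fun setT (@first_rest n).
Proof.
apply: measurable_to_rV => i.
have [j ->|j ->] := @split_ordP 1 n i.
  rewrite (_ : (fun t => _) = fst); first exact: (@measurable_fst _ _ (measurableTypeR R) (borel 'rV[R]_n)).
  by apply/funext => t; rewrite /first_rest (@row_mxEl _ 1 1 n) mxE.
rewrite (_ : (fun t => _) = (fun v : borel 'rV[R]_n => (v : 'rV[R]_n) 0 j) \o snd).
  exact: measurableT_comp (measurable_rV_coord j) measurable_snd.
by apply/funext => t; rewrite /first_rest (@row_mxEr _ 1 1 n).
Qed.

(** The norm of a row is the maximum norm, so this is [-k, k]^n and splits as a product under
    [first_rest]. *)
Definition cube n (k : nat) : set 'rV[R]_n := [set v | `|v| <= k%:R].
Arguments cube : clear implicits.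

Lemma measurable_cube n k : measurable (cube n k : set (borel 'rV[R]_n)).
Proof.
apply: closed_borel; rewrite /cube.
have -> : [set v : 'rV[R]_n | `|v| <= k%:R] = (fun v => `|v|) @^-1` [set r | r <= k%:R].
  by [].
by apply: preimage_closed => [v _|]; [exact: norm_continuous|exact: closed_le].
Qed.

Lemma cube_cover n : [set: 'rV[R]_n] = \bigcup_k cube n k.
Proof.
apply/seteqP; split => // v _; exists (Num.truncn `|v|).+1 => //=.
by rewrite /cube/= ltW// truncnS_gt.
Qed.

Lemma first_rest_cube n k :
  @first_rest n @^-1` cube n.+1 k = [set t | `|t| <= k%:R] `*` cube n k.
Proof.
apply/seteqP; split => -[t y] /=; rewrite /cube /first_rest /=.
  move=> H; split; last first.
    apply: mx_norm_le => // i j; rewrite ord1; apply: le_trans H.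
    by rewrite -(@row_mxEr _ 1 1 n (const_mx t)) mx_coord_le_norm.
  apply: le_trans H; rewrite [t in X in X <= _](_ : t = row_mx (const_mx t : 'rV[R]_1) y 0 (lshift n 0)).
    exact: mx_coord_le_norm.
  by rewrite (@row_mxEl _ 1 1 n) mxE.
move=> [ht hy]; apply: mx_norm_le => // i j.
have [l ->|l ->] := @split_ordP 1 n j.
  by rewrite (@row_mxEl _ 1 1 n) mxE.
by rewrite (@row_mxEr _ 1 1 n) (le_trans _ hy)// mx_coord_le_norm.
Qed.

(** Turns the iterated integral into integration against a measure. In dimension 0 it is the Dirac
    mass at the only point; then it is the image of a product measure under [first_rest], by
    Tonelli. Finiteness on cubes is carried along since it gives sigma-finiteness of the next
    measure. *)
Theorem lebesgue_int_measure n :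
  exists nu : {sigma_finite_measure set (borel 'rV[R]_n) -> \bar R},
    (forall F : borel 'rV[R]_n -> \bar R, measurable_fun setT F ->
      (forall x, 0 <= F x)%E -> lebesgue_int F = \int[nu]_x F x)%E /\
    (forall k, nu (cube n k) < +oo)%E.
Proof.
elim: n => [|n [nu [nuE nuk]]].
  exists (@dirac _ (borel 'rV[R]_0) 0 R); split => [F mF F0|k].
    by rewrite integral_dirac//= diracT mul1e.
  by rewrite (le_lt_trans (probability_le1 _ _))//; [exact: measurable_cube|exact: ltry].
pose leb : {sigma_finite_measure set (measurableTypeR R) -> \bar R} := @lebesgue_measure R.
pose mu := image_measure (product_measure1 leb nu) (@measurable_first_rest n).
have muk k : (mu (cube n.+1 k) < +oo)%E.
  pose I : set R := `[(- k%:R), k%:R]%classic.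
  have EI : [set t : R | `|t| <= k%:R] = I.
    by apply/seteqP; split => t; rewrite /I/= in_itv/= ler_norml.
  have E : mu (cube n.+1 k) = (leb I * nu (cube n k))%E.
    rewrite -product_measure1E; [|exact: measurable_itv|exact: measurable_cube].
    by rewrite -EI -first_rest_cube.
  rewrite E; apply: lte_mul_pinfty; [exact: measure_ge0| |exact: nuk].
  by rewrite /leb/= /I lebesgue_measure_itv/=; case: ifP.
have [mu' mu'E] : exists nu : {sigma_finite_measure set (borel 'rV[R]_n.+1) -> \bar R},
    nu = mu :> (set (borel 'rV[R]_n.+1) -> \bar R).
  apply: sigma_finite_pack; exists (cube n.+1); first exact: cube_cover.
  by move=> k; split; [exact: measurable_cube|exact: muk].
exists mu'; rewrite mu'E; split=> [F mF F0|]; last exact: muk.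
rewrite ge0_integral_pushforward//; last exact: measurable_first_rest.
rewrite preimage_setT fubini_tonelli1//.
- apply: eq_integral => t _.
  apply: (nuE (fun y => (F \o @first_rest n) (t, y))) => [|x]; last exact: F0.
  apply: measurableT_comp mF _.
  exact: measurableT_comp (@measurable_first_rest n) (pair1_measurable t).
- exact: measurableT_comp mF (@measurable_first_rest n).
- by move=> x; exact: F0.
Qed.

End LebesgueMeasureRn.
Arguments cube {R} n k _.

(** * Transfer of integrals along a parametrisation with a density *)

Section WeightedTransfer.
Context d1 d2 (X : measurableType d1) (Y : measurableType d2) (R : realType).
Variables (mu : {measure set X -> \bar R}) (vol : {measure set Y -> \bar R}).
Variables (V : set X) (D : set Y) (phi : X -> Y) (w : X -> R).
Hypotheses (mV : measurable V) (mD : measurable D).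
Hypotheses (mphi : measurable_fun V phi) (mw : measurable_fun V w).
Hypothesis w0 : forall x, 0 <= w x.
Hypothesis volE : forall B, measurable B ->
  vol (B `&` D) = (\int[mu]_(x in V) (\1_B (phi x) * w x)%:E)%E.

Import HBNNSimple.

Let mindic B : measurable B ->
  measurable_fun V (fun x => (\1_B (phi x) * w x)%:E).
Proof.
move=> mB; apply/measurable_EFinP/measurable_funM => //.
apply: (measurable_comp measurableT) => //.
Qed.

(** A simple function is a finite combination of indicators of its level sets, and [volE] is the
    claim for indicators. *)
Let nnsfun_transfer (h : {nnsfun Y >-> R}) :
  (\int[vol]_(y in D) (h y)%:E = \int[mu]_(x in V) (h (phi x) * w x)%:E)%E.
Proof.
transitivity (\sum_(k \in range h) k%:E * vol (h @^-1` [set k] `&` D))%E.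
  under eq_integral do rewrite fimfunE -fsumEFin//.
  rewrite ge0_integral_fsum//; last 2 first.
  - by move=> y; apply/measurable_EFinP/measurable_funM.
  - by move=> y x _; rewrite nnfun_muleindic_ge0.
  by apply: eq_fsbigr => r _; rewrite integralZl_indic_nnsfun// integral_indic.
transitivity (\sum_(k \in range h)
    \int[mu]_(x in V) (k%:E * (\1_(h @^-1` [set k]) (phi x) * w x)%:E))%E.
  apply: eq_fsbigr => k; rewrite inE => -[y _ <-].
  rewrite volE// -ge0_integralZl//.
  - exact: mindic.
  - by move=> x _; rewrite lee_fin mulr_ge0.
  - by rewrite lee_fin.
rewrite -ge0_integral_fsum//.
- apply: eq_integral => x _; rewrite fimfunE mulr_fsuml// -fsumEFin//.
  by apply: eq_fsbigr => k _; rewrite -EFinM mulrA.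
- by move=> k; apply: measurable_funeM; exact: mindic.
- move=> k x _; rewrite -EFinM lee_fin mulrA mulr_ge0//.
  exact: nnfun_muleindic_ge0.
Qed.

(** Monotone convergence on both sides along one approximation by simple functions; multiplying by w
    >= 0 preserves monotonicity. *)
Lemma ge0_integral_weighted (f : Y -> \bar R) : measurable_fun setT f ->
  (forall y, 0 <= f y)%E ->
  (\int[vol]_(y in D) f y = \int[mu]_(x in V) (f (phi x) * (w x)%:E))%E.
Proof.
move=> mf f0; pose f_ := nnsfun_approx measurableT mf.
transitivity (limn (fun n => \int[vol]_(y in D) (f_ n y)%:E))%E.
  rewrite -monotone_convergence//.
  - apply: eq_integral => y _; apply/esym/cvg_lim => //.
    exact: cvg_nnsfun_approx.
  - by move=> n; apply/measurable_EFinP; apply: measurable_funTS.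
  - by move=> n y _; rewrite lee_fin.
  - by move=> y _ m n mn; rewrite lee_fin; exact/lefP/nd_nnsfun_approx.
under eq_fun do rewrite nnsfun_transfer.
rewrite -monotone_convergence//.
- apply: eq_integral => x _; apply/cvg_lim => //.
  under eq_fun do rewrite EFinM.
  apply: cvgeZr => //. exact: cvg_nnsfun_approx.
- move=> n; apply/measurable_EFinP/measurable_funM => //.
  exact: (measurable_comp measurableT).
- by move=> n x _; rewrite lee_fin mulr_ge0.
- move=> x _ m n mn; rewrite lee_fin ler_wpM2r//.
  exact/lefP/nd_nnsfun_approx.
Qed.

(** Multiplication by w >= 0 commutes with taking positive and negative parts, so both parts
    transfer separately and no integrability is assumed. *)
Lemma integral_weighted (f : Y -> R) : measurable_fun setT f ->
  (\int[vol]_(y in D) (f y)%:E = \int[mu]_(x in V) (f (phi x) * w x)%:E)%E.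
Proof.
move=> mf; have mF : measurable_fun setT (EFin \o f) by exact/measurable_EFinP.
rewrite integralE [RHS]integralE; congr (_ - _)%E.
- rewrite (ge0_integral_weighted (measurable_funepos mF)); last first.
    by move=> y; exact: funepos_ge0.
  apply: eq_integral => x _; rewrite !funeposE/= -!EFin_max -EFinM.
  by rewrite maxr_pMl// mul0r.
- rewrite (ge0_integral_weighted (measurable_funeneg mF)); last first.
    by move=> y; exact: funeneg_ge0.
  apply: eq_integral => x _; rewrite !funenegE/= -!EFin_max -EFinM.
  by rewrite maxr_pMl// mul0r mulNr.
Qed.

End WeightedTransfer.

(** * Integrals of partial derivatives over R^n *)

Section IntegralOfPartials.
Context {R : realType}.

(** Obtained by choice, hence known only through agreement with [lebesgue_int] on nonnegative
    measurable functions and finiteness on cubes. *)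
Definition lebesgue_rV n : {sigma_finite_measure set (borel 'rV[R]_n) -> \bar R} :=
  sval (cid (@lebesgue_int_measure R n)).

Lemma lebesgue_intE n (F : borel 'rV[R]_n -> \bar R) :
  measurable_fun setT F -> (forall x, 0 <= F x)%E ->
  lebesgue_int F = (\int[lebesgue_rV n]_x F x)%E.
Proof. exact: (svalP (cid (@lebesgue_int_measure R n))).1. Qed.

Lemma lebesgue_rV_cube n k : (lebesgue_rV n (cube n k) < +oo)%E.
Proof. exact: (svalP (cid (@lebesgue_int_measure R n))).2. Qed.

Let leb1 : {sigma_finite_measure set (measurableTypeR R) -> \bar R} :=
  @lebesgue_measure R.

(** The measures in dimensions n and n + 1 are chosen independently; the recursion of [lebesgue_int]
    links them for nonnegative functions, and positive and negative parts give the rest. *)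
Lemma lebesgue_rVS n (F : borel 'rV[R]_n.+1 -> \bar R) : measurable_fun setT F ->
  (\int[lebesgue_rV n.+1]_x F x =
   \int[product_measure1 leb1 (lebesgue_rV n)]_z F (first_rest z))%E.
Proof.
have ge0 (G : borel 'rV[R]_n.+1 -> \bar R) : measurable_fun setT G ->
    (forall x, 0 <= G x)%E ->
  (\int[lebesgue_rV n.+1]_x G x =
   \int[product_measure1 leb1 (lebesgue_rV n)]_z G (first_rest z))%E.
  move=> mG G0; rewrite -lebesgue_intE//.
  rewrite (@fubini_tonelli1 _ _ _ _ _ leb1 (lebesgue_rV n) (G \o @first_rest R n)).
  - apply: eq_integral => t _.
    apply: (lebesgue_intE (F := fun y => (G \o @first_rest R n) (t, y))) => [|x]; last exact: G0.
    apply: measurableT_comp mG _.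
    exact: measurableT_comp (@measurable_first_rest R n) (pair1_measurable t).
  - exact: measurableT_comp mG (@measurable_first_rest R n).
  - by move=> x; exact: G0.
move=> mF; rewrite integralE [RHS]integralE; congr (_ - _)%E.
- rewrite (ge0 (fun x => F^\+ x)%E).
  + by apply: eq_integral => z _; rewrite !funeposE.
  + exact: measurable_funepos.
  + by move=> x; exact: funepos_ge0.
- rewrite (ge0 (fun x => F^\- x)%E).
  + by apply: eq_integral => z _; rewrite !funenegE.
  + exact: measurable_funeneg.
  + by move=> x; exact: funeneg_ge0.
Qed.

Lemma cube_compact n k : compact (cube n k : set 'rV[R]_n).
Proof.
apply: bounded_closed_compact.
  by exists k%:R; split => // x kx v; rewrite /cube/= => /le_trans; apply; exact: ltW.
have -> : cube n k = (fun v : 'rV[R]_n => `|v|) @^-1` [set r : R | r <= k%:R] by [].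
by apply: preimage_closed => [v _|]; [exact: norm_continuous|exact: closed_le].
Qed.

Lemma continuous_cube_integrable n k (u : 'rV[R]_n -> R) :
  continuous u -> (forall x, ~ cube n k x -> u x = 0) ->
  (lebesgue_rV n).-integrable setT (fun x => (u x)%:E).
Proof.
move=> cu u0.
have -> : (fun x => (u x)%:E) = (EFin \o u) \_ (cube n k).
  apply/funext => x; rewrite patchE; case: ifPn => // /negP.
  by rewrite inE => /u0 ->.
apply/(integrable_mkcond _ (@measurable_cube R n k)).1.
apply: measurable_bounded_integrable.
- exact: measurable_cube.
- exact: lebesgue_rV_cube.
- apply: (@measurable_funS _ _ _ _ setT) => //.
  by apply: continuous_on_measurable; [exact: openT|move=> x _; exact: cu].
- have : compact (u @` cube n k).
    by apply: continuous_compact; [exact: continuous_subspaceT|exact: cube_compact].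
  move=> /compact_bounded [N [Nr H]]; exists N; split => // x Nx v kv.
  by apply: H => //; exists v.
Qed.

(** Fundamental theorem of calculus on an interval at whose ends [u] vanishes. *)
Lemma integral_derive_line (u : R -> R) (du : R -> R) (k : nat) :
  (forall t, is_derive t (1 : R) u (du t)) -> continuous du ->
  (forall t, k%:R < `|t| -> u t = 0 /\ du t = 0) ->
  (\int[leb1]_t (du t)%:E = 0)%E.
Proof.
move=> hu cdu u0.
(* One more than k, since [u] is known to vanish only where |t| exceeds k strictly. *)
pose I : set R := `[(- k.+1%:R), k.+1%:R]%classic.
have -> : (fun t => (du t)%:E) = (EFin \o du) \_ I.
  apply/funext => t; rewrite patchE; case: ifPn => // /negP.
  rewrite inE /I /= in_itv/= -ler_norml => /negP; rewrite -ltNge => kt.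
  by rewrite (u0 t _).2// (lt_trans _ kt)// ltr_nat.
rewrite -integral_mkcond.
have cu : continuous u.
  by move=> t; apply/differentiable_continuous/derivable1_diffP; case: (hu t).
rewrite (@continuous_FTC2 R du u).
- have [-> _] : u k.+1%:R = 0 /\ du k.+1%:R = 0 by apply: u0; rewrite ger0_norm// ltr_nat.
  have [-> _] : u (- k.+1%:R) = 0 /\ du (- k.+1%:R) = 0.
    by apply: u0; rewrite normrN ger0_norm// ltr_nat.
  by rewrite subee.
- by rewrite ltrNl (lt_trans (_ : _ < 0))// oppr_lt0 ltr0n.
- exact: continuous_subspaceT.
- split => [t _||]; first by case: (hu t).
  + exact: cvg_at_right_filter (cu _).
  + exact: cvg_at_left_filter (cu _).
- by move=> t _; rewrite derive1E; case: (hu t).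
Qed.

Lemma partial_off_cube n (a : 'I_n) k (u : 'rV[R]_n -> R) :
  (forall x, ~ cube n k x -> u x = 0) ->
  forall x, ~ cube n k x -> partial a u x = 0.
Proof.
move=> u0 x kx; rewrite (@partial_eq_on _ _ (~` cube n k) _ _ (fun=> 0))//.
- exact: partial_cst.
- apply: closed_openC; exact: compact_closed (@norm_hausdorff _ _) (@cube_compact _ _).
Qed.

Lemma partial_integrable n (a : 'I_n) k (u : 'rV[R]_n -> R) :
  Ck_on 1 setT u -> (forall x, ~ cube n k x -> u x = 0) ->
  (lebesgue_rV n).-integrable setT (fun x => (partial a u x)%:E).
Proof.
move=> cu u0; apply: continuous_cube_integrable (partial_off_cube a u0).
by move=> x; exact: C1_partial_continuous cu _.
Qed.

(** By Fubini the first coordinate may be integrated first or last. A derivative in it integrates to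
    0 on each line; a derivative in another coordinate is a partial derivative of the slice, covered
    by the induction hypothesis. *)
Theorem integral_partial_eq0 n (a : 'I_n) k (u : 'rV[R]_n -> R) :
  Ck_on 1 setT u -> (forall x, ~ cube n k x -> u x = 0) ->
  (\int[lebesgue_rV n]_x (partial a u x)%:E = 0)%E.
Proof.
elim: n a u => [|n IH] a u cu u0; first by case: a.
have pu0 (i : 'I_n.+1) := partial_off_cube i u0.
have cp (i : 'I_n.+1) : continuous (partial i u).
  by move=> x; exact: C1_partial_continuous cu _.
have ip := partial_integrable a cu u0.
have mp : measurable_fun setT (fun x : borel 'rV[R]_n.+1 => (partial a u x)%:E).
  exact: measurable_int ip.
rewrite (lebesgue_rVS mp).
(* Exchanging the integrals of a signed function needs integrability on the product, obtained by
   transporting the integral of the absolute value. *)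
have ipp : (product_measure1 leb1 (lebesgue_rV n)).-integrable setT
    (fun z => (partial a u (first_rest z))%:E).
  apply/integrableP; split.
    exact: measurableT_comp mp (@measurable_first_rest R n).
  have /integrableP[_ +] := ip; rewrite lebesgue_rVS//.
  exact: measurableT_comp.
have [j aE|j aE] := @split_ordP 1 n a.
- rewrite -(integral21_prod_meas1 ipp) integral0_eq// => y _.
  rewrite /fubini_G aE; pose y' : 'rV[R]_n := y.
  pose e : 'rV[R]_n.+1 := delta_mx 0 (lshift n j).
  pose x0 : 'rV[R]_n.+1 := row_mx (0 : 'rV[R]_1) y'.
  have lineE t : first_rest (t, y) = x0 + t *: e.
    apply/rowP => i.
    rewrite [RHS]mxE [X in _ = _ + X]mxE [delta_mx _ _ _ _]mxE /x0 /first_rest /=.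
    have [l ->|l ->] := @split_ordP 1 n i.
      by rewrite !(@row_mxEl _ 1 1 n) !mxE !ord1 !eqxx mulr1 add0r.
    rewrite !(@row_mxEr _ 1 1 n) (_ : _ == _ = false) ?mulr0 ?addr0 ?andbF//.
    by apply/eqP => /(congr1 val) /=; rewrite ord1.
  apply: (@integral_derive_line (fun t => u (x0 + t *: e)) _ k).
  + move=> t; rewrite [first_rest _]lineE; apply: is_derive_line.
    by case: cu => _ /(_ (lshift n j)) [+ _]; apply.
  + rewrite (_ : (fun t => _) = partial (lshift n j) u \o (fun t => x0 + t *: e)).
      move=> t; apply: continuous_comp; last exact: cp.
      by apply: continuousD; [exact: cst_continuous|exact: scalel_continuous].
    by apply/funext => t; rewrite lineE.
  + move=> t kt.
    have nc : ~ cube n.+1 k (first_rest (t, y)).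
      move=> H; have : (@first_rest R n @^-1` cube n.+1 k) (t, y) by [].
      by rewrite first_rest_cube => -[/= + _]; apply/negP; rewrite -ltNge.
    by split; [rewrite -lineE; exact: u0|exact: pu0].
- rewrite -(integral12_prod_meas1 ipp) integral0_eq// => t _.
  rewrite /fubini_F aE.
  pose F (y : 'rV[R]_n) : 'rV[R]_n.+1 := first_rest (t, y).
  have FE (y : 'rV[R]_n) (h : R) : F (h *: delta_mx 0 j + y) =
      h *: delta_mx 0 (rshift 1 j) + F y.
    apply/rowP => i; rewrite [RHS]mxE [X in _ = X + _]mxE /F /first_rest /=.
    have [l ->|l ->] := @split_ordP 1 n i.
      rewrite !(@row_mxEl _ 1 1 n) !mxE eqxx/= (_ : _ == _ = false).
        by rewrite mulr0 add0r.
      by apply/eqP => /(congr1 val)/=; rewrite ord1.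
    rewrite !(@row_mxEr _ 1 1 n) !mxE !eqxx/=; congr (_ * _%:R + _).
  (* For fixed t the derivative in a later coordinate is that of the slice, because [F] carries
     steps along one basis vector to steps along the shifted one. *)
  have utE y : partial (rshift 1 j) u (first_rest (t, y)) = partial j (u \o F) y.
    rewrite /partial /derive [in RHS](_ : (fun h : R => _) = fun h : R =>
      h^-1 *: ((u \o shift (F y)) (h *: delta_mx 0 (rshift 1 j)) - u (F y))) //.
    by apply/funext => h /=; rewrite FE.
  under eq_integral do rewrite utE.
  apply: IH.
  + apply: (@C1_comp _ _ _ setT setT) => //; [exact: openT|exact: openT|].
    move=> i; have [l ->|l ->] := @split_ordP 1 n i.
      rewrite (_ : (fun _ => _) = fun=> t); first by apply: Ck_on_cst; exact: openT.
      by apply/funext => y; rewrite /F /first_rest (@row_mxEl _ 1 1 n) mxE.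
    rewrite (_ : (fun _ => _) = fun y : 'rV[R]_n => y 0 l).
      by apply: Ck_on_coord; exact: openT.
    by apply/funext => y; rewrite /F /first_rest (@row_mxEr _ 1 1 n).
  + move=> y nky; apply: u0 => H; apply: nky.
    have : (@first_rest R n @^-1` cube n.+1 k) (t, y) by [].
    by rewrite first_rest_cube => -[].
Qed.

End IntegralOfPartials.

(** * Curvature and gradient fields in a chart *)

Section BochnerAlgebra.
Context {R : comPzRingType} {n : nat}.
Variables (X : 'I_n -> R) (dX : 'I_n -> 'I_n -> R) (ddX : 'I_n -> 'I_n -> 'I_n -> R).
Variables (G : 'I_n -> 'I_n -> 'I_n -> R) (dG : 'I_n -> 'I_n -> 'I_n -> 'I_n -> R).
Hypothesis ddX_sym : forall a b c, ddX a b c = ddX b a c.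
Hypothesis G_sym : forall c a b, G c a b = G c b a.

(** At a point, [N a b] stands for (D_a X)^b and [dN d a b] for its partial derivative in direction
    d. The field, the Christoffel symbols and their derivatives become free ring elements bound only
    by the two symmetries, so that the identities below are pure algebra. *)
Let N a b := dX a b + \sum_c G b a c * X c.
Let dN d a b := ddX d a b + \sum_c (dG d b a c * X c + G b a c * dX d c).
Let Ric a d := \sum_l (dG l l a d - dG a l l d
  + \sum_m (G l l m * G m a d - G l a m * G m l d)).

(* The contracted Ricci identity [D_b D_a X^b - D_a D_b X^b = Ric_ad X^d]. *)
Lemma contracted_ricci_identity a :
  \sum_b (dN b a b + \sum_c G b b c * N a c - \sum_c G c b a * N c b - dN a b b)
  = \sum_d Ric a d * X d.
Proof.
pose D := \sum_b ddX b a b.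
pose S1 := \sum_b \sum_c dG b b a c * X c.
pose S2 := \sum_b \sum_c dG a b b c * X c.
pose S3 := \sum_b \sum_c G b a c * dX b c.
pose S4 := \sum_b \sum_c G b b c * dX a c.
pose S5 := \sum_b \sum_c \sum_d G b b c * G c a d * X d.
pose S6 := \sum_b \sum_c \sum_d G b a c * G c b d * X d.
(* In the commutator the second derivatives [D] and the terms [S3], [S4] in first derivatives of X
   cancel; S1 - S2 + S5 - S6 is left, which is the curvature contracted with X. *)
have -> : \sum_b (dN b a b + \sum_c G b b c * N a c - \sum_c G c b a * N c b - dN a b b)
    = (D + (S1 + S3)) + (S4 + S5) - (S3 + S6) - (D + (S2 + S4)).
  rewrite !sumrB big_split/=; congr (_ + _ - _ - _).
  - rewrite big_split/=; congr (_ + _); rewrite -big_split/=.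
    by apply: eq_bigr => b _; rewrite -big_split.
  - rewrite -big_split/=; apply: eq_bigr => b _; rewrite -big_split/=.
    apply: eq_bigr => c _; rewrite mulrDr mulr_sumr; congr (_ + _).
    by apply: eq_bigr => d _; rewrite mulrA.
  - rewrite exchange_big/= -big_split/=; apply: eq_bigr => b _; rewrite -big_split/=.
    apply: eq_bigr => c _; rewrite mulrDr mulr_sumr (G_sym b c a); congr (_ + _).
    by apply: eq_bigr => d _; rewrite mulrA.
  - rewrite big_split/=; congr (_ + _).
      by apply: eq_bigr => b _; rewrite ddX_sym.
    by rewrite -big_split/=; apply: eq_bigr => b _; rewrite -big_split.
have -> : \sum_d Ric a d * X d = S1 - S2 + (S5 - S6).
  under eq_bigr do rewrite /Ric mulr_suml.
  rewrite exchange_big/= -!sumrB -big_split/=; apply: eq_bigr => b _.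
  rewrite -!sumrB; under eq_bigr do rewrite mulrDl mulrBl.
  rewrite big_split/= sumrB; congr (_ + _).
  under eq_bigr do rewrite mulr_suml.
  rewrite exchange_big/=; apply: eq_bigr => c _.
  by rewrite -sumrB; apply: eq_bigr => d _; rewrite mulrBl.
ring.
Qed.

(** The left side is the coordinate divergence of D_X X, with the contracted Christoffel symbol as
    the logarithmic derivative of the density. The right side is X(div X) + Ric(X, X) + tr((D X)^2),
    for an arbitrary field X. The product rule and the contracted Ricci identity suffice, the
    quadratic Christoffel terms being reabsorbed in the trace. *)
Lemma bochner_yano_algebra :
  \sum_b (\sum_a (dX b a * N a b + X a * dN b a b))
    + \sum_b (\sum_a G a a b) * (\sum_a X a * N a b)
  = \sum_a X a * (\sum_b dN a b b) + \sum_a \sum_d X a * Ric a d * X d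
    + \sum_a \sum_b N b a * N a b.
Proof.
pose T1 := \sum_a \sum_b dX b a * N a b.
pose T2 := \sum_a X a * \sum_b dN b a b.
pose T3 := \sum_a X a * \sum_b \sum_c G b b c * N a c.
pose T4 := \sum_a X a * \sum_b \sum_c G c b a * N c b.
pose T5 := \sum_a X a * \sum_b dN a b b.
have E : \sum_a \sum_d X a * Ric a d * X d = T2 + T3 - T4 - T5.
  rewrite -big_split/= -!sumrB; apply: eq_bigr => a _.
  under eq_bigr do rewrite -mulrA.
  rewrite -mulr_sumr -contracted_ricci_identity -mulrDr -!mulrBr; congr (_ * _).
  by rewrite !sumrB big_split.
have -> : \sum_b (\sum_a (dX b a * N a b + X a * dN b a b)) = T1 + T2.
  rewrite exchange_big/= -big_split/=; apply: eq_bigr => a _.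
  by rewrite big_split/= mulr_sumr.
have -> : \sum_b (\sum_a G a a b) * (\sum_a X a * N a b) = T3.
  under eq_bigr do rewrite mulr_sumr.
  rewrite exchange_big/=; apply: eq_bigr => e _.
  rewrite [\sum_b \sum_c _]exchange_big/= mulr_sumr; apply: eq_bigr => b _.
  by rewrite -mulr_suml mulrCA.
have -> : \sum_a \sum_b N b a * N a b = T1 + T4.
  rewrite /T4; under [in RHS]eq_bigr do rewrite exchange_big mulr_sumr.
  rewrite [\sum_a \sum_b X a * _]exchange_big/= -big_split/=; apply: eq_bigr => a _.
  under [X in _ = _ + X]eq_bigr do rewrite mulr_sumr.
  rewrite [X in _ = _ + X]exchange_big/= -big_split/=; apply: eq_bigr => b _.
  rewrite {1}/N mulrDl mulr_suml; congr (_ + _); apply: eq_bigr => c _.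
  by rewrite -mulrA mulrCA.
rewrite E -/T5; ring.
Qed.

End BochnerAlgebra.

Section SmoothFunctions.
Context {R : realType} {n : nat}.
Implicit Types (U : set 'rV[R]_n) (u v : 'rV[R]_n -> R).

Lemma smooth_on_partial U u a : smooth_on U u -> smooth_on U (partial a u).
Proof. by move=> su k; exact: Ck_on_partial (su k.+1). Qed.

Lemma smooth_on_has_partials U u x : smooth_on U u -> U x -> has_partials u x.
Proof. by move=> su; exact: Ck_on_has_partials (su 1%N). Qed.

Lemma smooth_on_eq U u v : open U -> (forall y, U y -> u y = v y) ->
  smooth_on U u -> smooth_on U v.
Proof. by move=> oU uv su k; exact: Ck_on_eq oU uv (su k). Qed.

Lemma smooth_on_cst U (c : R) : open U -> smooth_on U (fun=> c).
Proof. by move=> oU k; exact: Ck_on_cst. Qed.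

Lemma smooth_onD U u v : open U -> smooth_on U u -> smooth_on U v ->
  smooth_on U (fun y => u y + v y).
Proof. by move=> oU su sv k; exact: Ck_onD (su k) (sv k). Qed.

Lemma smooth_onB U u v : open U -> smooth_on U u -> smooth_on U v ->
  smooth_on U (fun y => u y - v y).
Proof. by move=> oU su sv k; exact: Ck_onB (su k) (sv k). Qed.

Lemma smooth_onM U u v : open U -> smooth_on U u -> smooth_on U v ->
  smooth_on U (fun y => u y * v y).
Proof. by move=> oU su sv k; exact: Ck_onM (su k) (sv k). Qed.

Lemma smooth_on_sum U (I : Type) (r : seq I) (P : pred I)
    (F : I -> 'rV[R]_n -> R) : open U ->
  (forall i, P i -> smooth_on U (F i)) ->
  smooth_on U (fun y => \sum_(i <- r | P i) F i y).
Proof. by move=> oU sF k; apply: Ck_on_sum => // i Pi; exact: sF. Qed.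

Lemma smooth_on_invmx U p (B : 'rV[R]_n -> 'M[R]_p) : open U ->
  (forall y, U y -> B y \in unitmx) ->
  (forall a b, smooth_on U (fun y => B y a b)) ->
  forall a b, smooth_on U (fun y => invmx (B y) a b).
Proof. by move=> oU uB sB a b k; apply: Ck_on_invmx => // c d; exact: sB. Qed.

Lemma has_partials_sqrt u x : differentiable u x -> 0 < u x ->
  has_partials (fun y => Num.sqrt (u y)) x.
Proof.
move=> du u0 i; apply/diff_derivable.
apply: (@differentiable_comp _ _ _ _ u (@Num.sqrt R)) => //.
by apply/derivable1_diffP; case: (is_derive1_sqrt u0).
Qed.

(** Differentiating u = sqrt(u) sqrt(u) and solving for the derivative of the root. *)
Lemma partial_sqrt U u x i : open U -> (forall y, U y -> 0 < u y) -> U x ->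
  differentiable u x ->
  partial i (fun y => Num.sqrt (u y)) x = partial i u x / (Num.sqrt (u x) *+ 2).
Proof.
move=> oU u0 Ux du; have hs := has_partials_sqrt du (u0 _ Ux).
rewrite (@partial_eq_on _ _ U i u (fun y => Num.sqrt (u y) * Num.sqrt (u y)) x)//.
  rewrite partialM//; move: (partial i _ x) => p.
  have s0 : Num.sqrt (u x) != 0 by rewrite sqrtr_eq0 -ltNge u0.
  by move: (Num.sqrt (u x)) s0 => q q0; field.
by move=> y Uy; rewrite -expr2 sqr_sqrtr// ltW// u0.
Qed.

Lemma Ck_on_sqrt k U u : open U -> (forall y, U y -> 0 < u y) ->
  Ck_on k.+1 U u -> Ck_on k.+1 U (fun y => Num.sqrt (u y)).
Proof.
move=> oU u0 cu1.
have du x : U x -> differentiable u x.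
  by apply: C1_differentiable => //; exact: Ck_on_le cu1.
have cs x : U x -> {for x, continuous (fun y => Num.sqrt (u y))}.
  move=> Ux; apply: (@continuous_comp _ _ _ u (@Num.sqrt R)); last exact: sqrt_continuous.
  exact: Ck_on_continuous cu1 Ux.
have s0 y : U y -> Num.sqrt (u y) *+ 2 != 0.
  by move=> Uy; rewrite mulrn_eq0/= sqrtr_eq0 -ltNge u0.
(* Bootstrapping: the derivative is du / (2 sqrt u), so order l of the root gives order l + 1 as
   long as [u] has enough derivatives. *)
suff : forall l, (l <= k.+1)%N -> Ck_on l U (fun y => Num.sqrt (u y)) by exact.
elim=> [_|l IH lk]; first by split => // x; exact: cs.
apply: Ck_onS => // [x Ux|i].
  by apply: has_partials_sqrt; [exact: du|exact: u0].
apply: (@Ck_on_eq _ _ _ _ (fun y => partial i u y * (Num.sqrt (u y) *+ 2)^-1)) => //.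
  by move=> y Uy; rewrite (partial_sqrt _ oU)//; exact: du.
apply: Ck_onM => //.
  by apply: Ck_on_partial; exact: Ck_on_le cu1.
have cl := IH (ltnW lk).
apply: Ck_onV => //.
apply: (@Ck_on_eq _ _ _ _ (fun y => Num.sqrt (u y) + Num.sqrt (u y))) => //.
exact: Ck_onD.
Qed.

End SmoothFunctions.

Section ChartComputations.
Context {R : realType} {n : nat} {M : topologicalType}.
Context {A : smooth_manifold R n M} (g : riemannian_metric A).
Variable i : chart_index A.
Let V := chart_img (chart_of i).

Let oV : open V := @chart_img_open _ _ _ (chart_of i).

Lemma metric_entry_smooth a b : smooth_on V (fun y => g i y a b).
Proof. exact: (metric_smooth g).1. Qed.

Lemma metric_posdef x : V x -> posdef (g i x).
Proof. move=> Vx; split; [exact: (Defs.metric_sym g Vx)|exact: (metric_pos g Vx)]. Qed.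

Lemma metric_unit x : V x -> g i x \in unitmx.
Proof. by move=> /metric_posdef/posdef_unitmx. Qed.

Lemma metric_det_gt0 x : V x -> 0 < \det (g i x).
Proof. by move=> /metric_posdef/posdef_det_gt0. Qed.

Lemma metricC x a b : V x -> g i x a b = g i x b a.
Proof. by move=> /metric_posdef[gT _]; rewrite -[in LHS]gT mxE. Qed.

Lemma inv_metricC x a b : V x -> invmx (g i x) a b = invmx (g i x) b a.
Proof.
move=> /metric_posdef[gT _]; have : (invmx (g i x))^T = invmx (g i x).
  by rewrite trmx_inv gT.
by move=> hT; rewrite -[in LHS]hT mxE. Qed.

Lemma partial_metricC x a b c : V x ->
  partial c (fun y => g i y a b) x = partial c (fun y => g i y b a) x.
Proof. by move=> Vx; exact: (@partial_eq_on _ _ V c _ _ x oV Vx (fun y => @metricC y a b)). Qed.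

Lemma inv_metric_smooth a b : smooth_on V (fun y => invmx (g i y) a b).
Proof.
by apply: smooth_on_invmx => //; [exact: metric_unit|exact: metric_entry_smooth].
Qed.

Lemma christoffel_smooth c a b : smooth_on V (christoffel g c a b i).
Proof.
apply: smooth_onM => //; first exact: smooth_on_cst.
apply: smooth_on_sum => // d _; apply: smooth_onM => //.
  exact: inv_metric_smooth.
apply: smooth_onB => //; last exact/smooth_on_partial/metric_entry_smooth.
by apply: smooth_onD => //; apply: smooth_on_partial; exact: metric_entry_smooth.
Qed.

Lemma christoffelC x c a b : V x -> christoffel g c a b i x = christoffel g c b a i x.
Proof.
move=> Vx; rewrite /christoffel; congr (_ * _); apply: eq_bigr => d _.
by rewrite (partial_metricC a b d Vx) [X in _ * (X - _)]addrC.
Qed.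

(* [\sum_b Gamma^b_ac g_bd], the Christoffel symbol of the first kind. *)
Lemma christoffel_lower x a c d : V x ->
  \sum_b christoffel g b a c i x * g i x b d = 2^-1 *
    (partial a (fun y => g i y c d) x + partial c (fun y => g i y a d) x
     - partial d (fun y => g i y a c) x).
Proof.
move=> Vx; rewrite /christoffel.
under eq_bigr do rewrite -mulrA.
rewrite -mulr_sumr; congr (_ * _).
under eq_bigr do rewrite mulr_suml.
rewrite exchange_big/= (bigD1 d)//= [X in _ + X]big1 => [|e ed].
  rewrite addr0.
  under eq_bigr do rewrite mulrAC.
  rewrite -mulr_suml.
  rewrite (_ : \sum_(j < n) _ = 1) ?mul1r//.
  have := mulVmx (metric_unit Vx) => /matrixP/(_ d d); rewrite !mxE eqxx => H; apply: etrans H.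
  by apply: eq_bigr => b _; rewrite inv_metricC.
under eq_bigr do rewrite mulrAC.
rewrite -mulr_suml (_ : \sum_(j < n) _ = 0) ?mul0r//.
have := mulVmx (metric_unit Vx) => /matrixP/(_ e d); rewrite !mxE (negbTE ed) => H; apply: etrans H.
by apply: eq_bigr => b _; rewrite inv_metricC.
Qed.

(** Of the three metric derivatives two cancel on contraction, because the inverse metric is
    symmetric. *)
Lemma christoffel_trace x b : V x ->
  \sum_a christoffel g a a b i x =
  2^-1 * \sum_a \sum_d invmx (g i x) a d * partial b (fun y => g i y a d) x.
Proof.
move=> Vx; rewrite /christoffel -mulr_sumr; congr (_ * _).
under eq_bigr do under eq_bigr do rewrite mulrBr mulrDr.
under eq_bigr do rewrite sumrB big_split/=.
rewrite sumrB big_split/= [X in X + _ - _]exchange_big/=.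
rewrite addrAC -[RHS]add0r; congr (_ + _); apply/eqP; rewrite subr_eq0; apply/eqP.
apply: eq_bigr => a _; apply: eq_bigr => d _.
by rewrite inv_metricC// (partial_metricC _ _ _ Vx).
Qed.

(** Jacobi's formula for det g. This makes the divergence w^-1 d_b (w Z^b), with w = sqrt(det g),
    agree with the trace of the covariant derivative of Z. *)
Lemma partial_sqrt_det x b : V x ->
  partial b (fun y => Num.sqrt (\det (g i y))) x =
  Num.sqrt (\det (g i x)) * \sum_a christoffel g a a b i x.
Proof.
move=> Vx; have hg a c : has_partials (fun y => g i y a c) x.
  by apply: smooth_on_has_partials Vx; exact: metric_entry_smooth.
have cdet : Ck_on 1 V (fun y => \det (g i y)).
  by apply: Ck_on_det => // a c; exact: metric_entry_smooth.
rewrite (partial_sqrt _ oV)//; [|exact: metric_det_gt0|exact: C1_differentiable cdet Vx].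
rewrite partial_det_unit//; last exact: metric_unit.
rewrite christoffel_trace//.
have -> : \sum_a \sum_d invmx (g i x) d a * partial b (fun y => g i y a d) x =
    \sum_a \sum_d invmx (g i x) a d * partial b (fun y => g i y a d) x.
  by apply: eq_bigr => a _; apply: eq_bigr => d _; rewrite inv_metricC.
have d0 := metric_det_gt0 Vx.
have s0 : Num.sqrt (\det (g i x)) != 0 by rewrite sqrtr_eq0 -ltNge.
rewrite -{1}(sqr_sqrtr (ltW d0)).
by move: (Num.sqrt _) s0 (\sum_a _) => s s0 t; field.
Qed.

Section VectorField.
Variable X : vfield A.
Hypothesis sX : forall a, smooth_on V (fun y => X i y 0 a).

(** The component (D_a X)^b of the Levi-Civita derivative, direction of differentiation first. *)
Definition nabla (a b : 'I_n) (y : 'rV[R]_n) : R :=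
  partial a (fun z => X i z 0 b) y + \sum_c christoffel g b a c i y * X i y 0 c.

Lemma nabla_smooth a b : smooth_on V (nabla a b).
Proof.
apply: smooth_onD => //; first exact: smooth_on_partial.
apply: smooth_on_sum => // c _; apply: smooth_onM => //.
exact: christoffel_smooth.
Qed.

Lemma partial_nabla x d a b : V x ->
  partial d (nabla a b) x = partial d (partial a (fun z => X i z 0 b)) x +
    \sum_c (partial d (christoffel g b a c i) x * X i x 0 c
            + christoffel g b a c i x * partial d (fun z => X i z 0 c) x).
Proof.
move=> Vx.
have hX c : has_partials (fun z => X i z 0 c) x by exact: smooth_on_has_partials Vx.
have hG c : has_partials (christoffel g b a c i) x.
  by apply: smooth_on_has_partials Vx; exact: christoffel_smooth.
rewrite partialD; last first.
- by apply: has_partials_sum => c _; exact: has_partialsM.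
- by apply: smooth_on_has_partials Vx; exact: smooth_on_partial.
congr (_ + _); rewrite partial_sum; last by move=> c _; exact: has_partialsM.
by apply: eq_bigr => c _; exact: partialM.
Qed.

(** The algebraic identity evaluated at a point of the chart; its symmetry assumptions are the
    equality of mixed partials of X and the vanishing torsion. Note that \sum_b nabla b b is div
    X. *)
Lemma bochner_yano x : V x ->
  \sum_b partial b (fun y => \sum_a X i y 0 a * nabla a b y) x
  + \sum_b (\sum_a christoffel g a a b i x) * (\sum_a X i x 0 a * nabla a b x)
  = \sum_a X i x 0 a * partial a (fun y => \sum_b nabla b b y) x
    + eval2 (ricci g) X X i x + \sum_a \sum_b nabla b a x * nabla a b x.
Proof.
move=> Vx.
have hX c : has_partials (fun z => X i z 0 c) x by exact: smooth_on_has_partials Vx.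
have hN a b : has_partials (nabla a b) x.
  by apply: smooth_on_has_partials Vx; exact: nabla_smooth.
have := @bochner_yano_algebra R n (fun a => X i x 0 a)
  (fun a b => partial a (fun z => X i z 0 b) x)
  (fun d a b => partial d (partial a (fun z => X i z 0 b)) x)
  (fun c a b => christoffel g c a b i x)
  (fun d c a b => partial d (christoffel g c a b i) x).
move=> H.
have -> : \sum_b partial b (fun y => \sum_a X i y 0 a * nabla a b y) x =
  \sum_b \sum_a (partial b (fun z => X i z 0 a) x * nabla a b x +
                 X i x 0 a * partial b (nabla a b) x).
  apply: eq_bigr => b _; rewrite partial_sum; last by move=> a _; exact: has_partialsM.
  by apply: eq_bigr => a _; exact: partialM.
have -> : \sum_a X i x 0 a * partial a (fun y => \sum_b nabla b b y) x =
  \sum_a X i x 0 a * \sum_b partial a (nabla b b) x.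
  by apply: eq_bigr => a _; rewrite partial_sum// => b _; exact: hN.
have -> : eval2 (ricci g) X X i x =
    \sum_a \sum_d X i x 0 a * ricci g i x a d * X i x 0 d.
  rewrite /eval2 mxE exchange_big/=; apply: eq_bigr => d _.
  by rewrite !mxE mulr_suml.
under eq_bigr do under eq_bigr do rewrite partial_nabla//.
under [in RHS]eq_bigr do under eq_bigr do rewrite partial_nabla//.
rewrite /ricci; under [X in _ = _ + X + _]eq_bigr do under eq_bigr do rewrite mxE.
apply: H.
- move=> a b c; apply: partial_symmetric oV _ Vx; exact: (sX c 2).
- by move=> c a b; exact: christoffelC.
Qed.

End VectorField.

End ChartComputations.

(** * Gradient fields: the covariant derivative is half the Lie derivative of the metric *)

Section GradientField.
Context {R : realType} {n : nat} {M : topologicalType}.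
Context {A : smooth_manifold R n M} (g : riemannian_metric A).
Variable i : chart_index A.
Let V := chart_img (chart_of i).
Let oV : open V := @chart_img_open _ _ _ (chart_of i).
Variable u : sfield A.
Hypothesis su : smooth_on V (u i).
Let X := grad g u.

Lemma grad_smooth a : smooth_on V (fun y => X i y 0 a).
Proof.
apply: (@smooth_on_eq _ _ V (fun y => \sum_b invmx (g i y) a b * partial b (u i) y)) => //.
  by move=> y _; rewrite mxE.
apply: smooth_on_sum => // b _; apply: smooth_onM => //.
  exact: inv_metric_smooth.
exact: smooth_on_partial.
Qed.

Lemma grad_lower x d : V x -> \sum_b X i x 0 b * g i x b d = partial d (u i) x.
Proof.
move=> Vx.
under eq_bigr do rewrite mxE mulr_suml.
rewrite exchange_big/= (bigD1 d)//= [X in _ + X]big1 => [|e ed].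
  rewrite addr0; under eq_bigr do rewrite mulrAC.
  rewrite -mulr_suml (_ : \sum_(j < n) _ = 1) ?mul1r//.
  have := mulVmx (metric_unit g Vx) => /matrixP/(_ d d); rewrite !mxE eqxx => H.
  by apply: etrans H; apply: eq_bigr => b _; rewrite inv_metricC.
under eq_bigr do rewrite mulrAC.
rewrite -mulr_suml (_ : \sum_(j < n) _ = 0) ?mul0r//.
have := mulVmx (metric_unit g Vx) => /matrixP/(_ e d); rewrite !mxE (negbTE ed) => H.
by apply: etrans H; apply: eq_bigr => b _; rewrite inv_metricC.
Qed.

(** The index of D X lowered: g(D_a X, d_d), which is the Hessian of [u]. Christoffel symbols of the
    first kind then replace those with the inverse metric. *)
Let P x a d := \sum_b nabla g i X a b x * g i x b d.

Let P_first_kind x a d : V x -> P x a d =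
  \sum_b partial a (fun z => X i z 0 b) x * g i x b d +
  2^-1 * \sum_c X i x 0 c * (partial a (fun y => g i y c d) x
    + partial c (fun y => g i y a d) x - partial d (fun y => g i y a c) x).
Proof.
move=> Vx; rewrite /P /nabla; under eq_bigr do rewrite mulrDl.
rewrite big_split/=; congr (_ + _).
under eq_bigr do rewrite mulr_suml; rewrite exchange_big/= mulr_sumr.
apply: eq_bigr => c _; rewrite mulrCA -christoffel_lower// mulr_sumr.
by apply: eq_bigr => b _; rewrite mulrAC mulrC.
Qed.

Let P_sym x a d : V x -> P x a d = P x d a.
Proof.
move=> Vx.
have hX c : has_partials (fun z => X i z 0 c) x.
  by apply: smooth_on_has_partials Vx; exact: grad_smooth.
have hg b c : has_partials (fun y => g i y b c) x.
  by apply: smooth_on_has_partials Vx; exact: metric_entry_smooth.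
(* Differentiation of X_f = d_f u moves the derivative from X to the metric; what remains is a
   second derivative of [u] and metric derivatives, both symmetric in a and d after combination. *)
have dE e f : \sum_b partial e (fun z => X i z 0 b) x * g i x b f =
   partial e (partial f (u i)) x - \sum_c X i x 0 c * partial e (fun y => g i y c f) x.
  apply/eqP; rewrite eq_sym subr_eq; apply/eqP.
  rewrite -big_split/=.
  rewrite (@partial_eq_on _ _ V e _ (fun y => \sum_b X i y 0 b * g i y b f) x)//; last first.
    by move=> y Vy; rewrite grad_lower.
  rewrite partial_sum; last by move=> b _; exact: has_partialsM.
  by apply: eq_bigr => b _; rewrite partialM.
rewrite !P_first_kind// !dE (partial_symmetric a d oV (su 2) Vx).
rewrite -!addrA; congr (_ + _).
rewrite !mulr_sumr -!sumrN -!big_split/=; apply: eq_bigr => c _.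
rewrite (partial_metricC g d c a Vx) (partial_metricC g a c d Vx).
rewrite (partial_metricC g c d a Vx) (partial_metricC g d a c Vx).
move: (X i x 0 c) (partial _ _ x) (partial _ _ x) (partial _ _ x) => p q r s.
by field.
Qed.

(** The Christoffel terms of the two orderings add up to X^c d_c g_ad, the transport term of the Lie
    derivative. *)
Let lieE x a d : V x -> lie X g i x a d = P x a d + P x d a.
Proof.
move=> Vx; rewrite !P_first_kind// mxE !big_split/=.
have -> : \sum_c X i x 0 c * partial c (fun y => g i y a d) x =
   2^-1 * (\sum_c X i x 0 c * (partial a (fun y => g i y c d) x
    + partial c (fun y => g i y a d) x - partial d (fun y => g i y a c) x)) +
   2^-1 * (\sum_c X i x 0 c * (partial d (fun y => g i y c a) x
    + partial c (fun y => g i y d a) x - partial a (fun y => g i y d c) x)).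
  rewrite !mulr_sumr -big_split/=; apply: eq_bigr => c _.
  rewrite (partial_metricC g d c a Vx) (partial_metricC g a c d Vx).
  rewrite (partial_metricC g c d a Vx) (partial_metricC g d a c Vx).
  move: (X i x 0 c) (partial _ _ x) (partial _ _ x) (partial _ _ x) => p q r s.
  by field.
have -> : \sum_c partial d (fun y => X i y 0 c) x * g i x a c =
  \sum_b partial d (fun z => X i z 0 b) x * g i x b a.
  by apply: eq_bigr => b _; rewrite (metricC g a b Vx).
ring.
Qed.

(** By symmetry of the Hessian, L_X g is twice the lowered D X. Thereby D X inherits its change of
    chart from a Lie derivative. *)
Lemma nabla_grad x a b : V x ->
  nabla g i X a b x = (2^-1 *: (lie X g i x *m invmx (g i x))) a b.
Proof.
move=> Vx; pose N := \matrix_(a, b) nabla g i X a b x.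
have NG : N *m g i x = 2^-1 *: lie X g i x.
  apply/matrixP => c d; rewrite [LHS]mxE [RHS]mxE lieE// (P_sym d c Vx).
  have -> : \sum_j N c j * g i x j d = P x c d.
    by apply: eq_bigr => b' _; rewrite mxE.
  by move: (P x c d) => p; field.
rewrite scalemxAl -NG mulmxK ?metric_unit//.
by rewrite mxE.
Qed.

Lemma lie_grad_sym x : V x -> (lie X g i x)^T = lie X g i x.
Proof. by move=> Vx; apply/matrixP => a d; rewrite mxE !lieE// addrC. Qed.

End GradientField.

(** * Tensor fields under changes of charts *)

Section Overlap.
Context {R : realType} {n : nat} {M : topologicalType}.
Variable A : smooth_manifold R n M.
Implicit Types (i j : chart_index A) (x : 'rV[R]_n).

Lemma chart_inv_continuous_at (c : chart R n M) x : chart_img c x ->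
  {for x, continuous (chart_inv c)}.
Proof.
move=> cx; have := @chart_inv_continuous _ _ _ c.
rewrite continuous_open_subspace; last exact: chart_img_open.
by apply; rewrite inE.
Qed.

Lemma chart_map_continuous_at (c : chart R n M) p : chart_dom c p ->
  {for p, continuous (chart_map c)}.
Proof.
move=> cp; have := @chart_map_continuous _ _ _ c.
rewrite continuous_open_subspace; last exact: chart_dom_open.
by apply; rewrite inE.
Qed.

Lemma overlap_open (c d : chart R n M) : open (overlap c d).
Proof.
apply: preimage_open_on; [exact: chart_img_open| |exact: chart_dom_open].
by move=> x; exact: chart_inv_continuous_at.
Qed.

Lemma transition_img (c d : chart R n M) x : overlap c d x ->
  chart_img d (transition c d x).
Proof. by move=> [_ dx]; exact: chart_map_img. Qed.

Section Transition.
Variables i j : chart_index A.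
Let O := overlap (chart_of i) (chart_of j).
Let t := transition (chart_of i) (chart_of j).
Let oO : open O := @overlap_open (chart_of i) (chart_of j).

Lemma transition_differentiable x : O x -> differentiable t x.
Proof.
move=> Ox; apply: differentiable_row => a.
exact: C1_differentiable oO (transition_smooth i j a 1) Ox.
Qed.

Lemma transition_jacobian x a b : O x ->
  jacobian t x a b = partial a (fun y => t y 0 b) x.
Proof. by move=> Ox; apply: jacobian_partial; exact: transition_differentiable. Qed.

Lemma jacobian_smooth a b : smooth_on O (fun y => jacobian t y a b).
Proof.
apply: (@smooth_on_eq _ _ O (partial a (fun y => t y 0 b))) => //.
  by move=> y Oy; rewrite transition_jacobian.
exact/smooth_on_partial/transition_smooth.
Qed.

(** Mixed second partials of the transition map commute. *)
Lemma partial_jacobianC x a b c : O x ->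
  partial c (fun y => jacobian t y a b) x = partial a (fun y => jacobian t y c b) x.
Proof.
move=> Ox.
rewrite (@partial_eq_on _ _ O c _ (partial a (fun y => t y 0 b)))//; last first.
  by move=> y Oy; rewrite transition_jacobian.
rewrite (partial_symmetric c a oO (transition_smooth i j b 2) Ox).
apply: (@partial_eq_on _ _ O a _ _ x oO Ox) => y Oy.
by rewrite transition_jacobian.
Qed.

Lemma overlap_comp_partials (u : 'rV[R]_n -> R) x :
  Ck_on 1 (chart_img (chart_of j)) u -> O x ->
  has_partials (u \o t) x /\ forall a,
  partial a (u \o t) x = \sum_b jacobian t x a b * partial b u (t x).
Proof.
move=> cu Ox; have dt := transition_differentiable Ox.
have du : differentiable u (t x).
  apply: C1_differentiable cu _; first exact: chart_img_open.
  exact: transition_img.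
by split; [exact: comp_has_partials|move=> a; exact: partial_comp].
Qed.

End Transition.

Definition partial_mx p q (c : 'I_n) (F : 'rV[R]_n -> 'M[R]_(p, q)) x : 'M[R]_(p, q) :=
  \matrix_(a, b) partial c (fun y => F y a b) x.

Lemma partial_mulmx p q r c (F : 'rV[R]_n -> 'M[R]_(p, q))
    (G : 'rV[R]_n -> 'M[R]_(q, r)) x :
  (forall a b, has_partials (fun y => F y a b) x) ->
  (forall a b, has_partials (fun y => G y a b) x) ->
  (forall a b, has_partials (fun y => (F y *m G y) a b) x) /\
  partial_mx c (fun y => F y *m G y) x =
  partial_mx c F x *m G x + F x *m partial_mx c G x.
Proof.
move=> hF hG.
have E a b : (fun y => (F y *m G y) a b) = fun y => \sum_k F y a k * G y k b.
  by apply/funext => y; rewrite mxE.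
split=> [a b|].
  by rewrite E; apply: has_partials_sum => k _; exact: has_partialsM.
apply/matrixP => a b; rewrite [LHS]mxE E [RHS]mxE [X in _ = X + _]mxE [X in _ = _ + X]mxE.
rewrite partial_sum; last by move=> k _; exact: has_partialsM.
rewrite -big_split/=; apply: eq_bigr => k _.
by rewrite partialM// [partial_mx c F x _ _]mxE [partial_mx c G x _ _]mxE.
Qed.

Section LieDerivative.
Variables (X : vfield A) (T : tfield A).
Hypotheses (sX : smooth_vfield X) (sT : smooth_tfield T).

Let DX i x : 'M[R]_n := \matrix_(a, c) partial a (fun y => X i y 0 c) x.
Let DT i c x : 'M[R]_n := partial_mx c (T i) x.

Lemma lie_mxE i x : lie X T i x =
  \sum_c X i x 0 c *: DT i c x + DX i x *m T i x + T i x *m (DX i x)^T.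
Proof.
apply/matrixP => a b; rewrite !mxE summxE !big_split/=; congr (_ + _ + _).
- by apply: eq_bigr => c _; rewrite !mxE.
- by apply: eq_bigr => c _; rewrite !mxE.
- by apply: eq_bigr => c _; rewrite !mxE mulrC.
Qed.

(** The Lie derivative involves no connection, yet it is a tensor: the derivative E = X^c d_c J of
    the Jacobian enters the transport term through T and the other two terms through X, and these
    contributions match. *)
Lemma lie_transform i j x : overlap (chart_of i) (chart_of j) x ->
  let t := transition (chart_of i) (chart_of j) in
  lie X T i x = jacobian t x *m lie X T j (t x) *m (jacobian t x)^T.
Proof.
move=> Ox t; set O := overlap _ _ in Ox.
have oO : open O := @overlap_open _ _.
have Vx y : O y -> chart_img (chart_of i) y by case.
pose J := jacobian t x.
pose D c : 'M[R]_n := partial_mx c (jacobian t) x.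
have hJ a p : has_partials (fun y => jacobian t y a p) x.
  exact: smooth_on_has_partials (jacobian_smooth i j a p) Ox.
pose E := \sum_c X i x 0 c *: D c.
have XE y : O y -> X j (t y) = X i y *m jacobian t y by exact: sX.2.
have TE y : O y -> T i y = jacobian t y *m T j (t y) *m (jacobian t y)^T.
  exact: sT.2.
have hX a : has_partials (fun y => X i y 0 a) x.
  exact: smooth_on_has_partials (sX.1 i a) (Vx _ Ox).
have cX a := overlap_comp_partials (sX.1 j a 1%N) Ox.
have cT a b := overlap_comp_partials (sT.1 j a b 1%N) Ox.
(* Differentiating X_j(t) = X_i J gives X^c d_a J_cp, which equals X^c d_c J_ap, an entry of [E], by
   symmetry of the second derivatives of t. *)
have E1 : J *m DX j (t x) = DX i x *m J + E.
  apply/matrixP => a p; rewrite [LHS]mxE [RHS]mxE [X in _ = X + _]mxE summxE.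
  have := (cX p).2 a.
  rewrite (@partial_eq_on _ _ O a _ (fun y => \sum_c X i y 0 c * jacobian t y c p))//; last first.
    by move=> y Oy /=; rewrite XE// mxE.
  rewrite partial_sum; last by move=> c _; exact: has_partialsM.
  move=> H; transitivity (\sum_b jacobian t x a b * partial b (fun y => X j y 0 p) (t x)).
    by apply: eq_bigr => b _; rewrite [DX _ _ _ _]mxE.
  rewrite -H -big_split/=; apply: eq_bigr => c _.
  rewrite partialM// [DX _ _ _ _]mxE [(_ *: D c) _ _]mxE [D _ _ _]mxE.
  by rewrite (partial_jacobianC a p c Ox).
pose S c : 'M[R]_n := \sum_r J c r *: DT j r (t x).
have E2 c : DT i c x = D c *m T j (t x) *m J^T + J *m S c *m J^T + J *m T j (t x) *m (D c)^T.
  have -> : DT i c x =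
      partial_mx c (fun y => jacobian t y *m T j (t y) *m (jacobian t y)^T) x.
    apply/matrixP => a b; rewrite [LHS]mxE [RHS]mxE.
    by apply: (@partial_eq_on _ _ O c _ _ x oO Ox) => y Oy; rewrite TE.
  have hT a b : has_partials (fun y => T j (t y) a b) x by exact: (cT a b).1.
  have hJT a b : has_partials (fun y => (jacobian t y)^T a b) x.
    by rewrite (_ : (fun _ => _) = fun y => jacobian t y b a)//; apply/funext => y; rewrite mxE.
  have [hJTj E3] := partial_mulmx c hJ hT.
  rewrite (partial_mulmx c hJTj hJT).2 E3.
  have -> : partial_mx c (fun y => (jacobian t y)^T) x = (D c)^T.
    apply/matrixP => a b; rewrite [LHS]mxE [RHS]mxE [D c _ _]mxE.
    by congr (partial _ _ _); apply/funext => y; rewrite mxE.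
  have -> : partial_mx c (fun y => T j (t y)) x = S c.
    apply/matrixP => a b; rewrite [LHS]mxE /S summxE [LHS](cT a b).2.
    by apply: eq_bigr => r _; rewrite [RHS]mxE [DT _ _ _ _ _]mxE.
  by rewrite mulmxDl.
rewrite !lie_mxE -/J.
have -> : \sum_c X i x 0 c *: DT i c x =
    E *m T j (t x) *m J^T + J *m (\sum_r X j (t x) 0 r *: DT j r (t x)) *m J^T
    + J *m T j (t x) *m E^T.
  have -> : \sum_r X j (t x) 0 r *: DT j r (t x) = \sum_c X i x 0 c *: S c.
    under [RHS]eq_bigr do rewrite /S scaler_sumr.
    rewrite exchange_big/=; apply: eq_bigr => r _.
    rewrite XE// mxE scaler_suml; apply: eq_bigr => c _.
    by rewrite scalerA.
  under eq_bigr do rewrite E2 !scalerDr.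
  rewrite !big_split/=; congr (_ + _ + _).
  - by rewrite /E !mulmx_suml; apply: eq_bigr => c _; rewrite -!scalemxAl.
  - rewrite mulmx_sumr mulmx_suml; apply: eq_bigr => c _.
    by rewrite -scalemxAr -scalemxAl.
  - rewrite /E linear_sum mulmx_sumr; apply: eq_bigr => c _.
    by rewrite linearZ/= -scalemxAr.
rewrite TE// -/J.
have -> : J *m (\sum_c X j (t x) 0 c *: DT j c (t x) + DX j (t x) *m T j (t x)
      + T j (t x) *m (DX j (t x))^T) *m J^T
    = J *m (\sum_r X j (t x) 0 r *: DT j r (t x)) *m J^T
      + (J *m DX j (t x)) *m T j (t x) *m J^T + J *m T j (t x) *m (J *m DX j (t x))^T.
  by rewrite !mulmxDr !mulmxDl trmx_mul !mulmxA.
rewrite E1 linearD/= trmx_mul !mulmxDr !mulmxDl !mulmxA.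
have AC (W : zmodType) (a b c d e : W) : a + b + c + d + e = b + (d + a) + (e + c).
  rewrite (addrC d) (addrA b) (addrC b) -!addrA; congr (_ + (_ + _)).
  by rewrite addrC -addrA.
exact: AC.
Qed.

Lemma lie_smooth_tfield : smooth_tfield (lie X T).
Proof.
split=> [i a b|i j x Ox /=]; last exact: lie_transform.
have oV : open (chart_img (chart_of i)) by exact: chart_img_open.
pose F y := \sum_c (X i y 0 c * partial c (fun z => T i z a b) y
     + partial a (fun z => X i z 0 c) y * T i y c b
     + partial b (fun z => X i z 0 c) y * T i y a c).
apply: (@smooth_on_eq _ _ _ F) => //; first by move=> y _; rewrite mxE.
have sXi c : smooth_on (chart_img (chart_of i)) (fun z => X i z 0 c) by exact: sX.1.
have sTi c d : smooth_on (chart_img (chart_of i)) (fun z => T i z c d) by exact: sT.1.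
apply: smooth_on_sum => // c _; apply: smooth_onD => //; first apply: smooth_onD => //.
- by apply: smooth_onM => //; exact: smooth_on_partial.
- by apply: smooth_onM => //; exact: smooth_on_partial.
- by apply: smooth_onM => //; exact: smooth_on_partial.
Qed.

End LieDerivative.

End Overlap.

(** * Chart-independent values, and tensors with a raised index *)

Section ScalarFields.
Context {R : realType} {n : nat} {M : topologicalType}.
Variable A : smooth_manifold R n M.

Definition scalar_field (s : sfield A) := forall i j x,
  overlap (chart_of i) (chart_of j) x ->
  s i x = s j (transition (chart_of i) (chart_of j) x).

Definition vector_field (X : vfield A) := forall i j x,
  overlap (chart_of i) (chart_of j) x ->
  let t := transition (chart_of i) (chart_of j) in
  X j (t x) = X i x *m jacobian t x.

Definition covariant_field (T : tfield A) := forall i j x,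
  overlap (chart_of i) (chart_of j) x ->
  let t := transition (chart_of i) (chart_of j) in
  T i x = jacobian t x *m T j (t x) *m (jacobian t x)^T.

Lemma value_at_chart (s : sfield A) i p : scalar_field s ->
  chart_dom (chart_of i) p -> value_at s p = s i (chart_map (chart_of i) p).
Proof.
move=> ss ip; rewrite /value_at; set k := index_at A p.
have kp : chart_dom (chart_of k) p by exact: index_atP.
rewrite (ss k i); last first.
  by split; [exact: chart_map_img|rewrite /= chart_mapK].
by rewrite /transition /= chart_mapK.
Qed.

Lemma value_at_inv (s : sfield A) i x : scalar_field s ->
  chart_img (chart_of i) x -> value_at s (chart_inv (chart_of i) x) = s i x.
Proof.
move=> ss ix; rewrite (value_at_chart ss (chart_inv_dom ix)).
by rewrite chart_invK.
Qed.

Lemma value_at_continuous (s : sfield A) : scalar_field s ->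
  (forall i x, chart_img (chart_of i) x -> {for x, continuous (s i)}) ->
  continuous (value_at s).
Proof.
move=> ss cs p; set i := index_at A p.
have ip : chart_dom (chart_of i) p by exact: index_atP.
have near_p : \forall q \near p, s i (chart_map (chart_of i) q) = value_at s q.
  have : nbhs p (chart_dom (chart_of i)).
    by apply: open_nbhs_nbhs; split => //; exact: chart_dom_open.
  by apply: filterS => q iq; rewrite (value_at_chart ss iq).
have : {for p, continuous (s i \o chart_map (chart_of i))}.
  apply: continuous_comp; first exact: chart_map_continuous_at.
  by apply: cs; exact: chart_map_img.
rewrite /prop_for /continuous_at /= (value_at_chart ss ip) => H.
exact: cvg_trans (near_eq_cvg near_p) H.
Qed.

Lemma eval2_scalar (T : tfield A) (X Y : vfield A) :
  covariant_field T -> vector_field X -> vector_field Y ->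
  scalar_field (eval2 T X Y).
Proof.
move=> cT vX vY i j x Ox; rewrite /eval2 (cT i j x Ox) (vX i j x Ox) (vY i j x Ox).
by rewrite trmx_mul !mulmxA.
Qed.

Definition directional (X : vfield A) (u : sfield A) : sfield A :=
  fun i x => \sum_a X i x 0 a * partial a (u i) x.

(** By the chain rule the partials of [u] change with the Jacobian that multiplies the components of
    X. *)
Lemma directional_scalar (X : vfield A) (u : sfield A) :
  vector_field X -> scalar_field u ->
  (forall i, Ck_on 1 (chart_img (chart_of i)) (u i)) ->
  scalar_field (directional X u).
Proof.
move=> vX su cu i j x Ox; rewrite /directional (vX i j x Ox).
set t := transition _ _.
have oO : open (overlap (chart_of i) (chart_of j)) by exact: overlap_open.
have uE a : partial a (u i) x = \sum_b jacobian t x a b * partial b (u j) (t x).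
  have [_ <-] := overlap_comp_partials (cu j) Ox.
  by apply: (@partial_eq_on _ _ _ a _ _ x oO Ox) => y Oy; exact: su.
under [RHS]eq_bigr do rewrite mxE mulr_suml.
rewrite [RHS]exchange_big/=; apply: eq_bigr => a _.
by rewrite uE mulr_sumr; apply: eq_bigr => b _; rewrite mulrA.
Qed.

Variable g : riemannian_metric A.

Lemma metric_covariant : covariant_field g.
Proof. exact: (metric_smooth g).2. Qed.

(** From g_i = J g_j J^T with g_i invertible; the inverse transition is not differentiated. *)
Lemma jacobian_unit (i j : chart_index A) x : overlap (chart_of i) (chart_of j) x ->
  jacobian (transition (chart_of i) (chart_of j)) x \in unitmx.
Proof.
move=> Ox; have : g i x \in unitmx by apply: metric_unit; case: Ox.
by rewrite (metric_covariant Ox) !unitmx_mul => /andP[/andP[]].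
Qed.

Definition raise (T : tfield A) : tfield A := fun i x => T i x *m invmx (g i x).

(** A mixed tensor changes by conjugation with the Jacobian, which makes traces of its powers
    scalars. *)
Lemma raise_transform (T : tfield A) i j x : covariant_field T ->
  overlap (chart_of i) (chart_of j) x ->
  let t := transition (chart_of i) (chart_of j) in
  raise T i x = jacobian t x *m raise T j (t x) *m invmx (jacobian t x).
Proof.
move=> cT Ox t; rewrite /raise.
have uJ := jacobian_unit Ox.
have uJT : (jacobian t x)^T \in unitmx by rewrite unitmx_tr.
have ugj : g j (t x) \in unitmx by apply: metric_unit; exact: transition_img.
have Vx : chart_img (chart_of i) x by case: Ox.
apply: (can_inj (mulmxK (metric_unit g Vx))).
rewrite mulmxKV ?metric_unit// [in RHS](metric_covariant Ox) (cT i j x Ox) -/t.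
by rewrite !mulmxA mulmxKV// mulmxKV.
Qed.

Lemma raise_trace_scalar (T : tfield A) : covariant_field T ->
  scalar_field (fun i x => \tr (raise T i x)).
Proof.
move=> cT i j x Ox /=; rewrite (raise_transform cT Ox) mxtrace_mulC mulmxA.
by rewrite mulVmx ?mul1mx//; exact: jacobian_unit.
Qed.

Lemma raise_sqr_trace_scalar (T : tfield A) : covariant_field T ->
  scalar_field (fun i x => \tr (raise T i x *m raise T i x)).
Proof.
move=> cT i j x Ox /=; rewrite (raise_transform cT Ox).
have uJ := jacobian_unit Ox.
by rewrite !mulmxA mulmxKV// mxtrace_mulC !mulmxA mulVmx// mul1mx.
Qed.

Lemma raise_vector (T : tfield A) (X : vfield A) :
  covariant_field T -> vector_field X ->
  vector_field (fun i x => X i x *m raise T i x).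
Proof.
move=> cT vX i j x Ox /=; rewrite (vX i j x Ox) (raise_transform cT Ox).
have uJ := jacobian_unit Ox.
by rewrite !mulmxA mulmxKV.
Qed.

Lemma trace_metric_raise (T : tfield A) i x : chart_img (chart_of i) x ->
  trace_metric g T i x = \tr (raise T i x).
Proof.
move=> Vx; rewrite /trace_metric /raise /mxtrace.
apply: eq_bigr => a _; rewrite mxE; apply: eq_bigr => b _.
by rewrite mulrC inv_metricC.
Qed.

End ScalarFields.

(** * Partitions of unity and the divergence theorem *)

Section BumpFunctions.
Context {R : realType}.

(** The device for extension by zero: regularity is checked on two sets that cover [S], one meeting
    the support and one avoiding it. *)
Lemma Ck_on_setU n k (U W S : set 'rV[R]_n) (u : 'rV[R]_n -> R) :
  S `<=` U `|` W -> Ck_on k U u -> Ck_on k W u -> Ck_on k S u.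
Proof.
move=> SUW; elim: k u => [|k IH] u [cU dU] [cW dW]; split => //.
- by move=> x /SUW[]; [exact: cU|exact: cW].
- by move=> x /SUW[]; [exact: cU|exact: cW].
- move=> i; have [a b] := dU i; have [c d] := dW i.
  by split; [move=> x /SUW[]; [exact: a|exact: c]|exact: IH].
Qed.

(** A C^1 cut-off with derivative 2 max(t, 0), vanishing exactly for t <= 0. *)
Definition sqr_pos (t : R) : R := Num.max t 0 ^+ 2.

Let sqr_pos_taylor (t h : R) :
  `|sqr_pos (h + t) - sqr_pos t - h * (Num.max t 0 *+ 2)| <= h ^+ 2.
Proof.
rewrite /sqr_pos !maxEle ler_norml.
by case: ifPn; case: ifPn; rewrite -?ltNge => ? ?; apply/andP; split; nra.
Qed.

Lemma is_derive_sqr_pos (t : R) : is_derive t (1 : R) sqr_pos (Num.max t 0 *+ 2).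
Proof.
have H : (fun h : R => h^-1 *: ((sqr_pos \o shift t) (h *: (1 : R)) - sqr_pos t))
    @ 0^' --> Num.max t 0 *+ 2.
  apply/cvgrPdist_le => e e0; near=> h.
  have h0 : h != 0 by near: h; exact: nbhs_dnbhs_neq.
  have he : `|h| <= e by near: h; exact: dnbhs0_le.
  rewrite /= [h *: 1]mulr1 distrC [_ *: _]mulrC.
  rewrite -[X in _ - X](mulfK h0) -mulrBl normrM normfV ler_pdivrMr ?normr_gt0//.
  rewrite [_ *+ 2 * h]mulrC; apply: (le_trans (sqr_pos_taylor t h)).
  by rewrite -[h ^+ 2]ger0_norm ?sqr_ge0// normrX expr2 ler_wpM2r.
by apply: DeriveDef; [apply/cvg_ex; eexists; exact: H|apply: cvg_lim H].
Unshelve. all: by end_near. Qed.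

Lemma C1_comp_real n (U : set 'rV[R]_n) (f df : R -> R) v : open U ->
  (forall t, is_derive t (1 : R) f (df t)) -> continuous df ->
  Ck_on 1 U v -> Ck_on 1 U (fun y => f (v y)).
Proof.
move=> oU hf cdf cv.
have dv x : U x -> differentiable v x by exact: C1_differentiable.
have dfd t : differentiable f t by apply/derivable1_diffP; case: (hf t).
have pE i x : U x -> partial i (fun y => f (v y)) x = df (v x) * partial i v x.
  move=> Ux; have dvx := dv x Ux.
  rewrite /partial deriveE; last exact: (@differentiable_comp _ _ _ _ v f).
  rewrite (@diff_comp _ _ _ _ v f)//= -(deriveE _ dvx).
  have lin (w : R) : 'd f (v x) w = w * df (v x).
    rewrite -[w in LHS]mulr1 -[w * 1]/(w *: (1 : R)) linearZ/= -deriveE//.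
    by rewrite (@derive_val _ _ _ _ _ _ _ (hf (v x))).
  by rewrite lin mulrC.
apply: Ck_onS => // [x Ux|x Ux i|i].
- apply: (@continuous_comp _ _ _ v f); first exact: Ck_on_continuous cv Ux.
  exact/differentiable_continuous/dfd.
- by apply/diff_derivable/(@differentiable_comp _ _ _ _ v f) => //; exact: dv.
- apply: (@Ck_on_eq _ _ _ _ (fun y => df (v y) * partial i v y)) => //.
    by move=> y Uy; rewrite pE.
  apply: Ck_onM => //; last exact: Ck_on_partial.
  split => // x Ux; apply: (@continuous_comp _ _ _ v df); last exact: cdf.
  exact: Ck_on_continuous cv Ux.
Qed.

(** Positive exactly on the open box of radius r around [x0] when r > 0; the box is a ball of the
    maximum norm. *)
Definition box_bump n (x0 : 'rV[R]_n) (r : R) (x : 'rV[R]_n) : R :=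
  \prod_a sqr_pos (r ^+ 2 - (x 0 a - x0 0 a) ^+ 2).

Lemma box_bump_C1 n (x0 : 'rV[R]_n) r : Ck_on 1 setT (box_bump x0 r).
Proof.
have oT : open [set: 'rV[R]_n] by exact: openT.
apply: Ck_on_prod => // a _; apply: (C1_comp_real _ is_derive_sqr_pos) => //.
  rewrite (_ : (fun t => _) = fun t : R => t + `|t|).
    move=> t; apply: continuousD; first exact: cvg_id.
    exact: norm_continuous.
  apply/funext => t; rewrite maxEle mulr2n; case: (leP t 0) => t0.
    by rewrite ler0_norm// subrr addr0.
  by rewrite ger0_norm// ltW// ltNge.
apply: Ck_onB => //; first exact: Ck_on_cst.
have c1 : Ck_on 1 setT (fun y : 'rV[R]_n => y 0 a - x0 0 a).
  by apply: Ck_onB => //; [exact: Ck_on_coord|exact: Ck_on_cst].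
apply: (@Ck_on_eq _ _ _ _ (fun y => (y 0 a - x0 0 a) * (y 0 a - x0 0 a))) => //.
exact: Ck_onM.
Qed.

Lemma box_bump_ge0 n (x0 : 'rV[R]_n) r x : 0 <= box_bump x0 r x.
Proof. by apply: prodr_ge0 => a _; exact: sqr_ge0. Qed.

Lemma box_bump_gt0 n (x0 : 'rV[R]_n) r : 0 < r -> 0 < box_bump x0 r x0.
Proof.
move=> r0; apply: prodr_gt0 => a _; rewrite subrr expr0n subr0 /sqr_pos.
by rewrite max_l ?exprn_gt0// ltW// exprn_gt0.
Qed.

Lemma box_bump_support n (x0 : 'rV[R]_n) r x : 0 < r -> box_bump x0 r x != 0 ->
  `|x - x0| <= r.
Proof.
move=> r0 /prodf_neq0 H; apply: mx_norm_le; first exact: ltW.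
move=> i a; rewrite ord1 !mxE; have := H a isT.
rewrite /sqr_pos; apply: contraNT; rewrite -ltNge => xa.
rewrite max_r ?expr0n// subr_le0 -[leRHS]ger0_norm ?sqr_ge0// normrX.
by rewrite ler_sqr ?nnegrE ?normr_ge0 ?(ltW r0) ?(ltW xa).
Qed.

End BumpFunctions.

(** * Integrals of functions supported in one chart *)

Section ChartIntegral.
Context {R : realType} {n : nat} {M : ptopologicalType}.
Context {A : smooth_manifold R n M} (g : riemannian_metric A).
Variable vol : {measure set (borel M) -> \bar R}.
Hypothesis volP : is_riemannian_measure g vol.

Definition volume_density (i : chart_index A) x := Num.sqrt (\det (g i x)).

Lemma volume_density_smooth i : Ck_on 1 (chart_img (chart_of i)) (volume_density i).
Proof.
have oV : open (chart_img (chart_of i)) by exact: chart_img_open.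
apply: Ck_on_sqrt => //; first exact: metric_det_gt0.
by apply: Ck_on_det => // a b; exact: metric_entry_smooth.
Qed.

(** The integrand in coordinates, density included, extended by zero because [chart_inv] is
    meaningless off the image of the chart. *)
Definition pull (i : chart_index A) (F : M -> R) : 'rV[R]_n -> R :=
  (fun x => F (chart_inv (chart_of i) x) * volume_density i x) \_ (chart_img (chart_of i)).

Section OneChart.
Variable i : chart_index A.
Let V := chart_img (chart_of i).
Let D := chart_dom (chart_of i).
Let inv := chart_inv (chart_of i).
Let oV : open V := @chart_img_open _ _ _ (chart_of i).

Let measV : measurable (V : set (borel 'rV[R]_n)). Proof. exact: open_borel. Qed.

Let measD : measurable (D : set (borel M)).
Proof. by apply: open_borel; exact: chart_dom_open. Qed.

Let minv : measurable_fun (V : set (borel 'rV[R]_n)) (inv : borel 'rV[R]_n -> borel M).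
Proof. apply: continuous_on_borel; [exact: oV|move=> x Vx; exact: chart_inv_continuous_at]. Qed.

Let mw : measurable_fun (V : set (borel 'rV[R]_n)) (volume_density i : borel 'rV[R]_n -> R).
Proof.
apply: continuous_on_measurable => // x Vx.
exact: Ck_on_continuous (volume_density_smooth i) Vx.
Qed.

Let w0 x : 0 <= volume_density i x. Proof. exact: sqrtr_ge0. Qed.

(** On the image of the chart the condition of lying in [D] is automatic, so the defining formula of
    the measure becomes the hypothesis of the transfer lemmas. *)
Lemma chart_volume (B : set (borel M)) : measurable B ->
  vol (B `&` D) =
  (\int[lebesgue_rV n]_(x in V) (\1_B (inv x) * volume_density i x)%:E)%E.
Proof.
move=> mB; have mBD : measurable (B `&` D) by exact: measurableI.
have -> := volP mBD (@subIsetr _ B D).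
pose f (x : borel 'rV[R]_n) := (\1_B (inv x) * volume_density i x)%:E.
have E : (fun x => (\1_(V `&` inv @^-1` (B `&` D)) x * volume_density i x)%:E) = f \_ V.
  apply/funext => x; rewrite patchE /f; case: ifPn => [|/negP].
    rewrite inE => Vx; congr ((_ * _)%:E); rewrite !indicE; congr (_%:R); congr nat_of_bool.
    apply/idP/idP; rewrite !inE /=; first by move=> [_ []].
    by move=> Bx; split=> //; split=> //; exact: chart_inv_dom.
  rewrite inE => nVx; rewrite indicE memNset ?mul0r//.
  by move=> [].
have mf : measurable_fun (V : set (borel 'rV[R]_n)) f.
  apply/measurable_EFinP/measurable_funM; last exact: mw.
  apply: (measurable_comp measurableT _ _ minv) => //.
rewrite [LHS](_ : _ = lebesgue_int (f \_ V)); last by rewrite -E.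
rewrite lebesgue_intE.
- by rewrite [RHS]integral_mkcond.
- by have [H _] := measurable_restrictT f measV; exact: H mf.
- move=> x; rewrite patchE; case: ifP => // _.
  by rewrite /f lee_fin mulr_ge0.
Qed.

Section Localized.
Variables (K : set M) (F : M -> R).
Hypotheses (cK : compact K) (KD : K `<=` D).
Hypotheses (cF : continuous F) (F0 : forall p, ~ K p -> F p = 0).

Let C := chart_map (chart_of i) @` K.

Lemma chart_image_compact : compact C.
Proof.
apply: continuous_compact => //; apply: continuous_subspaceW KD _.
exact: chart_map_continuous.
Qed.

(** The image of the chart and the complement of the compact support cover R^n, so a function
    extended by zero can be studied on each. *)
Lemma chart_image_open_cover : open (~` C) /\ [set: 'rV[R]_n] `<=` V `|` ~` C.
Proof.
split.
  apply: closed_openC; apply: compact_closed (@norm_hausdorff _ _) _.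
  exact: chart_image_compact.
move=> x _; have [Vx|nVx] := pselect (V x); [by left|right].
by move=> [p Kp px]; apply: nVx; rewrite -px; exact/chart_map_img/KD.
Qed.

Lemma pull_off x : ~ C x -> pull i F x = 0.
Proof.
move=> nCx; rewrite /pull patchE; case: ifPn => //; rewrite inE => Vx.
rewrite F0 ?mul0r// => Kx; apply: nCx; exists (chart_inv (chart_of i) x) => //.
by rewrite chart_invK.
Qed.

Lemma pull_on x : V x -> pull i F x = F (inv x) * volume_density i x.
Proof. by move=> Vx; rewrite /pull patchE mem_set. Qed.

Lemma pull_continuous : continuous (pull i F).
Proof.
have [oC cov] := chart_image_open_cover.
move=> x; have [Vx|nCx] := cov x I.
  apply: (@continuous_eq_on _ _ V (fun y => F (inv y) * volume_density i y) _ x oV Vx).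
    by move=> y Vy; rewrite pull_on.
  apply: continuousM.
    apply: (@continuous_comp _ _ _ inv F); first exact: chart_inv_continuous_at.
    exact: cF.
  exact: Ck_on_continuous (volume_density_smooth i) Vx.
apply: (@continuous_eq_on _ _ (~` C) (fun=> 0) _ x oC nCx).
  by move=> y nCy; rewrite pull_off.
exact: cst_continuous.
Qed.

Lemma pull_bounded_support : exists k, forall x, ~ cube n k x -> pull i F x = 0.
Proof.
have [N [Nr HN]] := compact_bounded chart_image_compact.
(* The bound holds only for numbers strictly above [N]; hence |N| + 1, rounded up to an integer. *)
exists (Num.truncn (`|N| + 1)).+1 => x nx; apply: pull_off => Cx; apply: nx.
have := HN (`|N| + 1); rewrite (le_lt_trans (ler_norm _)) ?ltrDl// => /(_ isT x Cx) /=.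
by move=> /le_trans; apply; rewrite ltW// truncnS_gt.
Qed.

Lemma chart_integral :
  (\int[vol]_p (F p)%:E = \int[lebesgue_rV n]_x (pull i F x)%:E)%E.
Proof.
have mF : measurable_fun setT (F : borel M -> R).
  by apply: continuous_on_measurable; [exact: openT|move=> x _; exact: cF].
have -> : (fun p => (F p)%:E) = (EFin \o F) \_ D.
  apply/funext => p; rewrite patchE; case: ifPn => // /negP; rewrite inE => nDp.
  by rewrite F0// => /KD.
rewrite -integral_mkcond.
rewrite (integral_weighted measV measD minv mw w0 chart_volume mF).
rewrite integral_mkcond; apply: eq_integral => x _.
by rewrite /pull !patchE; case: ifP.
Qed.

End Localized.

(** The chart formula is applied to |F|, whose pullback is continuous and vanishes off a cube. *)
Lemma chart_integrable (K : set M) (F : M -> R) :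
  compact K -> K `<=` D -> continuous F -> (forall p, ~ K p -> F p = 0) ->
  vol.-integrable setT (fun p => (F p)%:E).
Proof.
move=> cK KD cF F0.
have mF : measurable_fun setT (F : borel M -> R).
  by apply: continuous_on_measurable; [exact: openT|move=> x _; exact: cF].
apply/integrableP; split; first exact/measurable_EFinP.
pose aF p := `|F p|.
have caF : continuous aF.
  move=> p; apply: (@continuous_comp _ _ _ F (fun t : R => `|t|)); first exact: cF.
  exact: norm_continuous.
have aF0 p : ~ K p -> aF p = 0 by move=> nKp; rewrite /aF F0// normr0.
under eq_integral do rewrite abse_EFin.
rewrite (chart_integral KD caF aF0).
have [k Hk] := pull_bounded_support cK KD aF0.
apply: integrable_lty => //.
exact: continuous_cube_integrable (pull_continuous cK KD caF aF0) Hk.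
Qed.

End OneChart.

End ChartIntegral.

Section PartitionOfUnity.
Context {R : realType} {n : nat} {M : ptopologicalType}.
Variable A : smooth_manifold R n M.

Definition C1_function (phi : M -> R) :=
  forall i : chart_index A, Ck_on 1 (chart_img (chart_of i)) (local_expr A phi i).

Lemma local_expr_scalar (phi : M -> R) : scalar_field (local_expr A phi).
Proof.
move=> i j x [Vx jx]; rewrite /local_expr /transition /=.
by rewrite chart_mapK.
Qed.

Lemma value_at_local_expr (phi : M -> R) p : value_at (local_expr A phi) p = phi p.
Proof. by rewrite /value_at /local_expr /= chart_mapK//; exact: index_atP. Qed.

Lemma C1_function_continuous phi : C1_function phi -> continuous phi.
Proof.
move=> cphi; rewrite (_ : phi = value_at (local_expr A phi)); last first.
  by apply/funext => p; rewrite value_at_local_expr.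
apply: value_at_continuous; first exact: local_expr_scalar.
by move=> i x Vx; exact: Ck_on_continuous (cphi i) Vx.
Qed.

(** A box bump in coordinates, extended by zero. It is C^1 in every chart because the Hausdorff
    property makes the compact set [K] closed. *)
Lemma chart_bump p : exists (psi : M -> R) (K : set M) (i : chart_index A),
  [/\ C1_function psi, compact K, K `<=` chart_dom (chart_of i) &
      [/\ forall q, ~ K q -> psi q = 0, forall q, 0 <= psi q & 0 < psi p]].
Proof.
pose i := index_at A p; pose c := chart_of i.
have ip : chart_dom c p by exact: index_atP.
pose x0 := chart_map c p.
have [d d0 dV] := nbhs_open_ball (chart_img_open (c := c)) (chart_map_img ip).
have r0 : 0 < d / 2 by rewrite divr_gt0.
pose C : set 'rV[R]_n := [set x | `|x - x0| <= d / 2].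
have CV : C `<=` chart_img c.
  move=> x Cx; apply: dV; apply: le_lt_trans Cx _.
  by rewrite ltr_pdivrMr// ltr_pMr// ltr1n.
have compC : compact C.
  apply: bounded_closed_compact.
    exists (`|x0| + d / 2); split; first exact: num_real.
    move=> N HN x Cx /=.
    rewrite -(subrK x0 x) (le_trans (ler_normD _ _))//.
    by rewrite addrC (le_trans _ (ltW HN))// lerD2l.
  have cn : continuous (fun y : 'rV[R]_n => `|y - x0|).
    move=> y; apply: (@continuous_comp _ _ _ (fun y : 'rV[R]_n => y - x0)
      (fun v : 'rV[R]_n => `|v|)); last exact: norm_continuous.
    by apply: continuousB; [exact: cvg_id|exact: cst_continuous].
  have -> : C = (fun x => `|x - x0|) @^-1` [set t | t <= d / 2] by [].
  by apply: preimage_closed => [x _|]; [exact: cn|exact: closed_le].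
pose K := chart_inv c @` C.
have compK : compact K.
  apply: continuous_compact compC.
  exact: continuous_subspaceW CV (chart_inv_continuous (c := c)).
have KD : K `<=` chart_dom c by move=> _ [x Cx <-]; exact/chart_inv_dom/CV.
pose psi q := if `[< chart_dom c q >] then box_bump x0 (d / 2) (chart_map c q) else 0.
have psi0 q : ~ K q -> psi q = 0.
  move=> nKq; rewrite /psi; case: asboolP => // cq.
  apply/eqP; apply: contra_notT nKq => /(box_bump_support r0) Cq.
  by exists (chart_map c q) => //; rewrite chart_mapK.
exists psi, K, i; split => //; last first.
  split => //.
    by move=> q; rewrite /psi; case: ifP => // _; exact: box_bump_ge0.
  by rewrite /psi; case: asboolP => // _; exact: box_bump_gt0.
move=> k.
have oK : open (~` K).
  by apply: closed_openC; apply: compact_closed => //; exact: manifold_hausdorff A.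
pose O := overlap (chart_of k) c.
pose W := chart_img (chart_of k) `&` chart_inv (chart_of k) @^-1` (~` K).
have oO : open O by exact: overlap_open.
have oW : open W.
  apply: preimage_open_on => //; first exact: chart_img_open.
  by move=> x; exact: chart_inv_continuous_at.
(* Near points sent into [K] the function is the bump composed with a transition map; on the open
   preimage of the complement of [K] it is zero. *)
apply: (@Ck_on_setU _ _ _ O W).
- move=> x Vx; have [xK|nxK] := pselect (K (chart_inv (chart_of k) x)).
    by left; split => //; exact: KD.
  by right.
- apply: (@Ck_on_eq _ _ _ _ (box_bump x0 (d / 2) \o transition (chart_of k) c)) => //.
    by move=> y [Vy /= cy]; rewrite /local_expr /psi /= asboolT.
  apply: (@C1_comp _ _ _ O setT) => //; first exact: openT.
    by move=> b; exact: transition_smooth k i b 1.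
  exact: box_bump_C1.
- apply: (@Ck_on_eq _ _ _ _ (fun=> 0)) => //; last exact: Ck_on_cst.
  by move=> y [Vy /= ?]; rewrite /local_expr /= psi0.
Qed.

(** Finitely many of the sets where a bump is positive cover M; the bumps are divided by their sum
    over the subcover, which is positive everywhere. *)
Theorem C1_partition_of_unity : compact [set: M] ->
  exists (I : Type) (s : seq I) (phi : I -> M -> R) (K : I -> set M)
      (k : I -> chart_index A),
    (forall a, [/\ C1_function (phi a), compact (K a),
       K a `<=` chart_dom (chart_of (k a)) & forall q, ~ K a q -> phi a q = 0]) /\
    forall q, \sum_(a <- s) phi a q = 1.
Proof.
move=> cM.
have [psi Hpsi] := choice chart_bump.
have [K HK] := choice Hpsi.
have [k Hk] := choice HK.
have cpsi p : C1_function (psi p) by case: (Hk p).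
have psi_ge0 p q : 0 <= psi p q by case: (Hk p) => _ _ _ [].
have /(_ M setT (fun p => [set q | 0 < psi p q])) : cover_compact [set: M].
  by rewrite -compact_cover.
case.
- move=> p _; rewrite (_ : [set q | _] = psi p @^-1` [set t | 0 < t])//.
  by apply: open_comp => [q _|]; [exact: C1_function_continuous|exact: open_gt].
- by move=> p _; exists p => //=; case: (Hk p) => _ _ _ [].
move=> D _ cover.
pose s := finmap.enum_fset D.
pose S q := \sum_(a <- s) psi a q.
have S0 q : 0 < S q.
  have [p pD /= pq] := cover q I.
  have ps : p \in s by exact: pD.
  rewrite /S (big_rem p ps)/=.
  rewrite ltr_pwDl//; apply: sumr_ge0 => a _; exact: psi_ge0.
exists M, s, (fun p q => psi p q / S q), K, k; split=> [p|q]; last first.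
  by rewrite -mulr_suml -/(S q) divff// lt0r_neq0.
have [cp cK KD [psi0 _ _]] := Hk p.
split => // [i|q /psi0 ->]; last by rewrite mul0r.
have oV : open (chart_img (chart_of i)) by exact: chart_img_open.
apply: (@Ck_on_eq _ _ _ _ (fun y => local_expr A (psi p) i y *
   (\sum_(a <- s) local_expr A (psi a) i y)^-1)) => //.
apply: Ck_onM => //; apply: Ck_onV => //.
  by move=> y _; rewrite lt0r_neq0//; exact: S0.
by apply: Ck_on_sum => // a _; exact: cpsi.
Qed.

End PartitionOfUnity.

(** * The divergence theorem on a compact manifold *)

Section Divergence.
Context {R : realType} {n : nat} {M : ptopologicalType}.
Context {A : smooth_manifold R n M} (g : riemannian_metric A).
Variable vol : {measure set (borel M) -> \bar R}.
Hypothesis volP : is_riemannian_measure g vol.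
Variables (Z : vfield A) (h : sfield A).
Hypotheses (vZ : vector_field Z) (sh : scalar_field h).
Hypothesis cZ : forall i a, Ck_on 1 (chart_img (chart_of i)) (fun y => Z i y 0 a).
Hypothesis ch : forall i x, chart_img (chart_of i) x -> {for x, continuous (h i)}.
Hypothesis divZ : forall i x, chart_img (chart_of i) x ->
  \sum_b partial b (fun y => volume_density g i y * Z i y 0 b) x =
  volume_density g i x * h i x.

(** With h = div Z, this is div(phi Z). *)
Let q (phi : M -> R) (p : M) : R :=
  phi p * value_at h p + value_at (directional Z (local_expr A phi)) p.

Let directional_C1_scalar phi : C1_function A phi ->
  scalar_field (directional Z (local_expr A phi)).
Proof.
by move=> cphi; apply: directional_scalar => //; exact: local_expr_scalar.
Qed.

Let q_continuous phi : C1_function A phi -> continuous (q phi).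
Proof.
move=> cphi p.
rewrite (_ : q phi = (phi \* value_at h) \+
  value_at (directional Z (local_expr A phi)))//.
apply: continuousD.
  apply: continuousM; first exact: C1_function_continuous cphi _.
  exact: value_at_continuous sh ch _.
apply: value_at_continuous; first exact: directional_C1_scalar.
move=> i x Vx; apply: continuous_at_sum => a _; apply: continuousM.
  exact: Ck_on_continuous (cZ i a) Vx.
exact: C1_partial_continuous (cphi i) Vx.
Qed.

Section OneChart.
Variables (i : chart_index A) (K : set M) (phi : M -> R).
Hypotheses (cphi : C1_function A phi) (cK : compact K).
Hypotheses (KD : K `<=` chart_dom (chart_of i)) (phi0 : forall p, ~ K p -> phi p = 0).
Let V := chart_img (chart_of i).
Let inv := chart_inv (chart_of i).
Let oV : open V := @chart_img_open _ _ _ (chart_of i).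

Let q0 p : ~ K p -> q phi p = 0.
Proof.
move=> nKp; rewrite /q phi0// mul0r add0r /value_at.
set k := index_at A p; set x := chart_map _ p.
have kp : chart_dom (chart_of k) p by exact: index_atP.
have oK : open (~` K).
  by apply: closed_openC; apply: compact_closed => //; exact: manifold_hausdorff A.
pose W := chart_img (chart_of k) `&` chart_inv (chart_of k) @^-1` (~` K).
have oW : open W.
  apply: preimage_open_on => //; first exact: chart_img_open.
  by move=> y; exact: chart_inv_continuous_at.
have Wx : W x by split; [exact: chart_map_img|rewrite /x /= chart_mapK].
rewrite /directional big1// => a _.
rewrite (@partial_eq_on _ _ W a _ (fun=> 0) x oW Wx) ?partial_cst ?mulr0//.
by move=> y [_ /= nKy]; rewrite /local_expr /= phi0.
Qed.

Let W b : 'rV[R]_n -> R :=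
  (fun y => volume_density g i y * Z i y 0 b * phi (inv y)) \_ V.

Let W_on b y : V y -> W b y = volume_density g i y * Z i y 0 b * phi (inv y).
Proof. by move=> Vy; rewrite /W patchE mem_set. Qed.

Let C := chart_map (chart_of i) @` K.

Let W_off b y : ~ C y -> W b y = 0.
Proof.
move=> nCx; rewrite /W patchE; case: ifPn => //; rewrite inE => Vx.
rewrite phi0 ?mulr0// => Kx; apply: nCx; exists (inv y) => //.
by rewrite /inv chart_invK.
Qed.

Let W_C1 b : Ck_on 1 setT (W b).
Proof.
have [oC cov] := chart_image_open_cover cK KD.
apply: (Ck_on_setU cov).
  apply: (@Ck_on_eq _ _ _ _ (fun y => volume_density g i y * Z i y 0 b * local_expr A phi i y)) => //.
    by move=> y Vy; rewrite W_on.
  apply: Ck_onM => //; apply: Ck_onM => //; exact: volume_density_smooth.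
apply: (@Ck_on_eq _ _ _ _ (fun=> 0)) => //; last exact: Ck_on_cst.
by move=> y nCy; rewrite W_off.
Qed.

(** The product rule for w Z^b phi, with [divZ] for the factor w Z^b; off the support both sides
    vanish. *)
Let pull_q x : pull g i (q phi) x = \sum_b partial b (W b) x.
Proof.
have [oC cov] := chart_image_open_cover cK KD.
have [Vx|nCx] := cov x I; last first.
  rewrite (pull_off g q0 nCx).
  rewrite big1// => b _.
  rewrite (@partial_eq_on _ _ _ b _ (fun=> 0) x oC nCx) ?partial_cst//.
  by move=> y nCy; rewrite W_off.
rewrite pull_on// /q (value_at_inv sh Vx).
rewrite (value_at_inv (directional_C1_scalar cphi) Vx).
have hw : has_partials (volume_density g i) x.
  exact: Ck_on_has_partials (volume_density_smooth g i) Vx.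
have hZ b : has_partials (fun y => Z i y 0 b) x by exact: Ck_on_has_partials (cZ i b) Vx.
have hphi : has_partials (local_expr A phi i) x by exact: Ck_on_has_partials (cphi i) Vx.
transitivity (\sum_b (partial b (fun y => volume_density g i y * Z i y 0 b) x * local_expr A phi i x
   + volume_density g i x * Z i x 0 b * partial b (local_expr A phi i) x)).
  rewrite big_split/= -mulr_suml divZ// mulrDl; congr (_ + _).
    by rewrite /local_expr /=; ring.
  by rewrite /directional mulr_suml; apply: eq_bigr => b _; ring.
apply: eq_bigr => b _.
rewrite (@partial_eq_on _ _ V b (W b) (fun y => volume_density g i y * Z i y 0 b * local_expr A phi i y) x oV Vx).
  by rewrite [RHS]partialM//; exact: (has_partialsM hw (hZ b)).
by move=> y Vy; rewrite W_on.
Qed.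

Lemma localized_divergence :
  vol.-integrable setT (fun p => (q phi p)%:E) /\
  (\int[vol]_p (q phi p)%:E = 0)%E.
Proof.
split; first exact: (chart_integrable volP cK KD (q_continuous cphi) q0).
rewrite (chart_integral volP KD (q_continuous cphi) q0).
under eq_integral do rewrite pull_q -sumEFin.
have [N [Nr HN]] := compact_bounded (chart_image_compact cK KD).
have [k Wk] : exists k, forall b x, ~ cube n k x -> W b x = 0.
  exists (Num.truncn (`|N| + 1)).+1 => b x nx; apply: W_off => Cx; apply: nx.
  have := HN (`|N| + 1); rewrite (le_lt_trans (ler_norm _)) ?ltrDl// => /(_ isT x Cx) /=.
  by move=> /le_trans; apply; rewrite ltW// truncnS_gt.
have pW b : (lebesgue_rV n).-integrable setT (fun x => (partial b (W b) x)%:E).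
  exact: partial_integrable (W_C1 b) (Wk b).
rewrite integral_sum//= big1// => b _.
exact: integral_partial_eq0 (W_C1 b) (Wk b).
Qed.

End OneChart.

(** Summing div(phi_a Z) over the partition gives h, as the derivatives of the phi_a add up to that
    of the constant 1; each summand integrates to 0 in its chart. *)
Theorem divergence_theorem : compact [set: M] ->
  vol.-integrable setT (fun p => (value_at h p)%:E) /\
  (\int[vol]_p (value_at h p)%:E = 0)%E.
Proof.
move=> cM; have [I [s [phi [K [k [phiP phi1]]]]]] := C1_partition_of_unity A cM.
have qP a := let: And4 c1 c2 c3 c4 := phiP a in localized_divergence c1 c2 c3 c4.
have hE p : value_at h p = \sum_(a <- s) q (phi a) p.
  rewrite /q big_split/= -mulr_suml phi1 mul1r -[LHS]addr0; congr (_ + _).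
  rewrite /value_at; set j := index_at A p; set x := chart_map _ p.
  have Vx : chart_img (chart_of j) x by exact/chart_map_img/index_atP.
  rewrite /directional exchange_big/= big1// => c _; rewrite -mulr_sumr.
  have hphi a : has_partials (local_expr A (phi a) j) x.
    by have [cp _ _ _] := phiP a; exact: Ck_on_has_partials (cp j) Vx.
  rewrite -partial_sum; last by move=> a _; exact: hphi.
  rewrite (_ : (fun y => _) = fun=> 1) ?partial_cst ?mulr0//.
  by apply/funext => y; exact: phi1.
have -> : (fun p => (value_at h p)%:E) = (fun p => \sum_(a <- s) (q (phi a) p)%:E)%E.
  by apply/funext => p; rewrite hE sumEFin.
split.
  by apply: integrable_sum => // a _; exact: (qP a).1.
rewrite integral_sum//=; last by move=> a; exact: (qP a).1.
by rewrite big1// => a _; exact: (qP a).2.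
Qed.

End Divergence.

(** * Nonnegative continuous functions with zero integral *)

Section ContinuousNonnegative.
Context {R : realType}.

Let leb1 : {sigma_finite_measure set (measurableTypeR R) -> \bar R} :=
  @lebesgue_measure R.

Let norm_first_rest n (t s : R) (y z : 'rV[R]_n) :
  `|first_rest (t, y) - first_rest (s, z)| <= Num.max `|t - s| `|y - z|.
Proof.
apply: mx_norm_le => [|i j]; first by rewrite le_max normr_ge0.
rewrite !ord1 le_max /first_rest /=.
have [l ->|l ->] := @split_ordP 1 n j.
  by rewrite mxE [X in _ + X]mxE !(@row_mxEl _ 1 1 n) !mxE lexx.
rewrite mxE [X in _ + X]mxE !(@row_mxEr _ 1 1 n); apply/orP; right.
by have := mx_coord_le_norm (y - z) 0 l; rewrite mxE [X in _ + X]mxE.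
Qed.

Lemma first_rest_continuous_first n (y : 'rV[R]_n) :
  continuous (fun t : R => first_rest (t, y) : 'rV[R]_n.+1).
Proof.
move=> t; apply/cvgrPdist_lt => e e0.
have /cvgrPdist_lt/(_ e e0) : (fun s : R => s) @ t --> t by exact: cvg_id.
apply: filterS => s ts; apply: le_lt_trans (norm_first_rest _ _ _ _) _.
by rewrite subrr normr0 gt_max e0 andbT.
Qed.

Lemma first_rest_continuous_rest n (t : R) :
  continuous (fun y : 'rV[R]_n => first_rest (t, y) : 'rV[R]_n.+1).
Proof.
move=> y; have Fy : Filter (nbhs y) by exact: nbhs_filter.
apply/(@cvgrPdist_lt _ _ _ (nbhs y)) => e e0.
have H : (fun z => z) @ nbhs y --> y by exact: cvg_id.
move: H => /cvgrPdist_lt/(_ e e0).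
apply: (@filterS _ (nbhs y)) => z yz; apply: le_lt_trans (norm_first_rest _ _ _ _) _.
by rewrite subrr normr0 gt_max e0.
Qed.

(** If v(t) != 0, a whole ball around t lies in the null set, whereas balls have positive
    measure. *)
Lemma ae_continuous_eq0 (v : R -> R) : continuous v ->
  {ae leb1, forall t, v t = 0} -> forall t, v t = 0.
Proof.
move=> cv [N [mN N0 subN]] t; apply/eqP; apply/negPn/negP => vt0.
have oN : open [set s | v s != 0].
  rewrite (_ : [set s | _] = v @^-1` ([set r | r != 0])); last by [].
  by apply: open_comp => [s _|]; [exact: cv|exact: open_neq].
have [d /= d0 dN] : nbhs_ball t [set s | v s != 0].
  by apply/nbhs_ballP; exact: open_nbhs_nbhs.
have : (lebesgue_measure (ball t d) <= leb1 N)%E.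
  apply: le_measure; rewrite ?inE//; first exact: measurable_ball.
  by move=> s /dN /eqP vs0; apply: subN.
have d20 : (0 < (d *+ 2)%:E)%E by rewrite lte_fin pmulrn_lgt0.
rewrite [X in (_ <= X)%E]N0 [X in (X <= _)%E]lebesgue_measure_ball; last exact: ltW.
by move=> d2; have := lt_le_trans d20 d2; rewrite ltxx.
Qed.

(** Tonelli and induction: for almost every t the slice integrates to 0, hence vanishes. For each
    fixed y the function of t is then zero almost everywhere, and continuity removes the exceptional
    t. *)
Lemma integral_eq0_continuous n (u : 'rV[R]_n -> R) : continuous u ->
  (forall x, 0 <= u x) -> (\int[lebesgue_rV n]_x (u x)%:E = 0)%E ->
  forall x, u x = 0.
Proof.
elim: n u => [|n IH] u cu u0.
all: have mu : measurable_fun setT (fun x : borel 'rV[R]__ => (u x)%:E) by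
  apply/measurable_EFinP; apply: continuous_on_measurable;
    [exact: openT|move=> x _; exact: cu].
- rewrite -lebesgue_intE//= => -[u00] x.
  by rewrite (_ : x = 0)//; apply/rowP => -[].
- rewrite lebesgue_rVS//.
  pose G z := (u (first_rest z))%:E.
  have mG : measurable_fun setT G := measurableT_comp mu (@measurable_first_rest R n).
  have G0 z : (0 <= G z)%E by rewrite lee_fin.
  rewrite (@fubini_tonelli1 _ _ _ _ _ leb1 (lebesgue_rV n) G)//.
  have F0 t : (0 <= fubini_F (lebesgue_rV n) G t)%E by apply: integral_ge0.
  under eq_integral => t _ do rewrite -(gee0_abs (F0 t)).
  have mF := measurable_fun_fubini_tonelli_F (m2 := lebesgue_rV n) G mG G0.
  move=> /(ae_eq_integral_abs leb1 measurableT mF) H x.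
  have xE : x = first_rest (x 0 0, rsubmx (x : 'rV[R]_(1 + n))).
    rewrite /first_rest /= -[LHS](@hsubmxK _ 1 1 n); congr (@row_mx _ 1 1 n _ _).
    by apply/rowP => j; rewrite !mxE ord1; congr (x 0 _); apply: val_inj.
  rewrite xE; move: (x 0 0) (rsubmx _) => t y {x xE}; move: t.
  apply: ae_continuous_eq0.
    move=> t; apply: (@continuous_comp _ _ _ (fun t => first_rest (t, y)) u).
      exact: first_rest_continuous_first.
    exact: cu.
  apply: filterS H => t /(_ I) Gt.
  apply: (IH (fun y => u (first_rest (t, y)))) => //.
  move=> z; apply: (@continuous_comp _ _ _ (fun y => first_rest (t, y)) u).
    exact: first_rest_continuous_rest.
  exact: cu.
Qed.

End ContinuousNonnegative.

Section CompactIntegration.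
Context {R : realType} {n : nat} {M : ptopologicalType}.
Context {A : smooth_manifold R n M} (g : riemannian_metric A).
Variable vol : {measure set (borel M) -> \bar R}.
Hypotheses (volP : is_riemannian_measure g vol) (cM : compact [set: M]).

Lemma continuous_integrable (F : M -> R) : continuous F ->
  vol.-integrable setT (fun p => (F p)%:E).
Proof.
move=> cF; have [I [s [phi [K [k [phiP phi1]]]]]] := C1_partition_of_unity A cM.
have -> : (fun p => (F p)%:E) = (fun p => \sum_(a <- s) (phi a p * F p)%:E)%E.
  by apply/funext => p; rewrite sumEFin -mulr_suml phi1 mul1r.
apply: integrable_sum => // a _; have [cphi cK KD phi0] := phiP a.
apply: (chart_integrable volP cK KD) => [p|p nKp]; last by rewrite phi0// mul0r.
apply: continuousM; [exact: C1_function_continuous cphi _|exact: cF].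
Qed.

(** Localised at p by a bump: psi F has zero integral too, so its coordinate expression, density
    included, is identically zero; at p both the bump and the density are positive. *)
Lemma continuous_integral_eq0 (F : M -> R) : continuous F ->
  (forall p, 0 <= F p) -> (\int[vol]_p (F p)%:E = 0)%E -> forall p, F p = 0.
Proof.
move=> cF F0 iF p.
have [psi [K [i [cpsi cK KD [psi0 psi_ge0 psi_gt0]]]]] := chart_bump A p.
have mcont (G : M -> R) : continuous G ->
    measurable_fun setT (fun q : borel M => (G q)%:E).
  move=> cG; apply/measurable_EFinP.
  by apply: continuous_on_measurable; [exact: openT|move=> q _; exact: cG].
pose G q := psi q * F q.
have cG : continuous G.
  by move=> q; apply: continuousM; [exact: C1_function_continuous cpsi _|exact: cF].
have G0 q : ~ K q -> G q = 0 by move=> nKq; rewrite /G psi0 ?mul0r.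
have iG : (\int[vol]_q (G q)%:E = 0)%E.
  (* The zero integral passes to psi F through almost everywhere vanishing, so no bound on psi
     enters. *)
  have : (\int[vol]_q `|(F q)%:E| = 0)%E.
    by rewrite -[RHS]iF; apply: eq_integral => q _; rewrite gee0_abs ?lee_fin.
  move=> /(ae_eq_integral_abs vol measurableT (mcont F cF)) Fae.
  transitivity (\int[vol]_q `|(G q)%:E|)%E.
    by apply: eq_integral => q _; rewrite gee0_abs// lee_fin mulr_ge0.
  apply/(ae_eq_integral_abs vol measurableT (mcont G cG)).
  by apply: filterS Fae => q /(_ I) /= [Fq] _; rewrite /G Fq mulr0.
have pull0 : forall x, pull g i G x = 0.
  apply: integral_eq0_continuous.
  - exact: pull_continuous cK KD cG G0.
  - move=> x; rewrite /pull patchE; case: ifP => // _.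
    by rewrite !mulr_ge0// sqrtr_ge0.
  - by rewrite -(chart_integral volP KD cG G0).
have ip : chart_dom (chart_of i) p.
  by apply: KD; apply: contrapT => /psi0 p0; rewrite p0 ltxx in psi_gt0.
have Vx := chart_map_img ip.
have := pull0 (chart_map (chart_of i) p); rewrite pull_on// chart_mapK//.
move=> /eqP; rewrite !mulf_eq0 (gt_eqF psi_gt0) sqrtr_eq0 leNgt (metric_det_gt0 g Vx).
by rewrite orbF => /eqP.
Qed.

End CompactIntegration.

(** * The soliton *)

Section CovariantDerivativeAlongGradient.
Context {R : realType} {n : nat} {M : ptopologicalType}.
Context {A : smooth_manifold R n M} (g : riemannian_metric A).

Lemma ricci_smooth i a b :
  smooth_on (chart_img (chart_of i)) (fun y => ricci g i y a b).
Proof.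
have oV : open (chart_img (chart_of i)) by exact: chart_img_open.
have sG c d e := @christoffel_smooth _ _ _ _ g i c d e.
pose F y := \sum_l riemann g l b l a i y.
apply: (@smooth_on_eq _ _ _ F) => // [y _|]; first by rewrite mxE.
apply: smooth_on_sum => // l _; apply: smooth_onD => //.
  by apply: smooth_onB => //; exact: smooth_on_partial.
by apply: smooth_on_sum => // m _; apply: smooth_onB => //; exact: smooth_onM.
Qed.

Lemma raise_smooth (T : tfield A) i a b :
  (forall c d, smooth_on (chart_img (chart_of i)) (fun y => T i y c d)) ->
  smooth_on (chart_img (chart_of i)) (fun y => raise g T i y a b).
Proof.
move=> sT; have oV : open (chart_img (chart_of i)) by exact: chart_img_open.
apply: (@smooth_on_eq _ _ _ (fun y => \sum_c T i y a c * invmx (g i y) c b)) => // [y _|].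
  by rewrite mxE.
by apply: smooth_on_sum => // c _; apply: smooth_onM => //; exact: inv_metric_smooth.
Qed.

Lemma eval2_smooth (T : tfield A) (X : vfield A) i :
  (forall c d, smooth_on (chart_img (chart_of i)) (fun y => T i y c d)) ->
  (forall c, smooth_on (chart_img (chart_of i)) (fun y => X i y 0 c)) ->
  smooth_on (chart_img (chart_of i)) (eval2 T X X i).
Proof.
move=> sT sX; have oV : open (chart_img (chart_of i)) by exact: chart_img_open.
pose F y := \sum_b (\sum_a X i y 0 a * T i y a b) * X i y 0 b.
apply: (@smooth_on_eq _ _ _ F) => // [y _|].
  by rewrite /eval2 mxE; apply: eq_bigr => b _; rewrite !mxE.
apply: smooth_on_sum => // b _; apply: smooth_onM => //.
by apply: smooth_on_sum => // a _; exact: smooth_onM.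
Qed.

Variable f : M -> R.
Hypothesis sf : smooth_function A f.
Let X := grad g (local_expr A f).
Hypothesis sX : smooth_vfield X.
Let L := lie X g.
Let sL : smooth_tfield L := lie_smooth_tfield sX (metric_smooth g).

(* Twice the covariant derivative of [X] along itself, since the covariant
   derivative of a gradient field [X] is half of [L_X g] with an index raised. *)
Definition nabla_along : vfield A := fun i x => X i x *m raise g L i x.

(** Equal to 2 div X. *)
Definition lie_trace : sfield A := fun i x => \tr (raise g L i x).

(** |L_X g|^2 = 4 |D X|^2. *)
Definition lie_sqr_norm : sfield A :=
  fun i x => \tr (raise g L i x *m raise g L i x).

(** Twice X(div X) + Ric(X, X) + |D X|^2, expressed through L_X g: X(div X) is half of X(tr L) and
    |D X|^2 a quarter of |L|^2. *)
Definition div_nabla_along : sfield A := fun i x =>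
  directional X lie_trace i x + 2 * eval2 (ricci g) X X i x
  + 2^-1 * lie_sqr_norm i x.

Lemma lie_trace_smooth i : smooth_on (chart_img (chart_of i)) (lie_trace i).
Proof.
have oV : open (chart_img (chart_of i)) by exact: chart_img_open.
by apply: smooth_on_sum => // a _; apply: raise_smooth; exact: sL.1.
Qed.

Lemma nabla_along_smooth i b :
  smooth_on (chart_img (chart_of i)) (fun y => nabla_along i y 0 b).
Proof.
have oV : open (chart_img (chart_of i)) by exact: chart_img_open.
apply: (@smooth_on_eq _ _ _ (fun y => \sum_a X i y 0 a * raise g L i y a b)) => // [y _|].
  by rewrite mxE.
apply: smooth_on_sum => // a _; apply: smooth_onM => //; first exact: sX.1.
by apply: raise_smooth; exact: sL.1.
Qed.

Lemma divergence_nabla_along i x : chart_img (chart_of i) x ->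
  \sum_b partial b (fun y => volume_density g i y * nabla_along i y 0 b) x =
  volume_density g i x * div_nabla_along i x.
Proof.
set V := chart_img _ => Vx; have oV : open V by exact: chart_img_open.
pose N := nabla g i X.
have NE y a b : V y -> raise g L i y a b = 2 * N a b y.
  move=> Vy; rewrite /N nabla_grad; [|exact: sf|by []].
  by rewrite [X in _ = 2 * X]mxE mulrA mulfV ?mul1r// pnatr_eq0.
have sXi a : smooth_on V (fun y => X i y 0 a) by exact: sX.1.
have sN a b : smooth_on V (N a b) by exact: nabla_smooth.
pose S b y := \sum_a X i y 0 a * N a b y.
have sS b : smooth_on V (S b).
  by apply: smooth_on_sum => // a _; exact: smooth_onM.
have ZE b y : V y -> nabla_along i y 0 b = 2 * S b y.
  move=> Vy; rewrite mxE mulr_sumr; apply: eq_bigr => a _.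
  by rewrite NE// mulrCA.
pose w := volume_density g i.
have hw : has_partials w x := Ck_on_has_partials (volume_density_smooth g i) Vx.
have hS b : has_partials (S b) x := smooth_on_has_partials (sS b) Vx.
have h2 : has_partials (fun=> 2 : R) x by exact: has_partials_cst.
have hN : has_partials (fun y => \sum_b N b b y) x.
  by apply: has_partials_sum => b _; exact: smooth_on_has_partials (sN b b) Vx.
(* The derivative of the density supplies the contracted Christoffel symbol, which puts the sum over
   b in the form of [bochner_yano]. *)
have pE b : partial b (fun y => w y * nabla_along i y 0 b) x =
    w x * 2 * ((\sum_a christoffel g a a b i x) * S b x + partial b (S b) x).
  rewrite (@partial_eq_on _ _ V b _ (fun y => w y * (2 * S b y)) x oV Vx); last first.
    by move=> y Vy; rewrite ZE.
  rewrite (partialM b hw (has_partialsM h2 (hS b))) (partialM b h2 (hS b)) partial_cst.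
  rewrite [partial b w x]partial_sqrt_det// -/(volume_density g i x) -/(w x).
  move: (w x) (\sum_a _) (S b x) (partial b (S b) x) => p q r s.
  by ring.
rewrite (eq_bigr _ (fun b _ => pE b)) -mulr_sumr big_split/= addrC -mulrA.
rewrite (@bochner_yano _ _ _ _ g i X sXi x Vx); congr (_ * _).
rewrite /div_nabla_along !mulrDr; congr (_ + _ + _).
- rewrite mulr_sumr; apply: eq_bigr => a _; rewrite mulrCA; congr (_ * _).
  rewrite [RHS](@partial_eq_on _ _ V a _ (fun y => 2 * \sum_b N b b y) x oV Vx).
    by rewrite (partialM a h2 hN) partial_cst mul0r add0r.
  by move=> y Vy; rewrite mulr_sumr; apply: eq_bigr => b _; rewrite NE.
- rewrite /lie_sqr_norm /mxtrace exchange_big/= !mulr_sumr; apply: eq_bigr => a _.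
  rewrite mxE !mulr_sumr; apply: eq_bigr => b _; rewrite !NE// -/N.
  by move: (N a b x) (N b a x) => p q; field.
Qed.

Lemma eval2_metric_grad (u : sfield A) i x : chart_img (chart_of i) x ->
  eval2 g X (grad g u) i x = directional X u i x.
Proof.
move=> Vx; rewrite /eval2 -mulmxA mxE; apply: eq_bigr => a _; congr (_ * _).
rewrite mxE -(grad_lower g u a Vx); apply: eq_bigr => b _.
by rewrite mxE (metricC g a b Vx) mulrC.
Qed.

Let covariant_L : covariant_field L := sL.2.

Lemma directional_lie_trace_scalar : scalar_field (directional X lie_trace).
Proof.
apply: directional_scalar => [||i]; first exact: sX.2.
  exact: raise_trace_scalar.
exact: lie_trace_smooth.
Qed.

Lemma directional_smooth i (u : sfield A) :
  smooth_on (chart_img (chart_of i)) (u i) ->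
  smooth_on (chart_img (chart_of i)) (directional X u i).
Proof.
move=> su; have oV : open (chart_img (chart_of i)) by exact: chart_img_open.
apply: smooth_on_sum => // a _; apply: smooth_onM => //; first exact: sX.1.
exact: smooth_on_partial.
Qed.

Lemma lie_sqr_norm_smooth i : smooth_on (chart_img (chart_of i)) (lie_sqr_norm i).
Proof.
have oV : open (chart_img (chart_of i)) by exact: chart_img_open.
have sr a b := raise_smooth a b (sL.1 i).
pose F y := \sum_a \sum_b raise g L i y a b * raise g L i y b a.
apply: (@smooth_on_eq _ _ _ F) => // [y _|].
  by apply: eq_bigr => a _; rewrite mxE.
by apply: smooth_on_sum => // a _; apply: smooth_on_sum => // b _; exact: smooth_onM.
Qed.

End CovariantDerivativeAlongGradient.

Section CompactSoliton.
Context {R : realType} {n : nat} {M : ptopologicalType}.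
Context {A : smooth_manifold R n M} (g : riemannian_metric A).
Variables (f : M -> R) (lambda mu : R).
Hypothesis sf : smooth_function A f.
Let X := grad g (local_expr A f).
Let L := lie X g.
Hypothesis soliton : hyperbolic_ricci_soliton g X lambda mu.
Let sX : smooth_vfield X := soliton.1.
Let sL : smooth_tfield L := lie_smooth_tfield sX (metric_smooth g).

Lemma soliton_ricciE i x : chart_img (chart_of i) x ->
  ricci g i x = mu *: g i x - lie X L i x - lambda *: L i x.
Proof.
by move=> /soliton.2 <-; rewrite -[RHS]addrA -opprD [RHS]addrAC subrr add0r.
Qed.

(** Every other term of the soliton equation is known to be a covariant tensor, so Ricci is one
    too. *)
Lemma soliton_ricci_covariant : covariant_field (ricci g).
Proof.
move=> i j x Ox /=; have [Vx _] := Ox.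
rewrite soliton_ricciE// soliton_ricciE; last exact: transition_img.
rewrite (metric_covariant g Ox) (sL.2 i j x Ox).
rewrite ((lie_smooth_tfield sX sL).2 i j x Ox).
by rewrite !mulmxBr !mulmxBl -!scalemxAr -!scalemxAl.
Qed.

Lemma soliton_scalar_curvature i x : trace_free g (lie X L) ->
  chart_img (chart_of i) x ->
  scalar_curvature g i x = mu * n%:R - lambda * lie_trace g f i x.
Proof.
move=> tf Vx; rewrite /scalar_curvature trace_metric_raise// /raise soliton_ricciE//.
rewrite !mulmxBl -!scalemxAl mulmxV ?metric_unit// !linearB/= !linearZ/= mxtrace1.
by have := tf i x Vx; rewrite trace_metric_raise// => ->; rewrite subr0.
Qed.

End CompactSoliton.

Theorem theorem2p5 (R : realType) (n : nat) (M : ptopologicalType)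
    (A : smooth_manifold R n M) (g : riemannian_metric A)
    (vol : {measure set (borel M) -> \bar R})
    (f : M -> R) (lambda mu : R) :
  let xi := grad g (local_expr A f) in
  compact [set: M] ->
  is_riemannian_measure g vol ->
  smooth_function A f ->
  hyperbolic_ricci_soliton g xi lambda mu ->
  lambda != 0 ->
  trace_free g (lie xi (lie xi g)) ->
  \int[vol]_p value_at (eval2 (ricci g) xi xi) p
    >= (2 * lambda)^-1 *
       \int[vol]_p value_at (eval2 g xi (grad g (scalar_curvature g))) p ->
  trivial_soliton g xi.
Proof.
move=> X cM volP sf soliton l0 tf ineq; set L := lie X g in tf.
have sX : smooth_vfield X := soliton.1.
have sL : smooth_tfield L := lie_smooth_tfield sX (metric_smooth g).
have Vp p : chart_img (chart_of (index_at A p)) (chart_map (chart_of (index_at A p)) p).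
  exact/chart_map_img/index_atP.
have scont (s : sfield A) : scalar_field s ->
    (forall i, smooth_on (chart_img (chart_of i)) (s i)) -> continuous (value_at s).
  move=> ss sms; apply: value_at_continuous => // i x Vx.
  exact: Ck_on_continuous (sms i 1%N) Vx.
pose a := directional X (lie_trace g f).
pose b := eval2 (ricci g) X X.
pose c := lie_sqr_norm g f.
have sa : scalar_field a by exact: directional_lie_trace_scalar.
have sb : scalar_field b.
  by apply: eval2_scalar; [exact: (soliton_ricci_covariant soliton)|exact: sX.2|exact: sX.2].
have sc : scalar_field c by apply: raise_sqr_trace_scalar; exact: sL.2.
have sma i : smooth_on (chart_img (chart_of i)) (a i).
  by apply: directional_smooth => //; exact: lie_trace_smooth.
have smb i : smooth_on (chart_img (chart_of i)) (b i).
  by apply: eval2_smooth => [d e|d]; [exact: ricci_smooth|exact: sX.1].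
have smc i : smooth_on (chart_img (chart_of i)) (c i) by exact: lie_sqr_norm_smooth.
have ca := scont a sa sma; have cb := scont b sb smb; have cc := scont c sc smc.
have ia := continuous_integrable volP cM ca.
have ib := continuous_integrable volP cM cb.
have ic := continuous_integrable volP cM cc.
pose h := div_nabla_along g f.
have hE : value_at h = fun p => value_at a p + 2 * value_at b p + 2^-1 * value_at c p.
  by [].
have [_ ih] : vol.-integrable setT (fun p => (value_at h p)%:E) /\
    (\int[vol]_p (value_at h p)%:E = 0)%E.
  apply: (@divergence_theorem _ _ _ _ g vol volP (nabla_along g f)) => //.
  - by apply: raise_vector; [exact: sL.2|exact: sX.2].
  - move=> i j x Ox; rewrite /h /div_nabla_along -/X.
    by rewrite -/(a i x) -/(b i x) -/(c i x) (sa i j x Ox) (sb i j x Ox) (sc i j x Ox).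
  - by move=> i d; exact: (nabla_along_smooth sX i d 1%N).
  - move=> i x Vx; have oV : open (chart_img (chart_of i)) by exact: chart_img_open.
    have sh : smooth_on (chart_img (chart_of i)) (h i).
      apply: smooth_onD => //; first apply: smooth_onD => //.
        by apply: smooth_onM => //; exact: smooth_on_cst.
      by apply: smooth_onM => //; exact: smooth_on_cst.
    exact: Ck_on_continuous (sh 1%N) Vx.
  - by move=> i x Vx; exact: divergence_nabla_along.
(* g(X, grad r) = X(r), and r = n mu - lambda tr L near the point, with constant first term. *)
have cE p : value_at (eval2 g X (grad g (scalar_curvature g))) p = - lambda * value_at a p.
  rewrite /value_at; move: (index_at A p) (chart_map _ p) (Vp p) => i x Vx.
  have oV : open (chart_img (chart_of i)) by exact: chart_img_open.
  rewrite eval2_metric_grad// /a /directional mulr_sumr; apply: eq_bigr => d _.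
  rewrite mulrCA; congr (_ * _).
  pose m (y : 'rV[R]_n) := mu * n%:R + - lambda * lie_trace g f i y.
  rewrite (@partial_eq_on _ _ _ d _ m x oV Vx).
    have hN : has_partials (lie_trace g f i) x.
      exact: smooth_on_has_partials (lie_trace_smooth sX i) Vx.
    have hc (e : R) : has_partials (fun=> e) x by exact: has_partials_cst.
    rewrite (partialD d (hc _) (has_partialsM (hc _) hN)) (partialM d (hc _) hN).
    by rewrite !partial_cst mul0r !add0r.
  by move=> y Vy; rewrite /m (soliton_scalar_curvature soliton tf Vy) mulNr.
(* The factor (2 lambda)^-1 times -lambda is -1/2 whatever the sign of lambda. *)
have ineq' : - (2^-1 * \int[vol]_p value_at a p) <= \int[vol]_p value_at b p.
  apply: le_trans ineq; under [X in _ <= _ * X]eq_Rintegral => p _ do rewrite cE.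
  rewrite RintegralZl// mulrA; move: (Rintegral _ _ _) => I.
  by rewrite (_ : _ * - lambda = - 2^-1) ?mulNr//; field.
have c0 p : 0 <= value_at c p.
  rewrite /value_at; move: (index_at A p) (chart_map _ p) (Vp p) => i x Vx.
  by have [+ _] := posdef_trace (metric_posdef g Vx) (lie_grad_sym g (local_expr A f) Vx).
have intc : (\int[vol]_p (value_at c p)%:E = 0)%E.
  have ia' : vol.-integrable setT (EFin \o (fun p => value_at a p)) by exact: ia.
  have i2b : vol.-integrable setT (EFin \o (fun p => 2 * value_at b p)).
    by have := integrableZl measurableT 2 ib; apply: eq_integrable.
  have i2c : vol.-integrable setT (EFin \o (fun p => 2^-1 * value_at c p)).
    by have := integrableZl measurableT 2^-1 ic; apply: eq_integrable.
  have iab : vol.-integrable setT (EFin \o (fun p => value_at a p + 2 * value_at b p)).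
    by have := integrableD measurableT ia i2b; apply: eq_integrable.
  have : \int[vol]_p (value_at a p + 2 * value_at b p + 2^-1 * value_at c p) = 0.
    by rewrite -[RHS](congr1 fine ih).
  rewrite RintegralD// RintegralD// !RintegralZl// => sum0.
  have Ic0 : 0 <= \int[vol]_p value_at c p by apply: Rintegral_ge0 => p _; exact: c0.
  (* With a, b, c now denoting integrals, a + 2 b + c / 2 = 0 and b >= - a / 2 force c <= 0. *)
  rewrite -[LHS]fineK ?integrable_fin_num// -/(Rintegral vol setT (value_at c)).
  congr EFin; apply/eqP; rewrite eq_le Ic0 andbT.
  move: ineq' sum0; move: (\int[vol]_p value_at a p) (\int[vol]_p value_at b p).
  by move: (\int[vol]_p value_at c p) => r p q pq s0; clear -pq s0; lra.
move=> i x Vx.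
have cx : c i x = 0.
  by rewrite -(value_at_inv sc Vx); apply: (continuous_integral_eq0 volP cc c0 intc).
(* The trace of (L g^-1)^2 vanishes at the point, which for symmetric L and positive definite g
   means L = 0. *)
have [_ +] := posdef_trace (metric_posdef g Vx) (lie_grad_sym g (local_expr A f) Vx).
by apply.
Qed.
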